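(* Let $M^{2n}$ be a quasitoric manifold, with its action of the torus $T^n$. Then $M$ admits a $T^n$-invariant Riemannian metric with respect to which the $T^n$-action on $M$ is polar.
   Context: All manifolds are connected and all actions are differentiable (smooth). The torus is $T^n=(S^1)^n$. Standard representation: $T^n$ acts on $\mathbb{C}^n$ by coordinatewise complex multiplication. Locally standard: an action of $T^n$ on a $2n$-dimensional manifold $M^{2n}$ is locally standard if every point has a $T^n$-invariant neighborhood $U$ for which there exist an automorphism $\rho\in\operatorname{Aut}(T^n)$ and a diffeomorphism $f$ from $U$ onto an open $T^n$-invariant subset of $\mathbb{C}^n$ (with the standard $T^n$-action) such that $f(tx)=\rho(t)f(x)$ for all $t\in T^n$, $x\in U$. Quasitoric manifold: a closed $2n$-dimensional manifold $M^{2n}$ equipped with a locally standard $T^n$-action such that the orbit space $M/T^n$ is an $n$-dimensional simple polytope (a convex polytope in which every vertex lies in exactly $n$ facets). Polar action: let a Lie group $G$ act by isometries on a Riemannian manifold $M$, with cohomogeneity $q$ (the codimension of the principal orbits). The action is polar if there is an immersed submanifold $\Sigma$ of $M$ of dimension $q$ (a section) that meets all orbits and such that the intersection with the orbits is everywhere orthogonal. *)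

(* Defs.v *)
From HB Require Import structures.
From mathcomp Require Import all_boot all_order all_algebra.
From mathcomp Require Import all_classical all_reals all_analysis.

Set Implicit Arguments.
Unset Strict Implicit.
Unset Printing Implicit Defensive.

Import Order.TTheory GRing.Theory Num.Theory.
Import numFieldNormedType.Exports.

Local Open Scope classical_set_scope.
Local Open Scope ring_scope.

(** * Smooth maps between finite-dimensional normed spaces *)

(* [A] is meant to be open, so that continuity, differentiability and
   directional derivatives at the points of [A] only depend on [f] on [A]. *)
Fixpoint Ck_on (R : realType) (V W : normedModType R) (k : nat)
    (f : V -> W) (A : set V) : Prop :=
  match k with
  | 0 => forall x, A x -> {for x, continuous f}
  | k'.+1 => (forall x, A x -> differentiable f x) /\
             (forall v, Ck_on k' (fun x => 'D_v f x) A)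
  end.

Definition smooth_on (R : realType) (V W : normedModType R)
    (f : V -> W) (A : set V) : Prop := forall k, Ck_on k f A.

(** * Manifolds *)

(* [fwd] is only meaningful on [dom], and [bwd] only on [fwd @` dom]. *)
Record chart (R : realType) (M : topologicalType) (E : normedModType R) :=
  Chart { dom : set M; fwd : M -> E; bwd : E -> M }.

Section Charts.
Context {R : realType} {M : topologicalType}.

Definition is_chart (E : normedModType R) (c : chart M E) : Prop :=
  [/\ open (dom c), open (fwd c @` dom c),
      (forall x, dom c x -> {for x, continuous (fwd c)}),
      (forall u, (fwd c @` dom c) u -> {for u, continuous (bwd c)})
    & (forall x, dom c x -> bwd c (fwd c x) = x)].

Definition compatible (E F : normedModType R)
    (c : chart M E) (d : chart M F) : Prop :=
  smooth_on (fwd d \o bwd c) (fwd c @` (dom c `&` dom d)) /\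
  smooth_on (fwd c \o bwd d) (fwd d @` (dom c `&` dom d)).

End Charts.

(* The atlas need not be maximal; all notions below are independent of the
   choice of an atlas defining the smooth structure. Charts have open image in
   R^m, so there is no boundary. *)
Record manifold (R : realType) (m : nat) := Manifold {
  carrier :> topologicalType;
  atlas : set (chart carrier 'rV[R]_m);
  manifold_hausdorff : hausdorff_space carrier;
  manifold_second_countable : @second_countable carrier;
  manifold_nonempty : [set: carrier] !=set0;
  manifold_connected : connected [set: carrier];
  atlas_chart : forall c, atlas c -> is_chart c;
  atlas_cover : forall x, exists2 c, atlas c & dom c x;
  atlas_compatible : forall c d, atlas c -> atlas d -> compatible c d }.

Section Maps.
Context {R : realType}.

Definition smooth_map (m p : nat) (M : manifold R m) (N : manifold R p)
    (f : M -> N) : Prop :=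
  continuous f /\
  forall c d, atlas c -> atlas d ->
    smooth_on (fwd d \o f \o bwd c) (fwd c @` (dom c `&` f @^-1` dom d)).

(* The differential of [f] at [x], in the charts [c] at [x] and [d] at [f x].
   Tangent vectors are row vectors, on which it acts by right product. *)
Definition tangent_mx (m p : nat) (M N : topologicalType)
    (c : chart M 'rV[R]_m) (d : chart N 'rV[R]_p) (f : M -> N) (x : M) :
    'M[R]_(m, p) :=
  jacobian (fwd d \o f \o bwd c) (fwd c x).

Definition injective_immersion (m p : nat) (M : manifold R m)
    (N : manifold R p) (f : M -> N) : Prop :=
  [/\ smooth_map f, injective f
    & forall x c d, atlas c -> atlas d -> dom c x -> dom d (f x) ->
        row_free (tangent_mx c d f x)].

(** * Riemannian metrics *)

(* [g c x] is the Gram matrix at [x], in the chart [c], of the inner product of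
   the tangent space at [x]; it is only meaningful for [c] in the atlas and [x]
   in [dom c]. The last condition says that these matrices, for the various
   charts at [x], represent the same inner product. *)
Definition riemannian_metric (m : nat) (M : manifold R m)
    (g : chart M 'rV[R]_m -> M -> 'M[R]_m) : Prop :=
  [/\ (forall c x, atlas c -> dom c x -> (g c x)^T = g c x),
      (forall c x (v : 'rV[R]_m), atlas c -> dom c x -> v != 0 ->
         0 < (v *m g c x *m v^T) 0 0),
      (forall c, atlas c -> smooth_on (g c \o bwd c) (fwd c @` dom c))
    & (forall c d x, atlas c -> atlas d -> dom c x -> dom d x ->
         g c x = tangent_mx c d id x *m g d x *m (tangent_mx c d id x)^T)].

Definition isometric (m : nat) (M : manifold R m)
    (g : chart M 'rV[R]_m -> M -> 'M[R]_m) (f : M -> M) : Prop :=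
  forall c d x, atlas c -> atlas d -> dom c x -> dom d (f x) ->
    g c x = tangent_mx c d f x *m g d (f x) *m (tangent_mx c d f x)^T.

(** * The torus and its actions *)

(* C^n as a real normed space: [(x, y)] stands for [x + i y]. *)
Definition Cn (n : nat) : normedModType R := ('rV[R]_n * 'rV[R]_n)%type.

Definition cmul (n : nat) (z w : Cn n) : Cn n :=
  (\row_k (z.1 0 k * w.1 0 k - z.2 0 k * w.2 0 k),
   \row_k (z.1 0 k * w.2 0 k + z.2 0 k * w.1 0 k)).

Definition cone (n : nat) : Cn n := (const_mx 1, 0).

(* T^n = (S^1)^n, a group under [cmul] with unit [cone]. *)
Definition torus (n : nat) : set (Cn n) :=
  [set t : Cn n | forall k : 'I_n, t.1 0 k ^+ 2 + t.2 0 k ^+ 2 = 1].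

(* The covering a |-> (exp (i a_1), ..., exp (i a_n)) of T^n by R^n. It is a
   surjective local diffeomorphism, so a map defined on T^n, or on the product
   of T^n with a manifold, is smooth if and only if its composition with [cexp]
   is; it also identifies the Lie algebra of T^n with R^n. *)
Definition cexp (n : nat) (a : 'rV[R]_n) : Cn n :=
  (\row_k cos (a 0 k), \row_k sin (a 0 k)).

(* Lie group automorphisms, i.e. smooth group automorphisms with smooth
   inverse; the values outside [torus n] are irrelevant. *)
Definition torus_endo (n : nat) (rho : Cn n -> Cn n) : Prop :=
  [/\ (forall t, torus t -> torus (rho t)),
      (forall s t, torus s -> torus t -> rho (cmul s t) = cmul (rho s) (rho t))
    & smooth_on (rho \o @cexp n) [set: 'rV[R]_n]].

Definition torus_auto (n : nat) (rho : Cn n -> Cn n) : Prop :=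
  torus_endo rho /\
  exists2 sigma, torus_endo sigma
    & forall t, torus t -> sigma (rho t) = t /\ rho (sigma t) = t.

Section Actions.
Context {m n : nat} (M : manifold R m).

(* In [act t x] only the [t] in [torus n] matter. *)
Implicit Type act : Cn n -> M -> M.

Definition smooth_torus_action act : Prop :=
  [/\ (forall x, act (cone n) x = x),
      (forall s t x, torus s -> torus t ->
         act (cmul s t) x = act s (act t x)),
      continuous (fun p : 'rV[R]_n * M => act (cexp p.1) p.2)
    & (forall c d, atlas c -> atlas d ->
         smooth_on
           (fun p : 'rV[R]_n * 'rV[R]_m => fwd d (act (cexp p.1) (bwd c p.2)))
           [set p | (fwd c @` dom c) p.2 /\
                    dom d (act (cexp p.1) (bwd c p.2))])].

Definition same_orbit act (x y : M) : Prop := exists2 t, torus t & y = act t x.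

Definition stabilizer act (x : M) : set (Cn n) :=
  [set t | torus t /\ act t x = x].

(* The differential at the unit of the orbit map t |-> t x, in the chart [c];
   its row space is the tangent space at [x] of the orbit of [x]. *)
Definition orbit_mx act (c : chart M 'rV[R]_m) (x : M) : 'M[R]_(n, m) :=
  jacobian (fun a : 'rV[R]_n => fwd c (act (cexp a) x)) 0.

Definition orbit_dim act (x : M) (k : nat) : Prop :=
  forall c, atlas c -> dom c x -> \rank (orbit_mx act c x) = k.

(* The orbit of [x] has the maximal orbit type. In general the isotropy group
   of [x] has to be subconjugate to all the others; the torus is abelian. *)
Definition principal act (x : M) : Prop :=
  forall y, stabilizer act x `<=` stabilizer act y.

Definition cohomogeneity act (q : nat) : Prop :=
  exists x k, [/\ principal act x, orbit_dim act x k & (q + k)%N = m].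

(* The section is the image of [iota]; it is connected, as all manifolds are. *)
Definition polar act (g : chart M 'rV[R]_m -> M -> 'M[R]_m) : Prop :=
  exists q, cohomogeneity act q /\
  exists (Sigma : manifold R q) (iota : Sigma -> M),
    [/\ injective_immersion iota,
        (forall x, exists s, same_orbit act x (iota s))
      & (forall s b c, atlas b -> atlas c -> dom b s -> dom c (iota s) ->
           tangent_mx b c iota s *m g c (iota s) *m
             (orbit_mx act c (iota s))^T = 0)].

(* For [f] a [Cn n]-valued chart, being a diffeomorphism from [dom f] onto
   [fwd f @` dom f] is compatibility with the atlas. The latter set is
   automatically invariant, since [dom f] is. *)
Definition locally_standard act : Prop :=
  forall x, exists (f : chart M (Cn n)) (rho : Cn n -> Cn n),
    [/\ dom f x,
        (forall t y, torus t -> dom f y -> dom f (act t y)),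
        torus_auto rho,
        is_chart f /\ (forall c, atlas c -> compatible c f)
      & forall t y, torus t -> dom f y ->
          fwd f (act t y) = cmul (rho t) (fwd f y)].

End Actions.

(** * Simple polytopes *)

Section Polytopes.
Context {n : nat}.
Implicit Types P F : set 'rV[R]_n.

(* The convex hull of the rows of some matrix [V]. *)
Definition polytope P : Prop :=
  exists (k : nat) (V : 'M[R]_(k, n)),
    P = [set x | exists w : 'rV[R]_k,
           [/\ forall i, 0 <= w 0 i, \sum_i w 0 i = 1 & x = w *m V]].

(* [B] spans the direction of the affine hull of [F]; in particular [F] is
   nonempty. *)
Definition affine_dim F (d : nat) : Prop :=
  exists (p : 'rV[R]_n) (B : 'M[R]_n),
    [/\ F p, (forall x, F x -> (x - p <= B)%MS),
        (forall C : 'M[R]_n, (forall x, F x -> (x - p <= C)%MS) ->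
           (B <= C)%MS)
      & \rank B = d].

(* The polytope itself and the empty set are faces. *)
Definition face P F : Prop :=
  exists (u : 'cV[R]_n) (b : R),
    (forall x, P x -> (x *m u) 0 0 <= b) /\
    F = [set x | P x /\ (x *m u) 0 0 = b].

Definition facet P F : Prop :=
  face P F /\ exists2 d, d.+1 = n & affine_dim F d.

Definition face_interior P F : set 'rV[R]_n :=
  [set x | F x /\ forall G, face P G -> G `<=` F -> G x -> G = F].

Definition simple_polytope P : Prop :=
  [/\ polytope P, affine_dim P n
    & forall v, face P [set v] ->
        ([set F | facet P F /\ F v] #= `I_n)%card].

End Polytopes.

(** * Quasitoric manifolds *)

(* "The orbit space is the simple polytope P" is meant as manifolds with
   corners: [pi] induces a homeomorphism from the orbit space onto P (it is
   continuous, open onto P, and its fibres are the orbits) which maps the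
   k-dimensional orbits to interior points of the k-dimensional faces. *)
Definition orbit_space_simple_polytope (m n : nat) (M : manifold R m)
    (act : Cn n -> M -> M) : Prop :=
  exists (P : set 'rV[R]_n) (pi : M -> 'rV[R]_n),
    [/\ simple_polytope P,
        continuous pi /\ range pi = P,
        (forall U, open U -> exists2 V, open V & pi @` U = P `&` V),
        (forall x y, pi x = pi y <-> same_orbit act x y)
      & (forall x k, orbit_dim act x k ->
           exists F, [/\ face P F, affine_dim F k
                       & face_interior P F (pi x)])].

Definition quasitoric (n : nat) (M : manifold R (2 * n))
    (act : Cn n -> M -> M) : Prop :=
  [/\ smooth_torus_action act, compact [set: M], locally_standard act
    & orbit_space_simple_polytope act].

End Maps.

(* Main.v *)
(* Call a subset S of M real if, near each of its orbits, some standard chart maps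
   S onto the points of C^n with real coordinates. Two real subsets S1, S2 near
   an orbit differ by a twist: S2 = {y | eta(y) y in S1} for a smooth invariant
   R^n-valued function eta, the torus acting through exp. Indeed in standard
   charts the components of the transition map are equivariant functions, and
   their arguments on the nonnegative orthant extend to smooth invariant
   functions, after division by the coordinate z_j where a component vanishes.
   The function eta is unique up to half periods, hence unique up to a constant
   over a connected part of the polytope. As convex sets intersected with boxes
   are convex, eta exists over any box, by bisection of the box, and then real
   subsets over the two halves of a box can be glued by twisting one of them with
   a cut-off of eta. So there is a global real subset. It is a closed
   n-dimensional submanifold that meets all orbits, and it is connected: its
   projection to the polytope is open and closed on each of its clopen parts, and
   the fibre over a vertex is a single fixed point. The metric is a sum of
   pullbacks of the flat metric of C^n by standard charts in which S is the real
   part, weighted by invariant bump functions: R^n is orthogonal to the torus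
   orbits of its points. *)

Require Import Defs.
From HB Require Import structures.
From mathcomp Require Import all_boot all_order all_algebra.
From mathcomp Require Import all_classical all_reals all_analysis.
From mathcomp Require Import ring lra.

Set Implicit Arguments.
Unset Strict Implicit.
Unset Printing Implicit Defensive.

Import Order.TTheory GRing.Theory Num.Theory.
Import numFieldNormedType.Exports.

Local Open Scope classical_set_scope.
Local Open Scope ring_scope.

(** * Smooth maps *)

(** The nonnegative orthant meets each orbit of C^n once, but it has corners; its union with its
    reflections is R^n, which is smooth. Hence the real subset meets a free orbit in 2^n points and
    comparisons are possible up to signs only: arguments matter modulo pi, which is why conditions
    below have the form [sin = 0] or [u sin psi = v cos psi]. No smooth structure is put on the
    polytope: smooth invariant functions on M and saturated open sets take its place. The obstacle
    in comparing two real subsets lies at the nonfree orbits, where a component of the transition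
    map may have no argument. Since that map is invertible, such a zero is of first order, and of
    weight 1 or -1 in a single coordinate, so the quotient has no zero nearby. Real subsets cannot
    be averaged by a partition of unity; instead of a cohomology argument, the constancy of half
    periods over convex walls makes the gluing consistent. *)

Lemma open_setI_preimage (T U : topologicalType) (f : T -> U) (A : set T) (B : set U) :
  open A -> (forall x, A x -> {for x, continuous f}) -> open B ->
  open (A `&` f @^-1` B).
Proof.
move=> oA cf oB; rewrite openE => x [Ax Bfx]; apply: filterI.
  exact: open_nbhs_nbhs.
have : nbhs (f x) B by exact: open_nbhs_nbhs.
exact: cf.
Qed.

Lemma continuous_pair (T U V : topologicalType) (f : T -> U) (g : T -> V) x :
  {for x, continuous f} -> {for x, continuous g} ->
  {for x, continuous (fun y => (f y, g y))}.
Proof.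
move=> cf cg.
have : (fun y => (f y, g y)) @ x --> (f x, g x) by exact: cvg_pair.
by [].
Qed.

Section Calculus.
Context {R : realType}.
Implicit Types V W X : normedModType R.

(** The difference [g - f] vanishes near [x], so it is little-o of anything and its differential at
    [x] is zero. *)
Lemma near_eq_differentiable V W (f g : V -> W) x :
  (\near x, f x = g x) -> differentiable f x -> differentiable g x.
Proof.
move=> fg df; have fgx := nbhs_singleton fg.
have -> : g = f + (g - f) by apply/funext => y /=; rewrite -[RHS]/(f y + (g y - f y)) addrC subrK.
apply: differentiableD => //; apply/diff_locallyP.
have d0 : 'd (g - f) x = 0 :> (V -> W) /\
    ((g - f) \o shift x = cst ((g - f) x) + 0 +o_ (0 : V) id).
  have E : (g - f) \o shift x = cst ((g - f) x) + 0 +o_ (0 : V) id.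
    apply/eqaddoP => e e0.
    have : \forall y \near (0 : V), f (y + x) = g (y + x).
      by move: fg; rewrite (near_shift 0 x); apply: filterS => y /=; rewrite subr0.
    apply: filterS => y fgy; rewrite /= -[X in `|X|]/(g (y + x) - f (y + x) - (g x - f x + 0)).
    by rewrite fgy fgx !subrr addr0 subrr normr0 mulr_ge0 // ltW.
  split => //.
  apply: (@diff_unique _ _ _ _ (\0 : {linear V -> W})) => //.
  by move=> y; apply: cst_continuous.
split; first by move=> y; rewrite d0.1; exact: cst_continuous.
by rewrite d0.1; exact: d0.2.
Unshelve. all: by end_near. Qed.

Lemma Ck_near k V W (f g : V -> W) (A : set V) :
  (forall x, A x -> \forall y \near x, f y = g y) -> Ck_on k f A -> Ck_on k g A.
Proof.
elim: k f g => [|k IH] f g fg /=.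
  move=> cf x Ax; have gf := nbhs_singleton (fg x Ax).
  apply: cvg_trans; first exact: near_eq_cvg (fg x Ax).
  by rewrite -gf; exact: cf.
move=> [df Df]; split=> [x Ax|v].
  by apply: near_eq_differentiable (df x Ax); exact: fg.
apply: IH (Df v) => x Ax; have /nbhs_interior := fg x Ax.
by apply: filterS => y fgy; apply: near_eq_derive.
Qed.

Lemma Ck_eq k V W (f g : V -> W) (A : set V) : open A ->
  (forall x, A x -> f x = g x) -> Ck_on k f A -> Ck_on k g A.
Proof.
move=> oA fg; apply: Ck_near => x Ax.
by have : nbhs x A by [exact: open_nbhs_nbhs]; apply: filterS.
Qed.

Lemma Ck_sub k V W (f : V -> W) (A B : set V) :
  B `<=` A -> Ck_on k f A -> Ck_on k f B.
Proof.
move=> BA; elim: k f => [|k IH] f /=; first by move=> cf x /BA; apply: cf.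
by move=> [df Df]; split=> [x /BA|v]; [exact: df|exact: IH].
Qed.

(** The iterated derivatives are functions on the whole space, so that being C^k on [A] is a
    condition at each point of [A] separately. Locality of smoothness follows from it. *)
Lemma Ck_pointwise k V W (f : V -> W) (A : set V) :
  (forall x, A x -> Ck_on k f [set x]) -> Ck_on k f A.
Proof.
elim: k f => [|k IH] f /= H; first by move=> x Ax; apply: (H x).
split=> [x Ax|v]; first by apply: (H x Ax).1.
by apply: IH => x Ax; apply: (H x Ax).2.
Qed.

Lemma Ck_cont k V W (f : V -> W) (A : set V) :
  Ck_on k f A -> forall x, A x -> {for x, continuous f}.
Proof.
by case: k => [//|k] [df _] x /df; apply: differentiable_continuous.
Qed.

Lemma CkW k V W (f : V -> W) (A : set V) : Ck_on k.+1 f A -> Ck_on k f A.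
Proof.
elim: k f => [|k IH] f; first exact: Ck_cont.
by move=> [df Df]; split => // v; apply: IH (Df v).
Qed.

Lemma Ck_cst k V W (w : W) (A : set V) : Ck_on k (fun=> w) A.
Proof.
elim: k w => [|k IH] w /=; first by move=> x _; exact: cst_continuous.
split=> [x _|v]; first exact: differentiable_cst.
have -> : 'D_v (fun=> w) = (fun=> 0 : W); last exact: IH.
by apply/funext => x; exact: derive_cst.
Qed.

Lemma Ck_comp_linear k V W X (L : {linear W -> X}) (f : V -> W) (A : set V) :
  open A -> continuous L -> Ck_on k f A -> Ck_on k (L \o f) A.
Proof.
move=> oA cL; elim: k f => [|k IH] f /=.
  by move=> cf x Ax; apply: continuous_comp; [exact: cf|exact: cL].
move=> [df Df]; split=> [x Ax|v].
  by apply: differentiable_comp; [exact: df|exact: linear_differentiable].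
apply: (@Ck_eq _ _ _ (L \o (fun x => 'D_v f x))) => //; last exact: IH.
move=> x Ax /=; rewrite deriveE; last exact: df.
rewrite deriveE; last first.
  by apply: differentiable_comp; [exact: df|exact: linear_differentiable].
rewrite [in RHS]diff_comp /=; [|exact: df|exact: linear_differentiable].
by rewrite diff_lin.
Qed.

Lemma CkD k V W (f g : V -> W) (A : set V) : open A ->
  Ck_on k f A -> Ck_on k g A -> Ck_on k (fun x => f x + g x) A.
Proof.
move=> oA; elim: k f g => [|k IH] f g /=.
  by move=> cf cg x Ax; apply: continuousD; [exact: cf|exact: cg].
move=> [df Df] [dg Dg]; split=> [x Ax|v].
  by apply: differentiableD; [exact: df|exact: dg].
apply: Ck_eq (IH _ _ (Df v) (Dg v)) => // x Ax.
by rewrite -deriveD //; apply: diff_derivable; [exact: df|exact: dg].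
Qed.

Lemma Ck_sum k V W (I : Type) (r : seq I) (P : pred I) (f : I -> V -> W)
    (A : set V) : open A ->
  (forall i, P i -> Ck_on k (f i) A) ->
  Ck_on k (fun x => \sum_(i <- r | P i) f i x) A.
Proof.
move=> oA Hf; elim: r => [|i r IH].
  by under eq_fun do rewrite big_nil; exact: Ck_cst.
under eq_fun do rewrite big_cons.
by case: (boolP (P i)) => // Pi; apply: CkD => //; exact: Hf.
Qed.

Lemma CkM k V (f g : V -> R) (A : set V) : open A ->
  Ck_on k f A -> Ck_on k g A -> Ck_on k (fun x => f x * g x) A.
Proof.
move=> oA; elim: k f g => [|k IH] f g.
  by move=> cf cg x Ax; apply: continuousM; [exact: cf|exact: cg].
move=> Cf Cg; have [df Df] := Cf; have [dg Dg] := Cg; split=> [x Ax|v].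
  by apply: differentiableM; [exact: df|exact: dg].
have := CkD oA (IH _ _ (CkW Cf) (Dg v)) (IH _ _ (CkW Cg) (Df v)).
apply: Ck_eq => // x Ax; rewrite deriveM //; apply: diff_derivable;
  [exact: df|exact: dg].
Qed.

(* Finite-dimensionality; a [normedModType] need not be a [vectType]. *)
Definition fdim W := exists (I : finType) (b : I -> W)
    (c : I -> {linear W -> R}),
  (forall i, continuous (c i)) /\ forall w, w = \sum_i c i w *: b i.

Lemma Ck_fdim l V W (I : finType) (b : I -> W) (c : I -> {linear W -> R})
    (f : V -> W) (A : set V) : open A ->
  (forall w, w = \sum_i c i w *: b i) ->
  (forall i, Ck_on l (fun x => c i (f x)) A) -> Ck_on l f A.
Proof.
move=> oA wE cf.
rewrite (_ : f = fun x => \sum_i c i (f x) *: b i); last first.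
  by apply/funext => x; rewrite -wE.
apply: Ck_sum => // i _.
have sl : linear ( *:%R ^~ (b i) : R -> W).
  by move=> u y z; rewrite scalerDl scalerA.
pose sM := GRing.isLinear.Build _ _ _ _ _ sl.
pose sL : {linear R -> W} := HB.pack ( *:%R ^~ (b i)) sM.
apply: (@Ck_comp_linear _ _ _ _ sL (fun x => c i (f x)) A oA) => //.
exact: scalel_continuous.
Qed.

(** In coordinates the chain rule reads ['D_v (h \o f) = sum_i c i ('D_v f) * ('D_(b i) h \o f)],
    and induction applies to each factor. The finite basis of the middle space turns the
    differential of [h], which varies with the point, into finitely many functions. *)
Lemma Ck_comp k V W X (g : W -> X) (f : V -> W) (A : set V) (B : set W) :
  fdim W -> fdim X -> open A -> open B -> (forall x, A x -> B (f x)) ->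
  Ck_on k f A -> Ck_on k g B -> Ck_on k (g \o f) A.
Proof.
move=> [p [b [c [cc cE]]]] [q [b' [c' [cc' cE']]]] oA oB AB.
(* Real values suffice, by the coordinates of the target; then only products of real functions
   occur. *)
suff H : forall (h : W -> R), Ck_on k f A -> Ck_on k h B -> Ck_on k (h \o f) A.
  move=> Cf Cg; apply: (Ck_fdim oA cE') => i.
  by apply: (H (c' i \o g)) => //; apply: Ck_comp_linear.
elim: k => [|k IH] h.
  by move=> cf ch x Ax; apply: continuous_comp; [exact: cf|exact/ch/AB].
move=> Cf Ch; have [df Df] := Cf; have [dh Dh] := Ch; split=> [x Ax|v].
  by apply: differentiable_comp; [exact: df|exact/dh/AB].
apply: (@Ck_eq _ _ _
  (fun x => \sum_i c i ('D_v f x) * ('D_(b i) h (f x)))) => //.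
  move=> x Ax.
  have -> : 'D_v (h \o f) x = 'd h (f x) ('D_v f x).
    rewrite deriveE; last first.
      by apply: differentiable_comp; [exact: df|exact/dh/AB].
    rewrite diff_comp /=; [|exact: df|exact/dh/AB].
    by rewrite [in RHS]deriveE //; exact: df.
  rewrite [in RHS](cE ('D_v f x)) linear_sum; apply: eq_bigr => i _.
  by rewrite linearZ /= -deriveE //; exact/dh/AB.
apply: Ck_sum => // i _; apply: CkM => //.
  exact: (Ck_comp_linear oA (cc i) (Df v)).
by apply: (IH (fun y => 'D_(b i) h y)); [exact: CkW|exact: Dh].
Qed.

Lemma CkZl k V (a : R) (f : V -> R) (A : set V) : open A ->
  Ck_on k f A -> Ck_on k (fun x => a * f x) A.
Proof. by move=> oA; apply: CkM => //; exact: Ck_cst. Qed.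

Lemma CkN k V (f : V -> R) (A : set V) : open A ->
  Ck_on k f A -> Ck_on k (fun x => - f x) A.
Proof. by move=> oA /(CkZl (-1) oA); under eq_fun do rewrite mulN1r. Qed.

(** Functions whose derivative is expressed by the same family (sine and cosine, inverse, square
    root) become smooth by induction on [k]. *)
Lemma Ck_scalar k (phi phi' : R -> R) (B : set R) : open B ->
  (forall y, B y -> is_derive y 1 phi (phi' y)) -> Ck_on k phi' B ->
  Ck_on k.+1 phi B.
Proof.
move=> oB dphi Cphi'; split=> [y By|v].
  by apply/derivable1_diffP; have [] := dphi y By.
apply: Ck_eq (CkZl v oB Cphi') => // y By.
have [dy <-] := dphi y By; rewrite !deriveE; first last.
- exact/derivable1_diffP.
- exact/derivable1_diffP.
by rewrite -[v in RHS]mulr1 [RHS]linearZ.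
Qed.

Lemma Ck_cos_sin k (B : set R) : open B -> Ck_on k cos B /\ Ck_on k sin B.
Proof.
move=> oB; elim: k => [|k [Cc Cs]].
  by split=> y _; [exact: continuous_cos|exact: continuous_sin].
split; first by apply: (@Ck_scalar _ _ (fun y => - sin y)) => //; exact: CkN.
by apply: (@Ck_scalar _ _ cos).
Qed.

Lemma is_derive_inv (y : R) : y != 0 -> is_derive y 1 (fun y : R => y^-1) (- (y^-1 * y^-1)).
Proof.
move=> y0; split; first exact/derivable1_diffP/differentiable_Rinv.
rewrite (@deriveV _ _ id) // derive_id -[RHS]mulr1.
by rewrite -invfM expr2.
Qed.

Lemma Ck_inv k (B : set R) : open B -> (forall y, B y -> y != 0) ->
  Ck_on k (fun y : R => y^-1) B.
Proof.
move=> oB B0; elim: k => [|k IH].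
  by move=> y /B0 y0; exact: inv_continuous.
apply: (@Ck_scalar _ _ (fun y => - (y^-1 * y^-1))) => //.
  by move=> y /B0; exact: is_derive_inv.
by apply: CkN => //; apply: CkM.
Qed.

Lemma fdimR : fdim R.
Proof.
exists unit, (fun=> 1), (fun=> idfun); split=> [_ x|w]; first exact: cvg_id.
by rewrite big_const /= card_unit /= [w *: _]mulr1 addr0.
Qed.

Lemma open_neq0 : open [set y : R | y != 0].
Proof.
rewrite (_ : [set _ | _] = ~` [set 0]); first exact/closed_openC/closed_eq.
by apply/seteqP; split=> y /= /eqP.
Qed.

Lemma Ck_invf k V (f : V -> R) (A : set V) : open A ->
  (forall x, A x -> f x != 0) -> Ck_on k f A -> Ck_on k (fun x => (f x)^-1) A.
Proof.
move=> oA f0 Cf; apply: (@Ck_comp _ _ _ _ (fun y : R => y^-1) f A [set y : R | y != 0]) => //.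
- exact: fdimR.
- exact: fdimR.
- by apply: Ck_inv => //; exact: open_neq0.
Qed.

Lemma Ck_sqrt k (B : set R) : open B -> (forall y, B y -> 0 < y) ->
  Ck_on k Num.sqrt B.
Proof.
move=> oB B0; elim: k => [|k IH]; first by move=> y _; exact: sqrt_continuous.
apply: (@Ck_scalar _ _ (fun y => (2 * Num.sqrt y)^-1)) => //.
  by move=> y /B0; exact: is_derive1_sqrt.
apply: Ck_invf => //; last exact: CkZl.
by move=> y /B0 y0; rewrite mulf_neq0 // gt_eqF // sqrtr_gt0.
Qed.

Lemma Ck_id k V (A : set V) : Ck_on k id A.
Proof.
case: k => [|k]; first by move=> x _; exact: cvg_id.
split=> [x _|v]; first by apply: ex_diff.
have -> : 'D_v id = (fun=> v : V) by apply/funext => x; exact: derive_id.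
exact: Ck_cst.
Qed.

Lemma Ck_atan k (B : set R) : open B -> Ck_on k atan B.
Proof.
move=> oB; case: k => [y _|k]; first exact: continuous_atan.
apply: (@Ck_scalar _ _ (fun y => (1 + y ^+ 2)^-1)) => //.
apply: Ck_invf => //=.
  by move=> y _; rewrite gt_eqF // ltr_pwDl // sqr_ge0.
apply: CkD => //; first exact: Ck_cst.
by apply: CkM => //; exact: Ck_id.
Qed.

(* The factor [t^-1 ^+ j] makes the family stable under derivation, up to
   linear combinations. *)
Definition flat (j : nat) (t : R) : R :=
  if 0 < t then t^-1 ^+ j * expR (- t^-1) else 0.

Lemma flat_ge0 j t : 0 <= flat j t.
Proof.
rewrite /flat; case: ifP => // t0.
by rewrite mulr_ge0 ?expR_ge0 // exprn_ge0 // invr_ge0 ltW.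
Qed.

Lemma flat_gt0 j t : (0 < flat j t) = (0 < t).
Proof.
rewrite /flat; case: ifP => [t0|_]; last by rewrite ltxx.
by rewrite mulr_gt0 ?expR_gt0 // exprn_gt0 // invr_gt0.
Qed.

(** From [exp x >= 1 + x^(j+1) / (j+1)!] at [x = 1/t]; the extra power makes the difference
    quotients at 0 tend to 0. *)
Lemma flat_le j t : `|flat j t| <= (j.+1)`!%:R * `|t|.
Proof.
rewrite ger0_norm ?flat_ge0 // /flat; case: ifP => [t0|_]; last by rewrite mulr_ge0.
rewrite gtr0_norm // expRN ler_pdivrMr ?expR_gt0 // -ler_pdivrMl ?mulr_gt0 ?ltr0n ?fact_gt0 //.
apply: (@le_trans _ _ (1 + t^-1 ^+ j.+1 / j.+1`!%:R)); last first.
  by apply: expR_ge1Dxn; rewrite invr_ge0 ltW.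
rewrite invfM -mulrA -exprS mulrC; lra.
Qed.

Lemma is_derive_flat j (t : R) :
  is_derive t 1 (flat j) (flat j.+2 t - j%:R * flat j.+1 t).
Proof.
have [t0|t0|->] := ltgtP t 0.
- apply: (@near_eq_is_derive _ _ _ (fun=> 0)).
    near=> s; rewrite /flat ifF //; apply/negbTE; rewrite -leNgt ltW //.
    by near: s; exact: lt_nbhsl.
  rewrite /flat !ifF; [|by apply/negbTE; rewrite -leNgt ltW..].
  by rewrite mulr0 subrr; exact: is_derive_cst.
- apply: (@near_eq_is_derive _ _ _ (fun s : R => s^-1 ^+ j * expR (- s^-1))).
    near=> s; rewrite /flat ifT //.
    by near: s; exact: lt_nbhsr.
  have tn0 : t != 0 by rewrite gt_eqF.
  have dt := is_derive_inv tn0.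
  have d1 := is_deriveX j dt.
  have d2 := @is_derive1_comp _ expR (- (fun y : R => y^-1)) t _ _
    (is_derive_expR _) (is_deriveN dt).
  have := is_deriveM d1 d2.
  rewrite (_ : _ * _ = (fun s : R => s^-1 ^+ j * expR (- s^-1))); last first.
    by apply/funext => s /=; rewrite /= fctE exprfctE.
  move=> d3; apply: is_derive_eq.
  rewrite exprfctE /flat t0 opprK /=; case: j {d1 d3} => [|j] /=.
    rewrite !expr0 !expr1 /GRing.scale /= !exprS expr0; ring.
  rewrite !exprS /GRing.scale /=; ring.
- rewrite /flat ltxx mulr0 subrr.
  have H : (fun h => h^-1 *: ((flat j \o shift 0) (h *: 1) - flat j 0)) @ 0^' --> (0 : R).
    apply/cvgrPdist_le => e e0.
    near=> h.
    have h0 : h != 0 by near: h; exact: nbhs_dnbhs_neq.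
    rewrite /= addr0 [h *: 1]mulr1 sub0r normrN {2}/flat ltxx subr0.
    (* The difference quotient at 0 is again a member of the family, so [flat_le] bounds it by a
       multiple of [h]. *)
    have -> : h^-1 *: flat j h = flat j.+1 h.
      rewrite /flat; case: ifP => _; last by rewrite scaler0.
      by rewrite exprS -mulrA.
    apply: (le_trans (flat_le _ _)).
    rewrite -ler_pdivlMl ?ltr0n ?fact_gt0 //.
    near: h; apply: dnbhs0_le.
    by rewrite mulr_gt0 // invr_gt0 ltr0n fact_gt0.
  by split; [apply/cvg_ex; exists 0|apply/cvg_lim].
Unshelve. all: by end_near. Qed.

Lemma Ck_flat k j (B : set R) : open B -> Ck_on k (flat j) B.
Proof.
move=> oB; elim: k j => [|k IH] j.
  move=> t _; apply/differentiable_continuous/derivable1_diffP.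
  by have [] := is_derive_flat j t.
apply: (@Ck_scalar _ _ (fun t => flat j.+2 t - j%:R * flat j.+1 t)) => //.
  by move=> t _; exact: is_derive_flat.
by apply: CkD => //; apply: CkN => //; apply: CkZl.
Qed.

Lemma fdim_rV m : fdim 'rV[R]_m.
Proof.
pose c (i : 'I_m) (v : 'rV[R]_m) : R := v 0 i.
have cl i : linear (c i) by move=> a u v; rewrite /c !mxE.
pose cM i := GRing.isLinear.Build _ _ _ _ _ (cl i).
pose cL i : {linear 'rV[R]_m -> R} := HB.pack (c i) (cM i).
exists 'I_m, (fun i => delta_mx 0 i), cL; split=> [i|w].
  exact: coord_continuous.
by rewrite {1}[w]row_sum_delta.
Qed.

Lemma fdim_prod V W : fdim V -> fdim W -> fdim (V * W)%type.
Proof.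
move=> [I [b [c [cc cE]]]] [J [b' [c' [cc' cE']]]].
pose c1 (i : I) (v : V * W) : R := c i v.1.
pose c2 (j : J) (v : V * W) : R := c' j v.2.
have l1 i : linear (c1 i) by move=> a u v; rewrite /c1 /= linearP.
have l2 i : linear (c2 i) by move=> a u v; rewrite /c2 /= linearP.
pose M1 i := GRing.isLinear.Build _ _ _ _ _ (l1 i).
pose L1 i : {linear (V * W)%type -> R} := HB.pack (c1 i) (M1 i).
pose M2 i := GRing.isLinear.Build _ _ _ _ _ (l2 i).
pose L2 i : {linear (V * W)%type -> R} := HB.pack (c2 i) (M2 i).
exists (I + J)%type,
  (fun k => match k with inl i => (b i, 0) | inr j => (0, b' j) end),
  (fun k => match k with inl i => L1 i | inr j => L2 j end).
split=> [[i|j] x|[v w]].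
- by apply: continuous_comp; [exact: cvg_fst|exact: cc].
- by apply: continuous_comp; [exact: cvg_snd|exact: cc'].
rewrite big_sumType /= /c1 /c2 /=.
rewrite [X in (X, _)](cE v) [X in (_, X)](cE' w).
have H1 : \sum_i c i v *: (b i, 0 : W) = (\sum_i c i v *: b i, 0).
  elim/big_rec2: _ => //= i y1 y2 _ ->.
  by congr (_, _) => /=; rewrite scaler0 addr0.
have H2 : \sum_i c' i w *: (0 : V, b' i) = (0, \sum_i c' i w *: b' i).
  elim/big_rec2: _ => //= i y1 y2 _ ->.
  by congr (_, _) => /=; rewrite scaler0 addr0.
rewrite H1 H2; congr (_, _) => /=; first by rewrite addr0.
by rewrite add0r.
Qed.

Lemma fdimC n : fdim (@Cn R n).
Proof. exact: (fdim_prod (fdim_rV n) (fdim_rV n)). Qed.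

Lemma Ck_linear k V W (L : V -> W) (A : set V) : open A ->
  linear L -> continuous L -> Ck_on k L A.
Proof.
move=> oA Ll cL.
pose M := GRing.isLinear.Build _ _ _ _ _ Ll.
pose LL : {linear V -> W} := HB.pack L M.
exact: (@Ck_comp_linear k V V W LL id A oA cL (@Ck_id k V A)).
Qed.

Section Smooth.

Lemma smooth_comp V W X (g : W -> X) (f : V -> W) (A : set V) (B : set W) :
  fdim W -> fdim X -> open A -> open B -> (forall x, A x -> B (f x)) ->
  smooth_on f A -> smooth_on g B -> smooth_on (fun x => g (f x)) A.
Proof. by move=> ? ? ? ? ? Cf Cg k; apply: (@Ck_comp _ _ _ _ _ _ A B). Qed.

Lemma smooth_comp_linear V W X (L : W -> X) (f : V -> W) (A : set V) : open A ->
  linear L -> continuous L -> smooth_on f A -> smooth_on (fun x => L (f x)) A.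
Proof.
move=> oA Ll cL Cf k.
pose M := GRing.isLinear.Build _ _ _ _ _ Ll.
pose LL : {linear W -> X} := HB.pack L M.
exact: (@Ck_comp_linear k V W X LL f A oA cL (Cf k)).
Qed.

Lemma smooth_eq V W (f g : V -> W) (A : set V) : open A ->
  (forall x, A x -> f x = g x) -> smooth_on f A -> smooth_on g A.
Proof. by move=> ? ? Cf k; apply: Ck_eq (Cf k). Qed.

Lemma smooth_sub V W (f : V -> W) (A B : set V) :
  B `<=` A -> smooth_on f A -> smooth_on f B.
Proof. by move=> BA Cf k; apply: Ck_sub (Cf k). Qed.

Lemma smooth_loc V W (f : V -> W) (A : set V) :
  (forall x, A x -> exists2 B, B x & smooth_on f B) -> smooth_on f A.
Proof.
move=> H k; apply: Ck_pointwise => x /H[B Bx Cf].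
by apply: Ck_sub (Cf k) => y ->.
Qed.

Lemma smooth_cont V W (f : V -> W) (A : set V) x :
  smooth_on f A -> A x -> {for x, continuous f}.
Proof. by move=> Cf; apply: (Cf 0%N). Qed.

Lemma smooth_diff V W (f : V -> W) (A : set V) x :
  smooth_on f A -> A x -> differentiable f x.
Proof. by move=> Cf; apply: (Cf 1%N).1. Qed.

Lemma smooth_derive V W (f : V -> W) (A : set V) v :
  smooth_on f A -> smooth_on (fun x => 'D_v f x) A.
Proof. by move=> Cf k; apply: (Cf k.+1).2. Qed.

Lemma smooth_cst V W (w : W) (A : set V) : smooth_on (fun=> w) A.
Proof. by move=> k; exact: Ck_cst. Qed.

Lemma smooth_id V (A : set V) : smooth_on id A.
Proof. by move=> k; exact: Ck_id. Qed.

Lemma smoothD V W (f g : V -> W) (A : set V) : open A ->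
  smooth_on f A -> smooth_on g A -> smooth_on (fun x => f x + g x) A.
Proof. by move=> oA Cf Cg k; apply: CkD. Qed.

Lemma smoothM V (f g : V -> R) (A : set V) : open A ->
  smooth_on f A -> smooth_on g A -> smooth_on (fun x => f x * g x) A.
Proof. by move=> oA Cf Cg k; apply: CkM. Qed.

Lemma smoothN V (f : V -> R) (A : set V) : open A ->
  smooth_on f A -> smooth_on (fun x => - f x) A.
Proof. by move=> oA Cf k; apply: CkN. Qed.

Lemma smoothB V (f g : V -> R) (A : set V) : open A ->
  smooth_on f A -> smooth_on g A -> smooth_on (fun x => f x - g x) A.
Proof. by move=> oA Cf Cg; apply: smoothD => //; apply: smoothN. Qed.

Lemma smooth_sum V W (I : Type) (r : seq I) (P : pred I) (f : I -> V -> W)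
    (A : set V) : open A -> (forall i, P i -> smooth_on (f i) A) ->
  smooth_on (fun x => \sum_(i <- r | P i) f i x) A.
Proof. by move=> oA Hf k; apply: Ck_sum => // i Pi; exact: Hf. Qed.

Lemma smooth_inv V (f : V -> R) (A : set V) : open A ->
  (forall x, A x -> f x != 0) -> smooth_on f A ->
  smooth_on (fun x => (f x)^-1) A.
Proof. by move=> oA f0 Cf k; apply: Ck_invf. Qed.

Lemma smooth_scalar V (phi : R -> R) (f : V -> R) (A : set V) (B : set R) :
  open A -> open B -> (forall x, A x -> B (f x)) -> smooth_on phi B ->
  smooth_on f A -> smooth_on (fun x => phi (f x)) A.
Proof.
move=> oA oB AB Cp Cf.
by apply: (@smooth_comp _ _ _ phi f A B) => //; exact: fdimR.
Qed.

Lemma smooth_sqrt V (f : V -> R) (A : set V) : open A ->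
  (forall x, A x -> 0 < f x) -> smooth_on f A ->
  smooth_on (fun x => Num.sqrt (f x)) A.
Proof.
move=> oA f0; apply: (@smooth_scalar _ _ _ _ [set y | 0 < y]) => //.
by move=> k; apply: Ck_sqrt.
Qed.

Lemma smooth_cos V (f : V -> R) (A : set V) : open A ->
  smooth_on f A -> smooth_on (fun x => cos (f x)) A.
Proof.
move=> oA; apply: (@smooth_scalar _ _ _ _ setT) => //; first exact: openT.
by move=> k; have [] := Ck_cos_sin k (@openT R).
Qed.

Lemma smooth_sin V (f : V -> R) (A : set V) : open A ->
  smooth_on f A -> smooth_on (fun x => sin (f x)) A.
Proof.
move=> oA; apply: (@smooth_scalar _ _ _ _ setT) => //; first exact: openT.
by move=> k; have [] := Ck_cos_sin k (@openT R).
Qed.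

Lemma smooth_atan V (f : V -> R) (A : set V) : open A ->
  smooth_on f A -> smooth_on (fun x => atan (f x)) A.
Proof.
move=> oA; apply: (@smooth_scalar _ _ _ _ setT) => //; first exact: openT.
by move=> k; exact: Ck_atan (@openT R).
Qed.

Lemma smooth_flat V (f : V -> R) (A : set V) : open A ->
  smooth_on f A -> smooth_on (fun x => flat 0 (f x)) A.
Proof.
move=> oA; apply: (@smooth_scalar _ _ _ _ setT) => //; first exact: openT.
by move=> k; exact: Ck_flat (@openT R).
Qed.

Lemma smooth_coord V m p (f : V -> 'M[R]_(m, p)) (A : set V) i j : open A ->
  smooth_on f A -> smooth_on (fun x => f x i j) A.
Proof.
move=> oA; apply: (@smooth_comp_linear _ _ _ (fun M : 'M[R]_(m, p) => M i j)) => //.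
  by move=> a u v; rewrite !mxE.
exact: coord_continuous.
Qed.

Lemma smooth_mx V m p (f : V -> 'M[R]_(m, p)) (A : set V) : open A ->
  (forall i j, smooth_on (fun x => f x i j) A) -> smooth_on f A.
Proof.
move=> oA Cf.
have -> : f = fun x => \sum_i \sum_j f x i j *: delta_mx i j.
  by apply/funext => x; rewrite -matrix_sum_delta.
apply: smooth_sum => // i _; apply: smooth_sum => // j _.
apply: (@smooth_comp_linear _ _ _ (fun a : R => a *: delta_mx i j)) => //.
  by move=> u y z; rewrite scalerDl scalerA.
exact: scalel_continuous.
Qed.

Lemma smooth_fst V W X (f : V -> W * X) (A : set V) : open A ->
  smooth_on f A -> smooth_on (fun x => (f x).1) A.
Proof.
by move=> oA; apply: smooth_comp_linear => // x; exact: cvg_fst.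
Qed.

Lemma smooth_snd V W X (f : V -> W * X) (A : set V) : open A ->
  smooth_on f A -> smooth_on (fun x => (f x).2) A.
Proof.
by move=> oA; apply: smooth_comp_linear => // x; exact: cvg_snd.
Qed.

Lemma smooth_pair V W X (f : V -> W) (g : V -> X) (A : set V) : open A ->
  smooth_on f A -> smooth_on g A -> smooth_on (fun x => (f x, g x)) A.
Proof.
move=> oA Cf Cg.
have -> : (fun x => (f x, g x)) = fun x => (f x, 0) + (0, g x).
  by apply/funext => x; congr (_, _) => /=; rewrite ?addr0 ?add0r.
apply: smoothD => //.
  apply: (@smooth_comp_linear _ _ _ (fun u : W => (u, 0 : X))) => //.
    by move=> a u v; congr (_, _) => /=; rewrite scaler0 addr0.
  by move=> u; apply: cvg_pair => //=; exact: cvg_cst.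
apply: (@smooth_comp_linear _ _ _ (fun u : X => (0 : W, u))) => //.
  by move=> a u v; congr (_, _) => /=; rewrite scaler0 addr0.
by move=> u; apply: cvg_pair => //=; exact: cvg_cst.
Qed.

Lemma smooth_row V m (f : 'I_m -> V -> R) (A : set V) : open A ->
  (forall i, smooth_on (f i) A) -> smooth_on (fun x => \row_i f i x) A.
Proof.
move=> oA Cf; apply: smooth_mx => // i j.
rewrite (_ : (fun x => _) = f j) //.
by apply/funext => x; rewrite mxE.
Qed.

End Smooth.
End Calculus.

(** * Integrals depending on a parameter *)

Section ParameterIntegral.
Context {R : realType}.
Implicit Types V : normedModType R.

Notation mu := (@lebesgue_measure R).

Lemma integrable01 (f : R -> R) :
  (forall s, 0 <= s <= 1 -> {for s, continuous f}) ->
  mu.-integrable `[0, 1] (EFin \o f).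
Proof.
move=> cf; apply: continuous_compact_integrable; first exact: segment_compact.
apply: continuous_in_subspaceT => s; rewrite inE /= in_itv /=; exact: cf.
Qed.

Lemma Rintegral01_cst (r : R) : \int[mu]_(s in `[0, 1]) r = r.
Proof.
by rewrite Rintegral_cst //= lebesgue_measure_itv /= lte_fin ltr01 sube0 /= mulr1.
Qed.

Lemma continuous_sum (V : normedModType R) (I : Type) (r : seq I)
    (f : I -> V -> R) (x : V) : (forall i, {for x, continuous (f i)}) ->
  {for x, continuous (fun y => \sum_(i <- r) f i y)}.
Proof.
move=> cf; elim: r => [|i r IH].
  rewrite (_ : (fun y => _) = fun=> 0); first exact: cst_continuous.
  by apply/funext => y; rewrite big_nil.
rewrite (_ : (fun y => _) = fun y => f i y + \sum_(i <- r) f i y).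
  exact: continuousD.
by apply/funext => y; rewrite big_cons.
Qed.

Lemma Rintegral01_sum (I : finType) (f : I -> R -> R) :
  (forall i (s : R), 0 <= s <= 1 -> {for s, continuous (f i)}) ->
  \int[mu]_(s in `[0, 1]) (\sum_i f i s) =
  \sum_i \int[mu]_(s in `[0, 1]) f i s.
Proof.
move=> cf; elim: (index_enum I) => [|i r IH].
  under eq_Rintegral do rewrite big_nil.
  by rewrite big_nil Rintegral01_cst.
under eq_Rintegral do rewrite big_cons.
rewrite big_cons RintegralD ?IH //; first by apply: integrable01; exact: cf.
by apply: integrable01 => s s01; apply: continuous_sum => j; exact: cf.
Qed.

(** The tube lemma for the compact interval [0, 1]. *)
Lemma near01 V (x : V) (Q : R -> V -> Prop) :
  (forall s : R, 0 <= s <= 1 -> \forall p \near (s, x), Q p.1 p.2) ->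
  \forall y \near x, forall s, 0 <= s <= 1 -> Q s y.
Proof.
move=> H.
have /compact_near_coveringP /(_ V (nbhs x) (fun y s => Q s y) _) :=
  @segment_compact R 0 1.
move=> H1; have := H1 _.
have H2 : forall s : R, `[0, 1]%classic s ->
    \forall s' \near s & y \near nbhs x, Q s' y.
  move=> s; rewrite /= in_itv /= => s01; have := H s s01.
  by case=> -[/= A B] [As Bx] AB; exists (A, B) => //= -[] /=.
move/(_ H2); apply: filterS => y Hy s s01; apply: Hy.
by rewrite /= in_itv.
Qed.

Section Param.
Variables (V : normedModType R) (A : set V).
Hypotheses (fV : fdim V) (oA : open A).

Lemma param_slice (F : R * V -> R) (O : set (R * V)) (x : V) :
  open O -> (forall s, 0 <= s <= 1 -> O (s, x)) -> smooth_on F O ->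
  forall s : R, 0 <= s <= 1 -> {for s, continuous (fun s => F (s, x))}.
Proof.
move=> oO AO sF s s01.
apply: (@continuous_comp _ _ _ (fun s : R => (s, x)) F).
  exact: (smooth_cont (smooth_pair openT (smooth_id setT) (smooth_cst x setT)) I).
exact: (smooth_cont sF (AO s s01)).
Qed.

Lemma is_derive_line (W X : normedModType R) (F : W -> X) (p w : W) (t : R) :
  differentiable F (p + t *: w) ->
  is_derive t 1 (fun t : R => F (p + t *: w)) ('D_w F (p + t *: w)).
Proof.
move=> dF0; have dF : derivable F (p + t *: w) w by exact: diff_derivable.
have E : (fun h : R => h^-1 *:
    (((fun t => F (p + t *: w)) \o shift t) (h *: 1) - F (p + t *: w))) =
    (fun h => h^-1 *: ((F \o shift (p + t *: w)) (h *: w) - F (p + t *: w))).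
  apply/funext => h /=; congr (_ *: (F _ - _)).
  by rewrite [h *: 1]mulr1 scalerDl addrCA.
by apply: DeriveDef; [rewrite /derivable E|rewrite /derive E].
Qed.

(** Differentiation under the integral sign. By the tube lemma the partial derivatives near [x] are
    close to those at [x] uniformly in [s], and the mean value theorem then bounds the remainder
    uniformly in [s]. The open set [O] around the product of [0, 1] and [A] is there because
    derivatives are taken in [R * V]. *)
Lemma param_diff (I : finType) (b : I -> V) (c : I -> {linear V -> R})
    (F : R * V -> R) (O : set (R * V)) (x : V) :
  (forall i, continuous (c i)) -> (forall v, v = \sum_i c i v *: b i) ->
  open O -> (forall s x, 0 <= s <= 1 -> A x -> O (s, x)) -> smooth_on F O ->
  A x ->
  differentiable (fun x => \int[mu]_(s in `[0, 1]) F (s, x)) x /\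
  'd (fun x => \int[mu]_(s in `[0, 1]) F (s, x)) x = (fun v =>
  \sum_i c i v * \int[mu]_(s in `[0, 1]) 'D_(0, b i) F (s, x)) :> (V -> R).
Proof.
move=> cc cE oO AO sF Ax.
pose D i p : R := 'D_(0, b i) F p.
have sD i : smooth_on (D i) O by exact: smooth_derive.
pose G x := \int[mu]_(s in `[0, 1]) F (s, x).
pose g i x := \int[mu]_(s in `[0, 1]) D i (s, x).
pose L v : R := \sum_i c i v * g i x.
have lL : linear L.
  move=> a u v; rewrite /L scaler_sumr -big_split /=; apply: eq_bigr => i _.
  by rewrite linearP /= mulrDl -mulrA.
pose LM := GRing.isLinear.Build _ _ _ _ _ lL.
pose LL : {linear V -> R} := HB.pack L LM.
have cL : continuous LL.
  move=> v; apply: (@continuous_sum _ _ _ (fun i v => c i v * g i x)) => i.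
  by apply: continuousM; [exact: cc|exact: cst_continuous].
have [k k0 ck] : exists2 k : I -> R, (forall i, 0 < k i) &
    forall i v, `|c i v| <= k i * `|v|.
  have /choice[k kP] : forall i, exists k : R, 0 < k /\ forall v, `|c i v| <= k * `|v|.
    by move=> i; have [k] := linear_lipschitz (cc i); exists k.
  by exists k => i; have [] := kP i.
(* Partial derivatives within [e / K] make the remainder at most [e] times the norm of [h]; the
   summand 1 keeps [K] positive when the basis is empty. *)
pose K := 1 + \sum_i k i.
have K0 : 0 < K by rewrite ltr_pwDl // sumr_ge0 // => i _; exact: ltW.
have key : G \o shift x = cst (G x) + LL +o_ (0 : V) id.
  apply/eqaddoP => e e0.
  have e'0 : 0 < e / K by rewrite divr_gt0.
  have U : \forall y \near x, (forall s, 0 <= s <= 1 ->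
      forall i, `|D i (s, y) - D i (s, x)| <= e / K) /\ A y.
    apply: filterI; last exact: open_nbhs_nbhs.
    apply: (@near01 _ _ (fun s y => forall i, `|D i (s, y) - D i (s, x)| <= e / K)).
    move=> s s01.
    suff H : forall i, \forall p \near ((s, x) : (R * V)%type),
        `|D i p - D i (p.1, x)| <= e / K.
      by move/filter_forall : H; apply: filterS => -[].
    move=> i.
    have c1 : {for (s, x), continuous (D i)} by apply: smooth_cont (sD i) _; exact: AO.
    have c2 : {for (s, x), continuous (fun p : R * V => D i (p.1, x))}.
      apply: (@continuous_comp _ _ _ (fun p : R * V => (p.1, x)) (D i)) => //.
      apply: (@smooth_cont _ _ _ (fun p : R * V => (p.1, x)) setT) => //.
      apply: smooth_pair; [exact: openT| |exact: smooth_cst].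
      by apply: smooth_fst; [exact: openT|exact: smooth_id].
    have c3 := continuousB c1 c2.
    move/cvgrPdist_le : c3 => /(_ _ e'0); apply: filterS => p /=.
    by rewrite -[(D i - _) (s, x)]/(D i (s, x) - D i (s, x)) subrr sub0r normrN.
  have [d /= d0 dU] := (nbhs_ballP _ _).1 U.
  have : \forall h \near (0 : V), ball (0 : V) d h by exact: nbhsx_ballx.
  apply: filterS => h hd.
  have hU (t : R) : 0 <= t <= 1 -> (forall s, 0 <= s <= 1 ->
      forall i, `|D i (s, x + t *: h) - D i (s, x)| <= e / K) /\ A (x + t *: h).
    move=> /andP[t0 t1]; apply: dU; move: hd; rewrite -!ball_normE /= sub0r.
    rewrite opprD addrA subrr add0r !normrN normrZ (ger0_norm t0).
    by apply: le_lt_trans; rewrite ler_piMl.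
  have Axh : A (x + h) by have := hU 1; rewrite ler01 lexx scale1r => /(_ isT)[].
  have pt s : 0 <= s <= 1 ->
      `|F (s, x + h) - F (s, x) - \sum_i c i h * D i (s, x)| <= e * `|h|.
    move=> s01.
    pose phi (t : R) := F ((s, x) + t *: (0, h)).
    have pE t : (s, x) + t *: (0, h) = (s, x + t *: h).
      by congr (_, _); rewrite /= ?scaler0 ?addr0.
    have dphi (t : R) : 0 <= t <= 1 ->
        is_derive t 1 phi (\sum_i c i h * D i (s, x + t *: h)).
      move=> t01; have [_ At] := hU t t01.
      have dF : differentiable F ((s, x) + t *: (0, h)).
        by rewrite pE; apply: (smooth_diff sF); exact: AO.
      have := is_derive_line dF.
      rewrite deriveE // pE => H; apply: is_derive_eq.
      have -> : (0 : R, h) = \sum_i c i h *: (0 : R, b i).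
        rewrite [X in (_, X)](cE h); elim/big_rec2: _ => //= i y1 y2 _ <-.
        by congr (_, _) => /=; rewrite scaler0 addr0.
      rewrite linear_sum; apply: eq_bigr => i _; rewrite linearZ /=.
      by rewrite -pE -deriveE // pE.
    have [||t] := @MVT_segment R phi (fun t => \sum_i c i h * D i (s, x + t *: h)) 0 1 ler01.
    - by move=> t; rewrite in_itv /= => /andP[t0 t1]; apply: dphi; rewrite !ltW.
    - apply: continuous_in_subspaceT => t; rewrite inE /= in_itv /= => t01.
      by apply/differentiable_continuous/derivable1_diffP; have [] := dphi t t01.
    rewrite in_itv /= => t01; rewrite /phi !pE scale1r scale0r addr0 subr0 mulr1.
    move=> ->; rewrite -sumrB (le_trans (ler_norm_sum _ _ _)) //.
    apply: (@le_trans _ _ (\sum_i (k i * `|h|) * (e / K))).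
      apply: ler_sum => i _; rewrite -mulrBr normrM ler_pM //.
      by have [/(_ s s01 i)] := hU t t01.
    rewrite -!mulr_suml mulrAC mulrC -[leRHS]mulrC ler_wpM2l // mulrCA.
    apply: ler_piMr; first exact: ltW.
    by rewrite ler_pdivrMr // mul1r lerDr.
  rewrite /= -[X in `|X|]/(G (h + x) - (G x + L h)).
  have iF y : A y -> mu.-integrable `[0, 1] (EFin \o (fun s => F (s, y))).
    move=> Ay; apply: integrable01; apply: (param_slice oO) sF => s s01.
    exact: AO.
  have cD i (s : R) : 0 <= s <= 1 -> {for s, continuous (fun s => D i (s, x))}.
    by move: s; apply: (param_slice oO) (sD i) => s s01; exact: AO.
  have cF y (s : R) : A y -> 0 <= s <= 1 -> {for s, continuous (fun s => F (s, y))}.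
    by move=> Ay; move: s; apply: (param_slice oO) sF => s s01; exact: AO.
  have cS (s : R) : 0 <= s <= 1 ->
      {for s, continuous (fun s => \sum_i c i h * D i (s, x))}.
    move=> s01; apply: continuous_sum => i; apply: continuousM; last exact: cD.
    exact: cst_continuous.
  have -> : L h = \int[mu]_(s in `[0, 1]) (\sum_i c i h * D i (s, x)).
    rewrite Rintegral01_sum.
      by apply: eq_bigr => i _; rewrite RintegralZl //; apply: integrable01; exact: cD.
    by move=> i s s01; apply: continuousM; [exact: cst_continuous|exact: cD].
  rewrite /G [h + x]addrC opprD addrA -RintegralB //; [|exact: iF|exact: iF].
  have iB : mu.-integrable `[0, 1] (EFin \o (fun s => F (s, x + h) - F (s, x))).
    by apply: integrable01 => s s01; apply: continuousB; exact: cF.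
  rewrite -RintegralB //; last exact: integrable01.
  have iC : forall s : R, 0 <= s <= 1 -> {for s, continuous (fun s =>
      F (s, x + h) - F (s, x) - \sum_i c i h * D i (s, x))}.
    move=> s s01; apply: (@continuousB _ _ _ (fun s => F (s, x + h) - F (s, x))).
      by apply: continuousB; exact: cF.
    exact: cS.
  rewrite (le_trans (le_normr_Rintegral _ _)) //; first exact: integrable01.
  rewrite -[leRHS]Rintegral01_cst; apply: le_Rintegral => //.
  - apply: integrable01 => s s01; apply: continuous_comp; first exact: iC.
    exact: norm_continuous.
  - by apply: integrable01 => s s01; exact: cst_continuous.
have dE : 'd G x = L :> (V -> R) by apply: (@diff_unique _ _ _ _ LL).
have dG : differentiable G x by apply/diff_locallyP; rewrite dE.
exact: (conj dG dE).
Qed.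

Lemma Ck_param_int k (F : R * V -> R) (O : set (R * V)) :
  open O -> (forall s x, 0 <= s <= 1 -> A x -> O (s, x)) -> smooth_on F O ->
  Ck_on k (fun x => \int[mu]_(s in `[0, 1]) F (s, x)) A.
Proof.
have [I [b [c [cc cE]]]] := fV.
move=> oO; elim: k F => [|k IH] F AO sF.
  by move=> x /(param_diff cc cE oO AO sF)[/differentiable_continuous].
have key := param_diff cc cE oO AO sF.
split=> [x /key[]//|v].
apply: (@Ck_eq _ _ _ _ (fun x =>
   \sum_i c i v * \int[mu]_(s in `[0, 1]) 'D_(0, b i) F (s, x))) => //.
  by move=> x /key[dG dL]; rewrite deriveE // dL.
apply: Ck_sum => // i _; apply: CkZl => //.
by apply: (IH (fun p => 'D_(0, b i) F p)) => //; exact: smooth_derive.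
Qed.

Lemma smooth_param_int (F : R * V -> R) (O : set (R * V)) :
  open O -> (forall s x, 0 <= s <= 1 -> A x -> O (s, x)) -> smooth_on F O ->
  smooth_on (fun x => \int[mu]_(s in `[0, 1]) F (s, x)) A.
Proof. by move=> oO AO sF k; apply: (Ck_param_int k oO). Qed.

End Param.
End ParameterIntegral.

Lemma open_forall (T : topologicalType) (I : finType) (P : I -> set T) :
  (forall i, open (P i)) -> open [set x | forall i, P i x].
Proof.
move=> oP; rewrite openE => x Px.
by apply: (@filter_forall _ _ _ (nbhs x) _) => i; exact: open_nbhs_nbhs.
Qed.

(** * Complex coordinates, moduli and invariant sets *)

Section ComplexSpace.
Context {R : realType} {n : nat}.
Local Notation C := (@Cn R n).
Implicit Types (z w : C) (a b : 'rV[R]_n).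

Lemma Cn_eq z w : (forall k, z.1 0 k = w.1 0 k) ->
  (forall k, z.2 0 k = w.2 0 k) -> z = w.
Proof.
case: z w => [z1 z2] [w1 w2] /= H1 H2.
by congr (_, _); apply/rowP.
Qed.

Lemma cmul1 z w k : (cmul z w).1 0 k = z.1 0 k * w.1 0 k - z.2 0 k * w.2 0 k.
Proof. by rewrite mxE. Qed.

Lemma cmul2 z w k : (cmul z w).2 0 k = z.1 0 k * w.2 0 k + z.2 0 k * w.1 0 k.
Proof. by rewrite mxE. Qed.

Lemma cexp1 a k : (cexp a).1 0 k = cos (a 0 k).
Proof. by rewrite mxE. Qed.

Lemma cexp2 a k : (cexp a).2 0 k = sin (a 0 k).
Proof. by rewrite mxE. Qed.

Definition cE := (cmul1, cmul2, cexp1, cexp2).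

Lemma cmulA z w (x : C) : cmul z (cmul w x) = cmul (cmul z w) x.
Proof. by apply: Cn_eq => k; rewrite !cE; ring. Qed.

Lemma cmul1z z : cmul (cone n) z = z.
Proof. by apply: Cn_eq => k; rewrite !cE !mxE; ring. Qed.

Lemma cexp0 : cexp 0 = cone n :> C.
Proof. by apply: Cn_eq => k; rewrite !cE !mxE ?cos0 ?sin0. Qed.

Lemma cexpD a b : cexp (a + b) = cmul (cexp a) (cexp b).
Proof. by apply: Cn_eq => k; rewrite !cE !mxE ?cosD ?sinD; ring. Qed.

Lemma torus_cexp a : torus (cexp a).
Proof. by move=> k; rewrite !cE cos2Dsin2. Qed.

Lemma cos_sin_surj (x y : R) : x ^+ 2 + y ^+ 2 = 1 ->
  exists t : R, cos t = x /\ sin t = y.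
Proof.
move=> xy; have x1 : -1 <= x <= 1.
  by rewrite -ler_norml -(@ler_pXn2r _ 2) ?nnegrE // expr1n real_normK ?num_real // -xy lerDl sqr_ge0.
have y2 : 1 - x ^+ 2 = y ^+ 2 by rewrite -xy addrAC subrr add0r.
have ca : cos (acos x) = x by rewrite acosK.
have sa : sin (acos x) = `|y| by rewrite sin_acos // y2 sqrtr_sqr.
have [y0|y0] := leP 0 y.
  by exists (acos x); rewrite ca sa ger0_norm.
by exists (- acos x); rewrite cosN sinN ca sa ltr0_norm // opprK.
Qed.

Lemma torusP (t : C) : torus t -> exists a, t = cexp a.
Proof.
move=> tt; have /choice[f fP] : forall k, exists u : R,
    cos u = t.1 0 k /\ sin u = t.2 0 k by move=> k; exact: cos_sin_surj.
exists (\row_k f k); apply: Cn_eq => k; rewrite !cE mxE; by have [] := fP k.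
Qed.

Definition mod2 z (k : 'I_n) : R := z.1 0 k ^+ 2 + z.2 0 k ^+ 2.

Lemma mod2_ge0 z k : 0 <= mod2 z k.
Proof. by rewrite addr_ge0 // sqr_ge0. Qed.

Lemma mod2_rot a z k : mod2 (cmul (cexp a) z) k = mod2 z k.
Proof.
rewrite /mod2 !cE; have := cos2Dsin2 (a 0 k).
set c := cos _; set s := sin _ => cs.
by rewrite -[RHS]mul1r -cs; ring.
Qed.

Lemma mod2_real z k : z.2 = 0 -> mod2 z k = z.1 0 k ^+ 2.
Proof. by move=> z2; rewrite /mod2 z2 mxE expr0n /= addr0. Qed.

(* The nonnegative real points form a slice of the torus action. *)
Definition nneg z := z.2 = 0 /\ forall k, 0 <= z.1 0 k.

Lemma nneg_rot z : exists a, nneg (cmul (cexp a) z).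
Proof.
have /choice[f fP] : forall k, exists u : R,
    cos u * z.1 0 k - sin u * z.2 0 k = Num.sqrt (mod2 z k) /\
    cos u * z.2 0 k + sin u * z.1 0 k = 0.
  move=> k; have [m0|m0] := eqVneq (mod2 z k) 0.
    have := m0; rewrite /mod2 => /eqP; rewrite paddr_eq0 ?sqr_ge0 // !sqrf_eq0.
    move=> /andP[/eqP z1 /eqP z2]; exists 0.
    by rewrite [X in Num.sqrt X]m0 z1 z2 sqrtr0 !mulr0 subrr addr0.
  have q0 : 0 < Num.sqrt (mod2 z k) by rewrite sqrtr_gt0 lt_def m0 mod2_ge0.
  have qE := sqr_sqrtr (mod2_ge0 z k); set q := Num.sqrt _ in q0 qE *.
  have [|u [cu su]] := @cos_sin_surj (z.1 0 k / q) (- (z.2 0 k / q)).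
    by rewrite sqrrN !expr_div_n -mulrDl qE divff.
  exists u; rewrite cu su; split; last by field; rewrite gt_eqF.
  apply: (@mulfI _ q); first by rewrite gt_eqF.
  rewrite -expr2 qE /mod2; field; by rewrite gt_eqF.
exists (\row_k f k); split=> [|k].
  by apply/rowP => k; rewrite !cE !mxE; have [] := fP k.
by rewrite !cE !mxE; have [-> _] := fP k; exact: sqrtr_ge0.
Qed.

Definition invariant (Z : set C) := forall a z, Z z -> Z (cmul (cexp a) z).

Lemma cexpNK a z : cmul (cexp (- a)) (cmul (cexp a) z) = z.
Proof. by rewrite cmulA -cexpD addNr cexp0 cmul1z. Qed.

Lemma Cn_ball z w (e : R) : 0 < e -> (forall k, `|z.1 0 k - w.1 0 k| < e) ->
  (forall k, `|z.2 0 k - w.2 0 k| < e) -> ball z e w.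
Proof.
by move=> e0 H1 H2; split; split=> // i k; rewrite ord1 -ball_normE /=.
Qed.

(** Both points can be rotated into the nonnegative orthant, where [(x - y)^2 <= |x^2 - y^2|]; hence
    the radius [e^2]. Points of an invariant open set thus get neighbourhoods described by moduli
    only. *)
Lemma invariant_moduli (Z : set C) (r : C) : open Z -> invariant Z -> Z r ->
  exists2 e : R, 0 < e &
    forall z, (forall k, `|mod2 z k - mod2 r k| < e) -> Z z.
Proof.
move=> oZ iZ Zr; have [a [r2 r1]] := nneg_rot r.
set r' := cmul (cexp a) r in r2 r1.
have Zr' : Z r' by exact: iZ.
have [e /= e0 eZ] := (nbhs_ballP _ _).1 (open_nbhs_nbhs (conj oZ Zr')).
exists (e ^+ 2); first by rewrite exprn_gt0.
move=> z zr; have [b [s2 s1]] := nneg_rot z.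
set z' := cmul (cexp b) z in s2 s1.
rewrite -(cexpNK b z) -/z'; apply/iZ/eZ; apply: Cn_ball => // k; last first.
  by rewrite r2 s2 !mxE subrr normr0.
have := zr k; rewrite -(mod2_rot b z) -(mod2_rot a r) -/r' -/z' !mod2_real //.
have := r1 k; have := s1 k; move: (z'.1 0 k) (r'.1 0 k) => x y x0 y0 xy.
rewrite distrC -(@ltr_pXn2r _ 2) ?nnegrE ?normr_ge0 ?(ltW e0) //.
apply: le_lt_trans xy.
have [h|h] := leP x y.
  rewrite -normrX ger0_norm ?sqr_ge0 // ler0_norm ?subr_le0 ?ler_pXn2r ?nnegrE //; nra.
rewrite -normrX ger0_norm ?sqr_ge0 // gtr0_norm ?subr_gt0 ?ltr_pXn2r ?nnegrE //; nra.
Qed.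

Section SmoothC.
Context {V : normedModType R}.
Implicit Types (f g : V -> C) (A : set V).

Lemma smooth_re f A k : open A -> smooth_on f A -> smooth_on (fun x => (f x).1 0 k) A.
Proof. by move=> oA sf; apply: smooth_coord => //; exact: smooth_fst. Qed.

Lemma smooth_im f A k : open A -> smooth_on f A -> smooth_on (fun x => (f x).2 0 k) A.
Proof. by move=> oA sf; apply: smooth_coord => //; exact: smooth_snd. Qed.

Lemma smooth_mod2 f A k : open A -> smooth_on f A -> smooth_on (fun x => mod2 (f x) k) A.
Proof.
move=> oA sf; apply: smoothD => //; apply: smoothM => //;
  by [exact: smooth_re|exact: smooth_im].
Qed.

Lemma smooth_cmul f g A : open A -> smooth_on f A -> smooth_on g A ->
  smooth_on (fun x => cmul (f x) (g x)) A.
Proof.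
move=> oA sf sg; apply: smooth_pair => //; apply: smooth_row => // k.
  by apply: smoothB => //; apply: smoothM => //; by [exact: smooth_re|exact: smooth_im].
by apply: smoothD => //; apply: smoothM => //; by [exact: smooth_re|exact: smooth_im].
Qed.

Lemma smooth_cexp (a : V -> 'rV[R]_n) A : open A -> smooth_on a A ->
  smooth_on (fun x => cexp (a x) : C) A.
Proof.
move=> oA sa; apply: smooth_pair => //; apply: smooth_row => // k.
  by apply: smooth_cos => //; exact: smooth_coord.
by apply: smooth_sin => //; exact: smooth_coord.
Qed.

End SmoothC.

Lemma continuous_mod2 k : continuous (fun z => mod2 z k).
Proof.
move=> z; apply: (@smooth_cont _ _ _ _ setT) => //.
by apply: smooth_mod2; [exact: openT|exact: smooth_id].
Qed.

Lemma open_moduli (r : C) (e : R) :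
  open [set z | forall k, `|mod2 z k - mod2 r k| < e].
Proof.
apply: open_forall => k.
apply: (@open_comp _ _ (fun z => `|mod2 z k - mod2 r k|) [set x | x < e]).
  move=> z _.
  apply: (@continuous_comp _ _ _ (fun z : C => mod2 z k - mod2 r k) (fun x : R => `|x|)); last exact: norm_continuous.
  by apply: continuousB; [exact: continuous_mod2|exact: cst_continuous].
exact: open_lt.
Qed.

End ComplexSpace.

(** * Arguments of equivariant functions *)

Section Phase.
Context {R : realType} {n : nat}.
Local Notation C := (@Cn R n).
Notation mu := (@lebesgue_measure R).
Implicit Types (z w : C) (a b : 'rV[R]_n).

Lemma derive_line_eq0 (V : normedModType R) (f : V -> R) (r w : V) :
  differentiable f r -> (\forall s \near (0 : R), f (r + s *: w) = 0) ->
  'D_w f r = 0.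
Proof.
move=> df f0; have df' : differentiable f (r + 0 *: w) by rewrite scale0r addr0.
have := is_derive_line df'; rewrite scale0r addr0 => -[_ <-].
by rewrite (near_eq_derive _ f0) derive_cst.
Qed.

Lemma FTC01 (F f : R -> R) :
  (forall s : R, 0 <= s <= 1 -> is_derive s 1 F (f s)) ->
  (forall s : R, 0 <= s <= 1 -> {for s, continuous f}) ->
  \int[mu]_(s in `[0, 1]) f s = F 1 - F 0.
Proof.
move=> dF cf; rewrite /Rintegral (@continuous_FTC2 _ f F) ?ltr01 //.
- by apply: continuous_in_subspaceT => s; rewrite inE /= in_itv /=; exact: cf.
- have cF (s : R) : 0 <= s <= 1 -> {for s, continuous F}.
    by move=> s01; apply/differentiable_continuous/derivable1_diffP; have [] := dF s s01.
  split.
  + by move=> s; rewrite in_itv /= => /andP[s0 s1]; have [] := dF s; rewrite ?ltW.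
  + by apply: cvg_at_right_filter; apply: cF; rewrite lexx ler01.
  + by apply: cvg_at_left_filter; apply: cF; rewrite lexx ler01.
move=> s; rewrite in_itv /= => /andP[s0 s1]; rewrite derive1E.
by have [] := dF s; rewrite ?ltW.
Qed.

(* Locked, since otherwise [(axis j x y).1 0 k] also matches [(axis j y x).2 0 k]. *)
Fact axis_key : unit. Proof. by []. Qed.
Definition axis (j : 'I_n) (x y : R) : C :=
  locked_with axis_key (x *: delta_mx 0 j, y *: delta_mx 0 j).

Lemma axis1 j x y k : (axis j x y).1 0 k = x *+ (k == j).
Proof. by rewrite /axis locked_withE !mxE eqxx /= mulr_natr. Qed.

Lemma axis2 j x y k : (axis j x y).2 0 k = y *+ (k == j).
Proof. by rewrite /axis locked_withE !mxE eqxx /= mulr_natr. Qed.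

Definition weight (l : 'I_n -> R) a := \sum_j a 0 j * l j.

(** The complex equation [g (exp (i a) z) = exp (i l(a)) g z] for [g = u + i v], where [l] is a
    weight on the Lie algebra. *)
Definition equivariant (l : 'I_n -> R) (u v : C -> R) (Z : set C) :=
  forall a z, Z z ->
    u (cmul (cexp a) z) = cos (weight l a) * u z - sin (weight l a) * v z /\
    v (cmul (cexp a) z) = cos (weight l a) * v z + sin (weight l a) * u z.

Lemma weightZ l t a : weight l (t *: a) = t * weight l a.
Proof. by rewrite mulr_sumr; apply: eq_bigr => j _; rewrite mxE mulrA. Qed.

Lemma weight_delta l j : weight l (delta_mx 0 j) = l j.
Proof.
rewrite /weight (bigD1 j) //= big1 ?addr0 ?mxE ?eqxx ?mul1r // => i /negbTE ij.
by rewrite mxE ij andbF mul0r.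
Qed.

(** Scaling [a] so that its weight becomes pi gives a torus element that still fixes [z], as it
    rotates zero coordinates only, but changes the signs of [u z] and [v z]. *)
Lemma fixed_weight l u v Z a z : equivariant l u v Z -> Z z ->
  (forall k, a 0 k != 0 -> z.1 0 k = 0 /\ z.2 0 k = 0) ->
  weight l a != 0 -> u z = 0 /\ v z = 0.
Proof.
move=> eq Zz az la; have := eq ((pi / weight l a) *: a) z Zz.
rewrite weightZ divfK // cospi sinpi.
have -> : cmul (cexp ((pi / weight l a) *: a)) z = z.
  apply: Cn_eq => k; rewrite !cE !mxE; have [->|/az[-> ->]] := eqVneq (a 0 k) 0.
  - by rewrite mulr0 cos0 sin0; ring.
  - ring.
  - by rewrite mulr0 cos0 sin0; ring.
  - ring.
by move=> [uE vE]; split; lra.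
Qed.

Lemma derive_comp (V W X : normedModType R) (g : W -> X) (f : V -> W) x v :
  differentiable f x -> differentiable g (f x) ->
  'D_v (fun y => g (f y)) x = 'D_('D_v f x) g (f x).
Proof.
move=> df dg; rewrite [LHS]deriveE; last exact: differentiable_comp.
have -> := @diff_comp _ _ _ _ f g x df dg.
by rewrite /= [RHS]deriveE // [in RHS]deriveE.
Qed.

Lemma derive_comp_linear (V W X : normedModType R) (L : W -> X) (f : V -> W) x v :
  linear L -> continuous L -> differentiable f x ->
  'D_v (fun y => L (f y)) x = L ('D_v f x).
Proof.
move=> Ll cL df.
pose M := GRing.isLinear.Build _ _ _ _ _ Ll.
pose LL : {linear W -> X} := HB.pack L M.
have dL : differentiable LL (f x) by exact: linear_differentiable.
rewrite (@derive_comp _ _ _ LL) // deriveE //.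
by rewrite (@diff_lin _ _ _ LL).
Qed.

Lemma derive_re (V : normedModType R) (f : V -> C) x v k : differentiable f x ->
  ('D_v f x).1 0 k = 'D_v (fun y => (f y).1 0 k) x.
Proof.
move=> df; rewrite (@derive_comp_linear _ _ _ (fun z : C => z.1 0 k)) //.
  by move=> t z w; rewrite !mxE.
by move=> z; exact: (smooth_cont (smooth_re k openT (smooth_id setT)) I).
Qed.

Lemma derive_im (V : normedModType R) (f : V -> C) x v k : differentiable f x ->
  ('D_v f x).2 0 k = 'D_v (fun y => (f y).2 0 k) x.
Proof.
move=> df; rewrite (@derive_comp_linear _ _ _ (fun z : C => z.2 0 k)) //.
  by move=> t z w; rewrite !mxE.
by move=> z; exact: (smooth_cont (smooth_im k openT (smooth_id setT)) I).
Qed.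

(** Multiplication by [i a]: the velocity at [z] of the one-parameter group of [a]. *)
Definition rot_field a z : C :=
  (\row_k (- (a 0 k * z.2 0 k)), \row_k (a 0 k * z.1 0 k)).

Lemma is_derive_rot a z :
  is_derive (0 : R) 1 (fun t : R => cmul (cexp (t *: a)) z) (rot_field a z).
Proof.
have sm : smooth_on (fun t : R => cmul (cexp (t *: a)) z) setT.
  apply: smooth_cmul; [exact: openT| |exact: smooth_cst].
  apply: smooth_cexp; first exact: openT.
  apply: (@smooth_comp_linear _ _ _ _ (fun t : R => t *: a) id setT); first exact: openT.
  - by move=> x y w; rewrite scalerDl scalerA.
  - exact: scalel_continuous.
  exact: smooth_id.
have dm := smooth_diff sm (I : setT 0).
split; first exact/derivable1_diffP.
have dl k : is_derive (0 : R) 1 (fun t : R => t * a 0 k) (a 0 k).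
  have := is_deriveM (is_derive_id (0 : R) 1) (is_derive_cst (a 0 k) (0 : R) 1).
  by rewrite scaler0 add0r [_ *: _]mulr1.
have dc k : is_derive (0 : R) 1 (fun t : R => cos (t * a 0 k)) 0.
  have := @is_derive1_comp _ cos (fun t : R => t * a 0 k) 0 _ _ (is_derive_cos _) (dl k).
  by rewrite mul0r sin0 oppr0 mul0r.
have ds k : is_derive (0 : R) 1 (fun t : R => sin (t * a 0 k)) (a 0 k).
  have := @is_derive1_comp _ sin (fun t : R => t * a 0 k) 0 _ _ (is_derive_sin _) (dl k).
  by rewrite mul0r cos0 mul1r.
apply: Cn_eq => k; rewrite ?derive_re ?derive_im // mxE.
  rewrite (_ : (fun y : R => _) =
      (fun t => cos (t * a 0 k)) * cst (z.1 0 k) - (fun t => sin (t * a 0 k)) * cst (z.2 0 k)).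
    have := is_deriveB (is_deriveM (dc k) (is_derive_cst (z.1 0 k) (0 : R) 1))
      (is_deriveM (ds k) (is_derive_cst (z.2 0 k) (0 : R) 1)).
    by move=> [_ ->]; rewrite /cst /= /GRing.scale /=; ring.
  by apply/funext => t; rewrite !cE mxE.
rewrite (_ : (fun y : R => _) =
    (fun t => cos (t * a 0 k)) * cst (z.2 0 k) + (fun t => sin (t * a 0 k)) * cst (z.1 0 k)).
  have := is_deriveD (is_deriveM (dc k) (is_derive_cst (z.2 0 k) (0 : R) 1))
    (is_deriveM (ds k) (is_derive_cst (z.1 0 k) (0 : R) 1)).
  by move=> [_ ->]; rewrite /cst /= /GRing.scale /=; ring.
by apply/funext => t; rewrite !cE mxE.
Qed.

Lemma is_derive_rot_comp (V : normedModType R) (u : C -> V) a z : differentiable u z ->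
  'D_(rot_field a z) u z = 'D_1 (fun t : R => u (cmul (cexp (t *: a)) z)) 0.
Proof.
have [dm mE] := is_derive_rot a z; move/derivable1_diffP : dm => dm du.
have z0 : cmul (cexp ((0 : R) *: a)) z = z by rewrite scale0r cexp0 cmul1z.
have du' : differentiable u (cmul (cexp ((0 : R) *: a)) z) by rewrite z0.
apply: etrans (esym (@derive_comp _ _ _ u _ 0 (1 : R) dm du')).
by rewrite mE z0.
Qed.

(** The equivariance, differentiated at the unit along [exp (i t a)]. *)
Lemma inf_equivariant l u v Z a z : equivariant l u v Z -> Z z ->
  differentiable u z -> differentiable v z ->
  'D_(rot_field a z) u z = - weight l a * v z /\
  'D_(rot_field a z) v z = weight l a * u z.
Proof.
move=> eq Zz du dv; rewrite !is_derive_rot_comp //.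
have dl : is_derive (0 : R) 1 (fun t : R => t * weight l a) (weight l a).
  have := is_deriveM (is_derive_id (0 : R) 1) (is_derive_cst (weight l a) (0 : R) 1).
  by rewrite scaler0 add0r [_ *: _]mulr1.
have dc : is_derive (0 : R) 1 (fun t : R => cos (t * weight l a)) 0.
  have := @is_derive1_comp _ cos (fun t : R => t * weight l a) 0 _ _ (is_derive_cos _) dl.
  by rewrite mul0r sin0 oppr0 mul0r.
have ds : is_derive (0 : R) 1 (fun t : R => sin (t * weight l a)) (weight l a).
  have := @is_derive1_comp _ sin (fun t : R => t * weight l a) 0 _ _ (is_derive_sin _) dl.
  by rewrite mul0r cos0 mul1r.
split.
  rewrite (_ : (fun t : R => _) = (fun t => cos (t * weight l a)) * cst (u z)
      - (fun t => sin (t * weight l a)) * cst (v z)).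
    have := is_deriveB (is_deriveM dc (is_derive_cst (u z) (0 : R) 1))
      (is_deriveM ds (is_derive_cst (v z) (0 : R) 1)).
    by move=> [_ ->]; rewrite /cst /= /GRing.scale /=; ring.
  by apply/funext => t; have [-> _] := eq (t *: a) z Zz; rewrite weightZ.
rewrite (_ : (fun t : R => _) = (fun t => cos (t * weight l a)) * cst (v z)
    + (fun t => sin (t * weight l a)) * cst (u z)).
  have := is_deriveD (is_deriveM dc (is_derive_cst (v z) (0 : R) 1))
    (is_deriveM ds (is_derive_cst (u z) (0 : R) 1)).
  by move=> [_ ->]; rewrite /cst /= /GRing.scale /=; ring.
by apply/funext => t; have [_ ->] := eq (t *: a) z Zz; rewrite weightZ.
Qed.

Lemma line1 z (s : R) w k : (z + s *: w).1 0 k = z.1 0 k + s * w.1 0 k.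
Proof. by rewrite -[(z + s *: w).1]/(z.1 + s *: w.1) !mxE. Qed.

Lemma line2 z (s : R) w k : (z + s *: w).2 0 k = z.2 0 k + s * w.2 0 k.
Proof. by rewrite -[(z + s *: w).2]/(z.2 + s *: w.2) !mxE. Qed.

Lemma scale1C (s : R) w k : (s *: w).1 0 k = s * w.1 0 k.
Proof. by rewrite -[(s *: w).1]/(s *: w.1) !mxE. Qed.

Lemma scale2C (s : R) w k : (s *: w).2 0 k = s * w.2 0 k.
Proof. by rewrite -[(s *: w).2]/(s *: w.2) !mxE. Qed.

Lemma rot_field1 a z k : (rot_field a z).1 0 k = - (a 0 k * z.2 0 k).
Proof. by rewrite mxE. Qed.

Lemma rot_field2 a z k : (rot_field a z).2 0 k = a 0 k * z.1 0 k.
Proof. by rewrite mxE. Qed.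

Lemma axis_dir (f : C -> R) j x y z : differentiable f z ->
  'D_(axis j x y) f z = x * 'D_(axis j 1 0) f z + y * 'D_(axis j 0 1) f z.
Proof.
move=> df; have -> : axis j x y = x *: axis j 1 0 + y *: axis j 0 1.
  apply: Cn_eq => k.
    rewrite line1 scale1C !axis1; case: (k == j); rewrite /= ?(mulr0n, mulr1n); ring.
  rewrite line2 scale2C !axis2; case: (k == j); rewrite /= ?(mulr0n, mulr1n); ring.
by rewrite !deriveE // linearD !linearZ.
Qed.

Lemma near_line (Z : set C) z w : open Z -> Z z ->
  \forall s \near (0 : R), Z (z + s *: w).
Proof.
move=> oZ Zz.
have cl : {for (0 : R), continuous (fun s : R => z + s *: w)}.
  by apply: continuousD; [exact: cst_continuous|exact: scalel_continuous].
have : nbhs (z + (0 : R) *: w) Z by rewrite scale0r addr0; exact: open_nbhs_nbhs.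
by move=> /cl.
Qed.

Lemma pos_lower_bound (I : finType) (f : I -> R) : (forall i, 0 < f i) ->
  exists2 e : R, 0 < e & forall i, e <= f i.
Proof.
move=> f0; have H : \forall e \near (0 : R)^'+, forall i, e <= f i.
  by apply: filter_forall => i; exact: nbhs_right_le.
have [e []] := filter_ex (filterI (nbhs_right_gt (0 : R)) H).
by exists e.
Qed.

Lemma derive_line_eq (V : normedModType R) (f h : V -> R) (z w : V) :
  differentiable f z -> differentiable h z ->
  (forall s : R, f (z + s *: w) = h (z + s *: w)) -> 'D_w f z = 'D_w h z.
Proof.
move=> df dh fh; have z0 : z + (0 : R) *: w = z by rewrite scale0r addr0.
have df' : differentiable f (z + (0 : R) *: w) by rewrite z0.
have dh' : differentiable h (z + (0 : R) *: w) by rewrite z0.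
have [_] := is_derive_line df'; have [_] := is_derive_line dh'.
have -> : (fun t : R => h (z + t *: w)) = (fun t : R => f (z + t *: w)) by exact/funext.
by rewrite z0 => <- <-.
Qed.

Lemma derive_rot (f : C -> R) a z w : differentiable f (cmul (cexp a) z) ->
  'D_w (fun z => f (cmul (cexp a) z)) z = 'D_(cmul (cexp a) w) f (cmul (cexp a) z).
Proof.
move=> df; have sT : smooth_on (fun z : C => cmul (cexp a) z) setT.
  by apply: smooth_cmul; [exact: openT|exact: smooth_cst|exact: smooth_id].
have dT := smooth_diff sT (I : setT z).
rewrite (@derive_comp _ _ _ f (fun z => cmul (cexp a) z) z w dT df); congr ('D_ _ f _).
rewrite (@derive_comp_linear C C C (fun z => cmul (cexp a) z) id) ?derive_id //.
- move=> s x y; rewrite [s *: x + y]addrC [RHS]addrC; apply: Cn_eq => k.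
    by rewrite line1 !cmul1 line1 line2; ring.
  by rewrite line2 !cmul2 line1 line2; ring.
- by move=> y; exact: (smooth_cont sT I).
Qed.

Section Division.
Variables (Z : set C) (u v : C -> R) (l : 'I_n -> R) (r : C).
Hypotheses (oZ : open Z) (iZ : invariant Z) (su : smooth_on u Z)
  (sv : smooth_on v Z) (eq : equivariant l u v Z) (Zr : Z r) (r0 : nneg r).

(* [part] replaces the coordinates that do not vanish at [r] by their moduli: it
   fixes the nonnegative orthant, and makes an equivariant function invariant
   under the corresponding factors of the torus. *)
Let part z : C :=
  (\row_j (if r.1 0 j == 0 then z.1 0 j else Num.sqrt (mod2 z j)),
   \row_j (if r.1 0 j == 0 then z.2 0 j else 0)).

(** The directions of the Lie algebra that still act after [part]: those of the coordinates that
    vanish at [r]. *)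
Let restr a : 'rV[R]_n := \row_j (if r.1 0 j == 0 then a 0 j else 0).

Lemma mod2_part z k : mod2 (part z) k = mod2 z k.
Proof.
rewrite {1}/mod2 !mxE; case: ifP => // _.
by rewrite sqr_sqrtr ?mod2_ge0 // expr0n /= addr0.
Qed.

Lemma part_rot a z : part (cmul (cexp a) z) = cmul (cexp (restr a)) (part z).
Proof.
apply: Cn_eq => k; rewrite !cE !mxE; case: ifP => _ //=.
- by rewrite mod2_rot cos0 sin0; ring.
- by rewrite cos0 sin0; ring.
Qed.

Lemma part_nneg z : nneg z -> part z = z.
Proof.
move=> [z2 z1]; apply: Cn_eq => k; rewrite !mxE; case: ifP => _ //=.
- by rewrite mod2_real // sqrtr_sqr ger0_norm.
- by rewrite z2 mxE.
Qed.

(** The second bound keeps the coordinates that are nonzero at [r] away from zero, so that the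
    square roots in [part] are smooth. *)
Lemma good_radius : exists2 e : R, 0 < e &
  (forall z, (forall k, `|mod2 z k - mod2 r k| < e) -> Z z) /\
  (forall k, r.1 0 k != 0 -> e <= mod2 r k).
Proof.
have [e e0 eZ] := invariant_moduli oZ iZ Zr.
have [d d0 dr] : exists2 d : R, 0 < d & forall k, d <= if r.1 0 k == 0 then e else mod2 r k.
  apply: pos_lower_bound => k; case: ifPn => // rk.
  by rewrite mod2_real ?r0.1 // lt_def sqrf_eq0 rk sqr_ge0.
exists (Order.min d e); first by rewrite lt_min d0 e0.
split=> [z zr|k rk].
  by apply: eZ => k; apply: lt_le_trans (zr k) _; rewrite ge_min lexx orbT.
by have := dr k; rewrite (negbTE rk) => h; rewrite ge_min h.
Qed.

Variable e : R.
Hypotheses (e0 : 0 < e)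
  (eZ : forall z, (forall k, `|mod2 z k - mod2 r k| < e) -> Z z)
  (er : forall k, r.1 0 k != 0 -> e <= mod2 r k).

Let Z1 := [set z : C | forall k, `|mod2 z k - mod2 r k| < e].

Lemma open_Z1 : open Z1. Proof. exact: open_moduli. Qed.
Let oZ1 := open_Z1.

Lemma Z1_part z : Z1 z -> Z1 (part z).
Proof. by move=> H k; rewrite mod2_part. Qed.

Lemma Z1_rot a z : Z1 z -> Z1 (cmul (cexp a) z).
Proof. by move=> H k; rewrite mod2_rot. Qed.

Lemma Z1_r : Z1 r.
Proof. by move=> k; rewrite subrr normr0. Qed.

Lemma smooth_part : smooth_on part Z1.
Proof.
apply: smooth_pair => //; apply: smooth_row => // j; have [rj|rj] := eqVneq (r.1 0 j) 0.
- by apply: smooth_re => //; exact: smooth_id.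
- apply: smooth_sqrt => //; last by apply: smooth_mod2 => //; exact: smooth_id.
  move=> z /(_ j); have := er rj; rewrite ltr_norml => h /andP[h1 _]; lra.
- by apply: smooth_im => //; exact: smooth_id.
- exact: smooth_cst.
Qed.

Let gu z := u (part z).
Let gv z := v (part z).

Lemma smooth_gu : smooth_on gu Z1.
Proof.
refine (@smooth_comp _ _ _ _ u part Z1 Z (fdimC n) fdimR oZ1 oZ _ smooth_part su) => z /Z1_part; exact: eZ.
Qed.

Lemma smooth_gv : smooth_on gv Z1.
Proof.
refine (@smooth_comp _ _ _ _ v part Z1 Z (fdimC n) fdimR oZ1 oZ _ smooth_part sv) => z /Z1_part; exact: eZ.
Qed.

(** Rotating a zero coordinate of [r] fixes [r], so by [fixed_weight] a function that is nonzero at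
    [r] has weight zero in that direction. Composing with [part] removes the other weights and
    changes nothing on the orthant. *)
Lemma division_nonzero : u r != 0 \/ v r != 0 ->
  [/\ smooth_on gu Z1, smooth_on gv Z1,
      (forall a z, Z1 z -> gu (cmul (cexp a) z) = gu z /\ gv (cmul (cexp a) z) = gv z),
      gu r != 0 \/ gv r != 0
    & forall z, Z1 z -> nneg z -> u z * gv z = v z * gu z].
Proof.
move=> uv; split; [exact: smooth_gu|exact: smooth_gv| | |].
- have l0 k : r.1 0 k = 0 -> l k = 0.
    move=> rk; apply/eqP/negPn/negP => lk.
    have [||ur vr] := @fixed_weight l u v Z (delta_mx 0 k) r eq Zr.
    - move=> i; rewrite mxE; have [->|ik] := eqVneq i k; last by rewrite andbF eqxx.
      by rewrite rk r0.1 mxE.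
    - by rewrite weight_delta.
    by case: uv; rewrite ?ur ?vr eqxx.
  move=> a z /Z1_part/eZ Zp.
  have w0 : weight l (restr a) = 0.
    rewrite /weight big1 // => j _; rewrite mxE; case: ifPn => [/eqP/l0 ->|_].
      by rewrite mulr0.
    by rewrite mul0r.
  rewrite /gu /gv part_rot; have [-> ->] := eq (restr a) Zp.
  by rewrite w0 cos0 sin0 !mul1r !mul0r subr0 addr0.
- by rewrite /gu /gv part_nneg.
- by move=> z Zz zn; rewrite /gu /gv part_nneg // mulrC.
Qed.

Lemma directions (f : C -> R) w z : differentiable f z ->
  'D_w f z = \sum_j (w.1 0 j * 'D_(axis j 1 0) f z + w.2 0 j * 'D_(axis j 0 1) f z).
Proof.
move=> df; rewrite deriveE //.
have {1}-> : w = \sum_j (w.1 0 j *: axis j 1 0 + w.2 0 j *: axis j 0 1).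
  have E : forall s : seq 'I_n, \sum_(j <- s) (w.1 0 j *: axis j 1 0 + w.2 0 j *: axis j 0 1) =
     (\sum_(j <- s) w.1 0 j *: delta_mx 0 j, \sum_(j <- s) w.2 0 j *: delta_mx 0 j).
    elim=> [|j s IH]; rewrite ?big_nil // !big_cons IH /axis !locked_withE.
    by congr (_, _); rewrite /= ?scale1r ?scale0r ?scaler0 ?addr0 ?add0r.
  by rewrite E -!row_sum_delta; case: (w).
rewrite linear_sum; apply: eq_bigr => j _.
by rewrite linearD !linearZ /= !deriveE.
Qed.

Section Vanishing.
Hypotheses (ur : u r = 0) (vr : v r = 0).
Variables (w : C) (a0 : 'rV[R]_n).
Hypotheses (dw : 'D_w u r != 0 \/ 'D_w v r != 0) (la0 : weight l a0 != 0)
  (ar0 : forall k, a0 0 k * r.1 0 k = 0).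

Let du : differentiable u r. Proof. exact: smooth_diff su Zr. Qed.
Let dv : differentiable v r. Proof. exact: smooth_diff sv Zr. Qed.

Lemma vanishing_coordinate : exists j, exists x y : R,
  'D_(axis j x y) u r != 0 \/ 'D_(axis j x y) v r != 0.
Proof.
apply: contrapT => H.
have H' j x y : 'D_(axis j x y) u r = 0 /\ 'D_(axis j x y) v r = 0.
  by split; apply/eqP/negPn/negP => h; apply: H; exists j, x, y; [left|right].
case: dw; rewrite directions // big1 ?eqxx // => j _; have [h1 h2] := H' j 1 0;
  have [h3 h4] := H' j 0 1; by rewrite ?h1 ?h2 ?h3 ?h4 !mulr0 addr0.
Qed.

(** The direction [a] fixes every point of the line from [r] along the axis [j]. If its weight were
    nonzero, [u] and [v] would vanish on this line near [r], and so would their derivatives along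
    it. *)
Lemma vanishing_weight j x y :
  'D_(axis j x y) u r != 0 \/ 'D_(axis j x y) v r != 0 ->
  forall a, (forall k, a 0 k * r.1 0 k = 0) -> a 0 j = 0 -> weight l a = 0.
Proof.
move=> dxy a ar aj; apply/eqP/negPn/negP => la.
have H : \forall s \near (0 : R), u (r + s *: axis j x y) = 0 /\ v (r + s *: axis j x y) = 0.
  apply: filterS (near_line (axis j x y) oZ Zr) => s Zs.
  apply: (fixed_weight eq Zs _ la) => k ak.
  have kj : k != j by apply: contraNneq ak => ->; rewrite aj.
  have rk : r.1 0 k = 0 by have := ar k => /eqP; rewrite mulf_eq0 (negbTE ak) => /eqP.
  have r2 : r.2 0 k = 0 by rewrite r0.1 mxE.
  by rewrite line1 line2 axis1 axis2 (negbTE kj) !mulr0 rk r2 addr0.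
have Du : 'D_(axis j x y) u r = 0.
  by apply: derive_line_eq0 => //; apply: filterS H => s [].
have Dv : 'D_(axis j x y) v r = 0.
  by apply: derive_line_eq0 => //; apply: filterS H => s [].
by case: dxy; rewrite ?Du ?Dv eqxx.
Qed.

(** Cauchy-Riemann equations at [r], of weight [l j]. At [r + s *: axis j x y] the infinitesimal
    rotation of the coordinate [j] is [s] times the quarter turn of the axis; infinitesimal
    equivariance along this line is differentiated at [s = 0]. *)
Lemma vanishing_rot j x y : r.1 0 j = 0 ->
  'D_(axis j (- y) x) u r = - l j * 'D_(axis j x y) v r /\
  'D_(axis j (- y) x) v r = l j * 'D_(axis j x y) u r.
Proof.
move=> rj; have rE (s : R) : rot_field (delta_mx 0 j) (r + s *: axis j x y) = s *: axis j (- y) x.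
  have dk k : (delta_mx 0 j : 'rV[R]_n) 0 k = (k == j)%:R by rewrite mxE.
  apply: Cn_eq => k.
    rewrite scale1C rot_field1 line2 dk axis1 axis2 r0.1 mxE.
    by case: (k == j); rewrite /= ?(mulr0n, mulr1n); ring.
  rewrite scale2C axis2 rot_field2 line1 axis1 dk.
  by have [->|_] := eqVneq k j; rewrite /= ?(mulr0n, mulr1n) ?rj; ring.
have key (f h : C -> R) (m : R) : smooth_on f Z -> smooth_on h Z -> f r = 0 -> h r = 0 ->
  (forall z, Z z -> 'D_(rot_field (delta_mx 0 j) z) f z = m * h z) ->
  'D_(axis j (- y) x) f r = m * 'D_(axis j x y) h r.
  move=> sf sh fr hr H.
  pose D z := 'D_(axis j (- y) x) f z.
  have sD : smooth_on D Z by exact: smooth_derive.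
  have r0E : r + (0 : R) *: axis j x y = r by rewrite scale0r addr0.
  have Zr' : Z (r + (0 : R) *: axis j x y) by rewrite r0E.
  have [d1 _] := is_derive_line (smooth_diff sD Zr').
  have d2 := is_derive_line (smooth_diff sh Zr').
  have E : \forall s \near (0 : R), s * D (r + s *: axis j x y) = m * h (r + s *: axis j x y).
    apply: filterS (near_line (axis j x y) oZ Zr) => s Zs.
    rewrite -H // rE deriveE; last exact: smooth_diff sf Zs.
    by rewrite linearZ /= /D -deriveE //; exact: smooth_diff sf Zs.
  have := near_eq_derive (1 : R) E.
  have [_ ->] := is_deriveM (is_derive_id (0 : R) (1 : R)) (derivableP d1).
  have [_ ->] := is_deriveM (is_derive_cst m (0 : R) (1 : R)) d2.
  by rewrite scale0r add0r scaler0 addr0 r0E [_ *: 1]mulr1.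
have wj : weight l (delta_mx 0 j) = l j := weight_delta l j.
split; apply: key => // z Zz; have := inf_equivariant (delta_mx 0 j) eq Zz
  (smooth_diff su Zz) (smooth_diff sv Zz); by rewrite wj => -[].
Qed.

(** Applied to two quarter turns of an axis, which reverse it and multiply the derivative by
    [- m^2]. *)
Lemma sqr_eq1_of (m d : R) : - d = - m * (m * d) -> d != 0 -> m ^+ 2 = 1.
Proof.
move=> h d0; apply: (mulIf d0); rewrite mul1r expr2 -mulrA; apply: oppr_inj.
by rewrite -mulNr.
Qed.

(* Where the function vanishes it is equivariant under a single factor of the
   torus, and of weight [1] or [-1] since its derivative is not zero. *)
Lemma vanishing_structure : exists j, [/\ r.1 0 j = 0,
  forall a, weight l (restr a) = a 0 j * l j, l j ^+ 2 = 1,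
  'D_(axis j 0 1) u r = - l j * 'D_(axis j 1 0) v r /\
  'D_(axis j 0 1) v r = l j * 'D_(axis j 1 0) u r
  & 'D_(axis j 1 0) u r != 0 \/ 'D_(axis j 1 0) v r != 0].
Proof.
have [j [x [y dxy]]] := vanishing_coordinate.
have W := vanishing_weight dxy.
have rj : r.1 0 j = 0.
  have := ar0 j => /eqP; rewrite mulf_eq0 => /orP[/eqP aj|/eqP//].
  by move: la0; rewrite W ?eqxx.
have W' i : r.1 0 i = 0 -> i != j -> l i = 0.
  move=> ri ij; rewrite -weight_delta; apply: W => [k|]; rewrite mxE /=.
    by have [->|_] := eqVneq k i; rewrite ?ri ?mulr0 // mul0r.
  by rewrite eq_sym (negbTE ij).
exists j.
have [E1 E2] := vanishing_rot 1 0 rj; rewrite oppr0 in E1 E2.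
have [E3 E4] := vanishing_rot 0 1 rj.
have N (f : C -> R) : differentiable f r -> 'D_(axis j (-1) 0) f r = - 'D_(axis j 1 0) f r.
  by move=> df; rewrite (axis_dir j (-1) 0) // mul0r addr0 mulN1r.
rewrite (N u du) in E3; rewrite (N v dv) in E4.
have ne : 'D_(axis j 1 0) u r != 0 \/ 'D_(axis j 1 0) v r != 0.
  apply: contrapT => /not_orP[/negP/negPn/eqP h1 /negP/negPn/eqP h2].
  by case: dxy; rewrite (axis_dir j x y) // ?E1 ?E2 ?h1 ?h2 !mulr0 addr0 eqxx.
split; [exact: rj| | |exact: (conj E1 E2)|exact: ne].
- move=> a; rewrite /weight (bigD1 j) //= mxE rj eqxx big1 ?addr0 // => i ij.
  by rewrite mxE; case: ifPn => [/eqP/W'/(_ ij) ->|_]; rewrite ?mulr0 ?mul0r.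
- case: ne => h; apply: sqr_eq1_of h; first by rewrite -E2.
  by rewrite E4 E1; ring.
Qed.

End Vanishing.

Lemma part_line j x y (s : R) : r.1 0 j = 0 ->
  part (r + s *: axis j x y) = r + s *: axis j x y.
Proof.
move=> rj; apply: Cn_eq => k; rewrite mxE; have [->|kj] := eqVneq k j.
- by rewrite rj eqxx.
- case: ifPn => // rk; rewrite /mod2 line1 line2 axis1 axis2 (negbTE kj) !mulr0 !addr0.
  by rewrite r0.1 mxE expr0n addr0 sqrtr_sqr ger0_norm // r0.2.
- by rewrite rj eqxx.
- case: ifPn => // rk; rewrite line2 axis2 (negbTE kj) mulr0 addr0.
  by rewrite r0.1 mxE.
Qed.

Lemma gu_r j x y : r.1 0 j = 0 -> 'D_(axis j x y) gu r = 'D_(axis j x y) u r.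
Proof.
move=> rj; apply: derive_line_eq => [||s]; last by rewrite /gu part_line.
  exact: smooth_diff smooth_gu Z1_r.
exact: smooth_diff su Zr.
Qed.

Lemma gv_r j x y : r.1 0 j = 0 -> 'D_(axis j x y) gv r = 'D_(axis j x y) v r.
Proof.
move=> rj; apply: derive_line_eq => [||s]; last by rewrite /gv part_line.
  exact: smooth_diff smooth_gv Z1_r.
exact: smooth_diff sv Zr.
Qed.

Section Quotient.
Variable j : 'I_n.
Hypotheses (rj : r.1 0 j = 0) (wj : forall a, weight l (restr a) = a 0 j * l j)
  (m2 : l j ^+ 2 = 1)
  (E1 : 'D_(axis j 0 1) u r = - l j * 'D_(axis j 1 0) v r)
  (E2 : 'D_(axis j 0 1) v r = l j * 'D_(axis j 1 0) u r)
  (ne : 'D_(axis j 1 0) u r != 0 \/ 'D_(axis j 1 0) v r != 0).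

Let m := l j.

Lemma equiv_g : equivariant (fun i => m *+ (i == j)) gu gv Z1.
Proof.
have wE a : weight (fun i => m *+ (i == j)) a = a 0 j * m.
  rewrite /weight (bigD1 j) //= eqxx mulr1n big1 ?addr0 // => i /negbTE ->.
  by rewrite mulr0n mulr0.
move=> a z /Z1_part/eZ Zp; rewrite wE /gu /gv part_rot.
by have := eq (restr a) Zp; rewrite wj.
Qed.

(* With [g = gu + i gv] and [h = h1 + i h2 = (d/dx_j - i m d/dy_j) g], the
   quotient of [g] by the coordinate [j] on the nonnegative orthant is the
   integral of [s h (sg s z)], where [sg s] scales the coordinate [j] by [s]; it
   is the integral of the derivative of [s g (sg s z)], divided by that
   coordinate. *)
Let h1 z := 'D_(axis j 1 0) gu z + m * 'D_(axis j 0 1) gv z.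
Let h2 z := 'D_(axis j 1 0) gv z - m * 'D_(axis j 0 1) gu z.

Let sg (s : R) z : C :=
  (\row_i ((if i == j then s else 1) * z.1 0 i), \row_i ((if i == j then s else 1) * z.2 0 i)).

Let q1 z := \int[mu]_(s in `[0, 1]) (s * h1 (sg s z)).
Let q2 z := \int[mu]_(s in `[0, 1]) (s * h2 (sg s z)).

Let W := [set p : R * C | Z1 (sg p.1 p.2)].

Lemma smooth_sg : smooth_on (fun p : R * C => sg p.1 p.2) setT.
Proof.
have oT := @openT (R * C)%type.
have s1 : smooth_on (fun p : R * C => p.1) setT by apply: smooth_fst => //; exact: smooth_id.
have s2 : smooth_on (fun p : R * C => p.2) setT by apply: smooth_snd => //; exact: smooth_id.
have si i : smooth_on (fun p : R * C => if i == j then p.1 else 1) setT.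
  by case: (i == j) => //; exact: smooth_cst.
apply: smooth_pair => //; apply: smooth_row => // i; apply: smoothM => //.
  exact: smooth_re.
exact: smooth_im.
Qed.

Lemma open_W : open W.
Proof.
apply: (@open_comp _ _ (fun p : R * C => sg p.1 p.2) Z1) => // p _.
exact: (smooth_cont smooth_sg).
Qed.

(** Scaling by [s] only shrinks the modulus of the coordinate [j], which is zero at [r]. *)
Lemma sg_W s z : 0 <= s <= 1 -> Z1 z -> W (s, z).
Proof.
move=> /andP[s0 s1] Zz k; rewrite /= /mod2 !mxE.
have [->|_] := eqVneq k j; last by rewrite !mul1r; exact: Zz.
have := Zz j; rewrite /mod2 r0.1 !mxE rj expr0n /= addr0 !subr0.
apply: le_lt_trans; rewrite !exprMn -mulrDr normrM ger0_norm ?sqr_ge0 //.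
by rewrite ler_piMl // expr_le1.
Qed.

Lemma smooth_h1 : smooth_on h1 Z1.
Proof.
apply: smoothD => //; first exact: smooth_derive smooth_gu.
by apply: smoothM => //; [exact: smooth_cst|exact: smooth_derive smooth_gv].
Qed.

Lemma smooth_h2 : smooth_on h2 Z1.
Proof.
apply: smoothB => //; first exact: smooth_derive smooth_gv.
by apply: smoothM => //; [exact: smooth_cst|exact: smooth_derive smooth_gu].
Qed.

Lemma smooth_scaled (h : C -> R) : smooth_on h Z1 ->
  smooth_on (fun p : R * C => p.1 * h (sg p.1 p.2)) W.
Proof.
move=> sh; have oW := open_W; apply: smoothM => //.
  by apply: smooth_fst => //; exact: smooth_id.
apply: (@smooth_comp _ _ _ _ h (fun p : R * C => sg p.1 p.2) W Z1 (fdimC n) fdimR oW oZ1) => //.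
exact: smooth_sub smooth_sg.
Qed.

Lemma smooth_q1 : smooth_on q1 Z1.
Proof.
exact: (smooth_param_int (fdimC n) oZ1 open_W sg_W (smooth_scaled smooth_h1)).
Qed.

Lemma smooth_q2 : smooth_on q2 Z1.
Proof.
exact: (smooth_param_int (fdimC n) oZ1 open_W sg_W (smooth_scaled smooth_h2)).
Qed.

Lemma sg_rot s a z : sg s (cmul (cexp a) z) = cmul (cexp a) (sg s z).
Proof. by apply: Cn_eq => k; rewrite !cE !mxE; ring. Qed.

Lemma sqr1_cases : m = 1 \/ m = -1.
Proof.
have /eqP : (m - 1) * (m + 1) = 0 by have := m2; rewrite -/m; nra.
rewrite mulf_eq0 subr_eq0 addr_eq0 => /orP[/eqP|/eqP]; by [left|right].
Qed.

Lemma weight_m a : weight (fun i => m *+ (i == j)) a = a 0 j * m.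
Proof.
rewrite /weight (bigD1 j) //= eqxx mulr1n big1 ?addr0 // => i /negbTE ->.
by rewrite mulr0n mulr0.
Qed.

Lemma g_derive_rot a z w : Z1 z ->
  'D_(cmul (cexp a) w) gu (cmul (cexp a) z) =
    cos (a 0 j) * 'D_w gu z - m * sin (a 0 j) * 'D_w gv z /\
  'D_(cmul (cexp a) w) gv (cmul (cexp a) z) =
    cos (a 0 j) * 'D_w gv z + m * sin (a 0 j) * 'D_w gu z.
Proof.
move=> Zz; have Zt := Z1_rot a Zz.
have dgu := smooth_diff smooth_gu Zz; have dgv := smooth_diff smooth_gv Zz.
(* As [m] is 1 or -1, it drops from the cosine and moves out of the sine. *)
have cm : cos (a 0 j * m) = cos (a 0 j).
  by case: sqr1_cases => ->; rewrite ?mulr1 // mulrN1 cosN.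
have sm : sin (a 0 j * m) = m * sin (a 0 j).
  by case: sqr1_cases => ->; rewrite ?mulr1 ?mul1r // mulrN1 sinN mulN1r.
rewrite -!derive_rot; [|exact: smooth_diff smooth_gv Zt|exact: smooth_diff smooth_gu Zt].
have nz : nbhs z Z1 by exact: open_nbhs_nbhs.
have Eu : \forall y \near z, gu (cmul (cexp a) y) = cos (a 0 j) * gu y - m * sin (a 0 j) * gv y.
  by apply: filterS nz => y Zy; have [-> _] := equiv_g a Zy; rewrite weight_m cm sm.
have Ev : \forall y \near z, gv (cmul (cexp a) y) = cos (a 0 j) * gv y + m * sin (a 0 j) * gu y.
  by apply: filterS nz => y Zy; have [_ ->] := equiv_g a Zy; rewrite weight_m cm sm.
have du' : derivable gu z w by exact: diff_derivable.
have dv' : derivable gv z w by exact: diff_derivable.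
rewrite (near_eq_derive _ Eu) (near_eq_derive _ Ev); split.
  have := is_deriveB (is_deriveM (is_derive_cst (cos (a 0 j)) z w) (derivableP du'))
    (is_deriveM (is_derive_cst (m * sin (a 0 j)) z w) (derivableP dv')).
  by case=> _ ->; rewrite /cst /= /GRing.scale /=; ring.
have := is_deriveD (is_deriveM (is_derive_cst (cos (a 0 j)) z w) (derivableP dv'))
  (is_deriveM (is_derive_cst (m * sin (a 0 j)) z w) (derivableP du')).
by case=> _ ->; rewrite /cst /= /GRing.scale /=; ring.
Qed.

Lemma cexp_axis a x y : cmul (cexp a) (axis j x y) =
  axis j (cos (a 0 j) * x - sin (a 0 j) * y) (cos (a 0 j) * y + sin (a 0 j) * x).
Proof.
apply: Cn_eq => k.
  rewrite cmul1 cexp1 cexp2 !axis1 axis2.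
  by have [->|_] := eqVneq k j; rewrite /= ?(mulr0n, mulr1n); ring.
rewrite cmul2 cexp1 cexp2 axis1 !axis2.
by have [->|_] := eqVneq k j; rewrite /= ?(mulr0n, mulr1n); ring.
Qed.

(** [h1 + i h2] is twice the Wirtinger derivative of [g] in the coordinate [j] if [m = 1], and in
    its conjugate if [m = -1]; this brings the weight of [g] to zero. *)
Lemma h_inv a z : Z1 z -> h1 (cmul (cexp a) z) = h1 z /\ h2 (cmul (cexp a) z) = h2 z.
Proof.
move=> Zz; have Zt := Z1_rot a Zz.
have dgu := smooth_diff smooth_gu Zt; have dgv := smooth_diff smooth_gv Zt.
have [H1 H2] := g_derive_rot a (axis j 1 0) Zz.
have [H3 H4] := g_derive_rot a (axis j 0 1) Zz.
rewrite !cexp_axis !mulr1 !mulr0 !subr0 !add0r in H1 H2 H3 H4.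
rewrite (axis_dir j (cos _) _ dgu) in H1; rewrite (axis_dir j (cos _) _ dgv) in H2.
rewrite (axis_dir j (- _) _ dgu) in H3; rewrite (axis_dir j (- _) _ dgv) in H4.
move: H1 H2 H3 H4; rewrite /h1 /h2; have := cos2Dsin2 (a 0 j).
move: m2; rewrite -/m.
set X1 := 'D_(axis j 1 0) gu (cmul _ _); set Y1 := 'D_(axis j 0 1) gu (cmul _ _).
set X2 := 'D_(axis j 1 0) gv (cmul _ _); set Y2 := 'D_(axis j 0 1) gv (cmul _ _).
move: X1 Y1 X2 Y2 ('D_(axis j 1 0) gu z) ('D_(axis j 0 1) gu z)
  ('D_(axis j 1 0) gv z) ('D_(axis j 0 1) gv z) (cos _) (sin _) (m).
move=> X1 Y1 X2 Y2 x1 y1 x2 y2 c s k k2 cs H1 H2 H3 H4.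
have X1E : X1 = c * (c * x1 - k * s * x2) - s * (c * y1 - k * s * y2).
  by rewrite -H1 -H3 -[LHS]mul1r -cs; ring.
have Y1E : Y1 = s * (c * x1 - k * s * x2) + c * (c * y1 - k * s * y2).
  by rewrite -H1 -H3 -[LHS]mul1r -cs; ring.
have X2E : X2 = c * (c * x2 + k * s * x1) - s * (c * y2 + k * s * y1).
  by rewrite -H2 -H4 -[LHS]mul1r -cs; ring.
have Y2E : Y2 = s * (c * x2 + k * s * x1) + c * (c * y2 + k * s * y1).
  by rewrite -H2 -H4 -[LHS]mul1r -cs; ring.
split; apply: subr0_eq.
  transitivity ((c ^+ 2 + s ^+ 2 - 1) * (x1 + k * y2) + (k ^+ 2 - 1) * (s ^+ 2 * x1 + c * s * y1)).
    by rewrite X1E Y2E; ring.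
  by rewrite cs k2 !subrr !mul0r addr0.
transitivity ((c ^+ 2 + s ^+ 2 - 1) * (x2 - k * y1) + (k ^+ 2 - 1) * (s ^+ 2 * x2 + c * s * y2)).
  by rewrite X2E Y1E; ring.
by rewrite cs k2 !subrr !mul0r addr0.
Qed.

Lemma q_inv a z : Z1 z -> q1 (cmul (cexp a) z) = q1 z /\ q2 (cmul (cexp a) z) = q2 z.
Proof.
move=> Zz; split; apply: eq_Rintegral => s; rewrite inE /= in_itv /= => s01;
  rewrite sg_rot; have [H1 H2] := h_inv a (sg_W s01 Zz); by rewrite ?H1 ?H2.
Qed.

Lemma sg_line s z : nneg z -> sg s z = sg 0 z + s *: axis j (z.1 0 j) 0.
Proof.
move=> [z2 z1]; apply: Cn_eq => k.
  rewrite line1 axis1 !mxE.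
  by have [->|_] := eqVneq k j; rewrite /= ?(mulr0n, mulr1n); ring.
by rewrite line2 axis2 !mxE z2 mxE mul0rn !mulr0 addr0.
Qed.

Lemma continuous_scaled (h : C -> R) z (s : R) : smooth_on h Z1 -> Z1 z ->
  0 <= s <= 1 -> {for s, continuous (fun s : R => s * h (sg s z))}.
Proof.
move=> sh Zz; move: s; apply: (@param_slice _ _ (fun p : R * C => p.1 * h (sg p.1 p.2)) W).
- exact: open_W.
- by move=> s s01; exact: sg_W.
- exact: smooth_scaled.
Qed.

(** The last hypothesis says that [s f (sg s z)] has derivative [z_j s h (sg s z)]; its values at 1
    and 0 are [f z] and 0. *)
Lemma q_quot_key (f h : C -> R) z : smooth_on f Z1 -> smooth_on h Z1 ->
  Z1 z -> nneg z ->
  (forall s, 0 <= s <= 1 -> f (sg s z) + s * (z.1 0 j * 'D_(axis j 1 0) f (sg s z)) =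
     z.1 0 j * (s * h (sg s z))) ->
  z.1 0 j * \int[mu]_(s in `[0, 1]) (s * h (sg s z)) = f z.
Proof.
move=> sf sh Zz zn E.
have ch := continuous_scaled sh Zz.
rewrite -RintegralZl //; last exact: integrable01.
apply: (etrans (@FTC01 (fun s => s * f (sg s z)) (fun s => z.1 0 j * (s * h (sg s z))) _ _)).
- move=> s s01; have Zs := sg_W s01 Zz.
  have df : differentiable f (sg 0 z + s *: axis j (z.1 0 j) 0).
    by rewrite -sg_line //; exact: smooth_diff sf Zs.
  have := is_deriveM (is_derive_id s (1 : R)) (is_derive_line df).
  rewrite -sg_line // (axis_dir _ _ _ (smooth_diff sf Zs)) mul0r addr0 => H.
  rewrite -E //.
  have -> : (fun s => s * f (sg s z)) = id * (fun t => f (sg 0 z + t *: axis j (z.1 0 j) 0)).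
    by apply/funext => t; rewrite (sg_line t zn).
  by move: H; rewrite [_%:A]mulr1 addrC.
- move=> s s01; apply: continuousM; first exact: cst_continuous.
  exact: ch.
- rewrite mul0r subr0 mul1r; congr f; apply: Cn_eq => k; rewrite !mxE;
  by case: ifP; rewrite mul1r.
Qed.

(** At a point [sg s z] of the orthant the rotation of the coordinate [j] is [s z_j] times the
    imaginary axis, so infinitesimal equivariance turns the derivatives in [y_j] that occur in [h]
    into values of [g]. Thanks to [m^2 = 1] these are the remaining term of the product rule. *)
Lemma q_quot z : Z1 z -> nneg z -> z.1 0 j * q1 z = u z /\ z.1 0 j * q2 z = v z.
Proof.
move=> Zz zn; have [z2 z1] := zn.
have key s : 0 <= s <= 1 ->
    s * (z.1 0 j * 'D_(axis j 0 1) gu (sg s z)) = - m * gv (sg s z) /\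
    s * (z.1 0 j * 'D_(axis j 0 1) gv (sg s z)) = m * gu (sg s z).
  move=> s01; have Zs := sg_W s01 Zz.
  have dgu := smooth_diff smooth_gu Zs; have dgv := smooth_diff smooth_gv Zs.
  have := inf_equivariant (delta_mx 0 j) equiv_g Zs dgu dgv.
  rewrite weight_m mxE !eqxx mul1r.
  have -> : rot_field (delta_mx 0 j) (sg s z) = axis j 0 (s * z.1 0 j).
    apply: Cn_eq => k.
      by rewrite rot_field1 axis1 mul0rn !mxE z2 mxE !mulr0 oppr0.
    rewrite rot_field2 axis2 !mxE eqxx /=.
    by have [->|_] := eqVneq k j; rewrite /= ?(mulr0n, mulr1n) ?mul1r ?mul0r.
  by rewrite (axis_dir j 0 _ dgu) (axis_dir j 0 _ dgv) !mul0r !add0r !mulrA.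
have mm : m * m = 1 by rewrite -expr2.
split.
  rewrite (q_quot_key smooth_gu smooth_h1) //; first by rewrite /gu part_nneg.
  move=> s /key[_ E]; rewrite /h1.
  have -> : gu (sg s z) = m * (s * (z.1 0 j * 'D_(axis j 0 1) gv (sg s z))).
    by rewrite E mulrA mm mul1r.
  by ring.
rewrite (q_quot_key smooth_gv smooth_h2) //; first by rewrite /gv part_nneg.
move=> s /key[E _]; rewrite /h2.
have -> : gv (sg s z) = - m * (s * (z.1 0 j * 'D_(axis j 0 1) gu (sg s z))).
  by rewrite E mulrA mulrNN mm mul1r.
by ring.
Qed.

(** [sg s] fixes [r], so the integrals are half of [h r], and the two terms of [h r] are equal by
    [E1] and [E2]. *)
Lemma q_r : q1 r = 'D_(axis j 1 0) u r /\ q2 r = 'D_(axis j 1 0) v r.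
Proof.
have sr s : sg s r = r.
  apply: Cn_eq => k; rewrite !mxE ?r0.1 ?mxE ?mulr0 //.
  by have [->|_] := eqVneq k j; rewrite ?rj ?mulr0 ?mul1r.
have half (x : R) : \int[mu]_(s in `[0, 1]) (s * x) = x / 2.
  apply: (etrans (@FTC01 (fun s => s * s * (x / 2)) (fun s => s * x) _ _)).
  - move=> s _; have := is_deriveM (is_deriveM (is_derive_id s (1 : R)) (is_derive_id s (1 : R)))
      (is_derive_cst (x / 2) s (1 : R)).
    move=> H; apply: is_derive_eq; rewrite /cst /GRing.scale /=.
    by field.
  - move=> s _; apply: continuousM; first exact: cvg_id.
    exact: cst_continuous.
  - by rewrite !mul1r !mul0r subr0.
rewrite /q1 /q2.
have -> : (fun s : R => s * h1 (sg s r)) = (fun s => s * h1 r) by apply/funext => s; rewrite sr.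
have -> : (fun s : R => s * h2 (sg s r)) = (fun s => s * h2 r) by apply/funext => s; rewrite sr.
rewrite !half /h1 /h2 !gu_r // !gv_r // E1 E2 -/m.
have mm : m * m = 1 by rewrite -expr2.
split.
  by rewrite mulrA mm mul1r; field.
by rewrite mulrA mulrN mm mulN1r opprK; field.
Qed.

End Quotient.
(** The identity [u g2 = v g1] compares arguments modulo pi only, and so serves both for the
    function itself and for its quotient by a coordinate. The second alternative of the hypothesis
    describes a first-order zero, with a direction that fixes [r] and has nonzero weight. *)
Lemma division :
  (u r != 0 \/ v r != 0) \/
  ((exists w, 'D_w u r != 0 \/ 'D_w v r != 0) /\
   exists2 a, weight l a != 0 & forall k, a 0 k * r.1 0 k = 0) ->
  exists g1 g2 : C -> R,
  [/\ smooth_on g1 Z1, smooth_on g2 Z1,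
      (forall a z, Z1 z -> g1 (cmul (cexp a) z) = g1 z /\ g2 (cmul (cexp a) z) = g2 z),
      g1 r != 0 \/ g2 r != 0
    & forall z, Z1 z -> nneg z -> u z * g2 z = v z * g1 z].
Proof.
move=> H; have [uv|] := pselect (u r != 0 \/ v r != 0).
  by exists gu, gv; exact: division_nonzero.
move=> /not_orP[/negP/negPn/eqP ur /negP/negPn/eqP vr].
case: H => [|[[w dw] [a la ar]]]; first by rewrite ur vr eqxx => -[].
have [j [rj wj m2 [E1 E2] ne]] := vanishing_structure ur vr dw la ar.
eexists; eexists; split.
- exact: smooth_q1 rj.
- exact: smooth_q2 rj.
- by move=> b z; apply: q_inv rj wj m2 b z.
- by have [-> ->] := q_r rj m2 E1 E2.
- move=> z Zz zn; have [<- <-] := q_quot rj wj m2 Zz zn; ring.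
Qed.

End Division.

(* Local argument of a nonvanishing invariant function: an arctangent after a
   rotation by the argument at [r]. *)
Lemma local_argument (Z : set C) (g1 g2 : C -> R) (r : C) :
  open Z -> invariant Z -> Z r -> smooth_on g1 Z -> smooth_on g2 Z ->
  (forall a z, Z z -> g1 (cmul (cexp a) z) = g1 z /\ g2 (cmul (cexp a) z) = g2 z) ->
  g1 r != 0 \/ g2 r != 0 ->
  exists (psi : C -> R) (Z' : set C),
  [/\ [/\ open Z', invariant Z', Z' r & Z' `<=` Z], smooth_on psi Z',
      (forall a z, Z' z -> psi (cmul (cexp a) z) = psi z)
    & forall z, Z' z -> (g1 z != 0 \/ g2 z != 0) /\ g1 z * sin (psi z) = g2 z * cos (psi z)].
Proof.
move=> oZ iZ Zr s1 s2 ginv gr.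
pose N := Num.sqrt (g1 r ^+ 2 + g2 r ^+ 2).
have N2 : N ^+ 2 = g1 r ^+ 2 + g2 r ^+ 2 by rewrite sqr_sqrtr // addr_ge0 ?sqr_ge0.
have N0 : 0 < N.
  rewrite sqrtr_gt0 lt_def addr_ge0 ?sqr_ge0 // andbT paddr_eq0 ?sqr_ge0 // !sqrf_eq0.
  by rewrite negb_and; apply/orP; case: gr; [left|right].
have [|t [ct st]] := @cos_sin_surj R (g1 r / N) (g2 r / N).
  by rewrite !expr_div_n -mulrDl -N2 divff // expf_neq0 // gt_eqF.
pose p z := cos t * g1 z + sin t * g2 z.
pose q z := cos t * g2 z - sin t * g1 z.
have sp : smooth_on p Z by apply: smoothD => //; apply: smoothM => //; exact: smooth_cst.
have sq : smooth_on q Z by apply: smoothB => //; apply: smoothM => //; exact: smooth_cst.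
pose Z' := Z `&` [set z | 0 < p z].
have oZ' : open Z'.
  refine (@open_setI_preimage _ _ p Z [set y | 0 < y] oZ _ (@open_gt R 0)) => z Zz.
  exact: (smooth_cont sp Zz).
have inv a z : Z z -> p (cmul (cexp a) z) = p z /\ q (cmul (cexp a) z) = q z.
  by move=> Zz; rewrite /p /q; have [-> ->] := ginv a z Zz.
have sub : Z' `<=` Z by move=> z [].
exists (fun z => t + atan (q z / p z)), Z'; split.
- split => //.
    by move=> a z [Zz pz]; split; [exact: iZ|rewrite /= (inv a z Zz).1].
  split => //; rewrite /= /p ct st.
  have -> : g1 r / N * g1 r + g2 r / N * g2 r = (g1 r ^+ 2 + g2 r ^+ 2) / N by ring.
  by rewrite divr_gt0 // -N2 exprn_gt0.
- apply: smoothD => //; first exact: smooth_cst.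
  apply: smooth_atan => //; apply: smoothM => //; first exact: smooth_sub sq.
  apply: smooth_inv => //; last exact: smooth_sub sp.
  by move=> z [_ pz]; rewrite gt_eqF.
- by move=> a z [Zz _]; have [-> ->] := inv a z Zz.
move=> z [Zz /= pz]; have pn0 : p z != 0 by rewrite gt_eqF.
have cs := cos2Dsin2 t.
have g1E : g1 z = cos t * p z - sin t * q z by rewrite /p /q -[LHS]mul1r -cs; ring.
have g2E : g2 z = sin t * p z + cos t * q z by rewrite /p /q -[LHS]mul1r -cs; ring.
split.
  apply: contrapT => /not_orP[/negP/negPn/eqP h1 /negP/negPn/eqP h2].
  by move: pz; rewrite /p h1 h2 !mulr0 addr0 ltxx.
rewrite cosD sinD; set th := atan _.
have cth : cos th != 0 by rewrite gt_eqF // cos_gt0_pihalf // atan_gtNpi2 atan_ltpi2.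
have sth : sin th * p z = cos th * q z.
  apply: (mulIf (x := (cos th)^-1)); first by rewrite invr_neq0.
  have -> : cos th * q z / cos th = q z by field.
  have -> : sin th * p z / cos th = tan th * p z by rewrite /tan; ring.
  by rewrite atanK divfK.
rewrite {}g1E {}g2E; apply: subr0_eq.
transitivity ((cos t ^+ 2 + sin t ^+ 2) * (sin th * p z - cos th * q z)); first by ring.
by rewrite sth subrr mulr0.
Qed.

Lemma phase (Z : set C) (u v : C -> R) (l : 'I_n -> R) (r : C) :
  open Z -> invariant Z -> smooth_on u Z -> smooth_on v Z ->
  equivariant l u v Z -> Z r -> nneg r ->
  (u r != 0 \/ v r != 0) \/
  ((exists w, 'D_w u r != 0 \/ 'D_w v r != 0) /\
   exists2 a, weight l a != 0 & forall k, a 0 k * r.1 0 k = 0) ->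
  exists (psi : C -> R) (Z' : set C),
  [/\ [/\ open Z', invariant Z', Z' r & Z' `<=` Z], smooth_on psi Z',
      (forall a z, Z' z -> psi (cmul (cexp a) z) = psi z)
    & forall z, Z' z -> nneg z -> u z * sin (psi z) = v z * cos (psi z)].
Proof.
move=> oZ iZ su sv eq Zr r0 H.
have [e e0 [eZ er]] := good_radius oZ iZ Zr r0.
have [g1 [g2 [s1 s2 ginv gr gq]]] := division oZ su sv eq Zr r0 e0 eZ er H.
have Z1i : invariant [set z : C | forall k, `|mod2 z k - mod2 r k| < e].
  by move=> a z; exact: Z1_rot.
have [psi [Z' [[oZ' iZ' Z'r sub] sp pinv pq]]] :=
  local_argument (open_Z1 (r := r) (e := e)) Z1i (Z1_r r e0) s1 s2 ginv gr.
exists psi, Z'; split => //; first by split => // z /sub/eZ.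
move=> z Z'z zn; have [gz pz] := pq z Z'z; have uv := gq z (sub z Z'z) zn.
case: gz => h; apply: (mulIf h).
  transitivity (u z * (g1 z * sin (psi z))); first by ring.
  rewrite pz; transitivity (u z * g2 z * cos (psi z)); first by ring.
  by rewrite uv; ring.
transitivity (u z * g2 z * sin (psi z)); first by ring.
rewrite uv; transitivity (v z * (g1 z * sin (psi z))); first by ring.
by rewrite pz; ring.
Qed.

End Phase.

(** * Endomorphisms of the torus *)

Section TorusEndomorphisms.
Context {R : realType} {n : nat}.
Local Notation C := (@Cn R n).
Implicit Types (z w : C) (a b : 'rV[R]_n).

(** The group law carries the derivatives at 0 to every point: [x' = - w y] and [y' = w x]. Hence
    [(x + i y) exp (- i w t)] has derivative zero and stays equal to 1. *)
Lemma one_parameter_group (x y : R -> R) :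
  (forall s t, x (s + t) = x s * x t - y s * y t) ->
  (forall s t, y (s + t) = x s * y t + y s * x t) ->
  (forall t, x t ^+ 2 + y t ^+ 2 = 1) ->
  derivable x (0 : R) 1 -> derivable y (0 : R) 1 ->
  x 1 = cos ('D_1 y 0) /\ y 1 = sin ('D_1 y 0).
Proof.
move=> xD yD xy1 dx dy; set w := 'D_1 y 0; pose al := 'D_1 x 0.
have x0y0 : x 0 = 1 /\ y 0 = 0.
  have := xD 0 0; have := yD 0 0; have := xy1 0; rewrite addr0.
  move: (x 0) (y 0) => p q H1 H2 H3.
  have : q * (2 * p - 1) = 0 by nra.
  by move/eqP; rewrite mulf_eq0 => /orP[/eqP q0|/eqP pq]; [split; nra|nra].
have [x0 y0] := x0y0.
have ix : is_derive (0 : R) 1 x al by apply: DeriveDef.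
have iy : is_derive (0 : R) 1 y w by apply: DeriveDef.
(* The curve lies on the unit circle, so its velocity at 1 is vertical. *)
have al0 : al = 0.
  have H := is_deriveD (is_deriveM ix ix) (is_deriveM iy iy).
  have E : x * x + y * y = cst 1.
    by apply/funext => t; rewrite -[LHS]/(x t * x t + y t * y t) -!expr2 xy1.
  rewrite E in H; have [_] := H; rewrite derive_cst x0 y0 !scale0r !scale1r; lra.
have shift_derive (f g : R -> R) (t d : R) :
    (forall h, f (t + h) = g h) -> is_derive (0 : R) 1 g d -> is_derive t 1 f d.
  move=> fg dg; have fE : f = (fun s => g (s - t)).
    by apply/funext => s; rewrite -fg addrC subrK.
  rewrite fE.
  have dsub : is_derive t 1 (fun s : R => s - t) 1.
    have := is_deriveB (is_derive_id t (1 : R)) (is_derive_cst t t (1 : R)).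
    by rewrite subr0.
  have dg' : is_derive (t - t) 1 g d by rewrite subrr.
  by have := @is_derive1_comp _ g (fun s => s - t) t _ _ dg' dsub; rewrite mulr1.
have dX (t : R) : is_derive t 1 x (- (w * y t)).
  apply: (shift_derive _ (fun h => x t * x h - y t * y h)) => //.
  have := is_deriveB (is_deriveM (is_derive_cst (x t) (0 : R) (1 : R)) ix)
     (is_deriveM (is_derive_cst (y t) (0 : R) (1 : R)) iy).
  move=> H; apply: is_derive_eq; rewrite al0 /cst /GRing.scale /=; ring.
have dY (t : R) : is_derive t 1 y (w * x t).
  apply: (shift_derive _ (fun h => x t * y h + y t * x h)) => //.
  have := is_deriveD (is_deriveM (is_derive_cst (x t) (0 : R) (1 : R)) iy)
     (is_deriveM (is_derive_cst (y t) (0 : R) (1 : R)) ix).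
  move=> H; apply: is_derive_eq; rewrite al0 /cst /GRing.scale /=; ring.
have dw (t : R) : is_derive t 1 (fun t : R => w * t) w.
  have := is_deriveM (is_derive_cst w t (1 : R)) (is_derive_id t (1 : R)).
  by rewrite scaler0 addr0 [_ *: 1]mulr1.
have dc (t : R) : is_derive t 1 (fun t => cos (w * t)) (- sin (w * t) * w).
  exact: (@is_derive1_comp _ cos (fun t => w * t) t _ _ (is_derive_cos _) (dw t)).
have ds (t : R) : is_derive t 1 (fun t => sin (w * t)) (cos (w * t) * w).
  exact: (@is_derive1_comp _ sin (fun t => w * t) t _ _ (is_derive_sin _) (dw t)).
have P t : x t * cos (w * t) + y t * sin (w * t) = 1.
  have H : forall t : R, is_derive t 1 (fun t => x t * cos (w * t) + y t * sin (w * t)) 0.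
    move=> s; have := is_deriveD (is_deriveM (dX s) (dc s)) (is_deriveM (dY s) (ds s)).
    move=> H; apply: is_derive_eq; rewrite /GRing.scale /=; ring.
  by rewrite (is_derive_0_is_cst t 0 H) mulr0 cos0 sin0 x0 y0; ring.
have Q t : y t * cos (w * t) - x t * sin (w * t) = 0.
  have H : forall t : R, is_derive t 1 (fun t => y t * cos (w * t) - x t * sin (w * t)) 0.
    move=> s; have := is_deriveB (is_deriveM (dY s) (dc s)) (is_deriveM (dX s) (ds s)).
    move=> H; apply: is_derive_eq; rewrite /GRing.scale /=; ring.
  by rewrite (is_derive_0_is_cst t 0 H) mulr0 cos0 sin0 x0 y0; ring.
have := P 1; have := Q 1; have := cos2Dsin2 w; rewrite mulr1.
move: (x 1) (y 1) (cos w) (sin w) => p q c s cs H1 H2; split.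
  transitivity (p * (c ^+ 2 + s ^+ 2)); first by rewrite cs mulr1.
  transitivity (c * (p * c + q * s) - s * (q * c - p * s)); first by ring.
  by rewrite H1 H2; ring.
transitivity (q * (c ^+ 2 + s ^+ 2)); first by rewrite cs mulr1.
transitivity (s * (p * c + q * s) + c * (q * c - p * s)); first by ring.
by rewrite H1 H2; ring.
Qed.

(** [A] is the differential at the unit; along each line [t a] the components of [rho] are
    one-parameter groups of the circle. *)
Lemma torus_endo_mx (rho : C -> C) : torus_endo rho ->
  exists A : 'M[R]_n, forall a, rho (cexp a) = cexp (a *m A).
Proof.
move=> [rt rM sr]; pose phi a := rho (cexp a).
have oT := @openT 'rV[R]_n.
have s2 k : smooth_on (fun a => (phi a).2 0 k) setT by exact: smooth_im.
have s1 k : smooth_on (fun a => (phi a).1 0 k) setT by exact: smooth_re.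
pose A := \matrix_(j < n, k < n) 'D_(delta_mx 0 j) (fun a => (phi a).2 0 k) 0.
exists A => a; rewrite -/(phi a).
have phiD t s : phi ((t + s) *: a) = cmul (phi (t *: a)) (phi (s *: a)).
  by rewrite /phi scalerDl cexpD rM //; exact: torus_cexp.
have key k : (phi a).1 0 k = cos ((a *m A) 0 k) /\ (phi a).2 0 k = sin ((a *m A) 0 k).
  have d0 (f : 'rV[R]_n -> R) : smooth_on f setT ->
      is_derive (0 : R) 1 (fun t : R => f (t *: a)) ('D_a f 0).
    move=> sf; have df : differentiable f (0 + (0 : R) *: a) by exact: smooth_diff sf I.
    have := is_derive_line df; rewrite scale0r addr0.
    by under eq_fun do rewrite add0r.
  have [|||||H1 H2] := @one_parameter_group (fun t => (phi (t *: a)).1 0 k)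
    (fun t => (phi (t *: a)).2 0 k).
  - by move=> t s; rewrite phiD cmul1.
  - by move=> t s; rewrite phiD cmul2.
  - by move=> t; apply: rt; exact: torus_cexp.
  - by have [] := d0 _ (s1 k).
  - by have [] := d0 _ (s2 k).
  have E : 'D_1 (fun t : R => (phi (t *: a)).2 0 k) 0 = (a *m A) 0 k.
    have [_ ->] := d0 _ (s2 k); rewrite mxE deriveE; last exact: smooth_diff (s2 k) I.
    rewrite [X in 'd _ _ X]row_sum_delta linear_sum; apply: eq_bigr => j _.
    by rewrite linearZ mxE -deriveE //; exact: smooth_diff (s2 k) I.
  by rewrite scale1r E in H1 H2; split.
by apply: Cn_eq => k; rewrite ?cexp1 ?cexp2; have [] := key k.
Qed.

(** Differentiating the sines at 0 recovers the entries. It makes the matrices of an automorphism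
    and of its inverse mutually inverse. *)
Lemma cexp_mulmx_inj (A B : 'M[R]_n) :
  (forall a, cexp (a *m A) = cexp (a *m B)) -> A = B.
Proof.
move=> H; apply/row_matrixP => i; apply/rowP => k; rewrite !rowE.
have ds (X : 'M[R]_n) : is_derive (0 : R) 1
    (fun t : R => sin (t * (delta_mx 0 i *m X : 'rV_n) 0 k)) ((delta_mx 0 i *m X : 'rV_n) 0 k).
  set w := (_ *m X) 0 k.
  have dl : is_derive (0 : R) 1 (fun t : R => t * w) w.
    have := is_deriveM (is_derive_id (0 : R) 1) (is_derive_cst w (0 : R) 1).
    by rewrite scaler0 add0r [_ *: _]mulr1.
  have := @is_derive1_comp _ sin (fun t : R => t * w) 0 _ _ (is_derive_sin _) dl.
  by rewrite mul0r cos0 mul1r.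
have [_ dA] := ds A; have [_ dB] := ds B.
rewrite -dA -dB; apply: near_eq_derive; near=> t.
have := congr1 (fun z : C => z.2 0 k) (H (t *: delta_mx 0 i)).
by rewrite !cexp2 -!scalemxAl !mxE.
Unshelve. all: by end_near. Qed.

Lemma torus_auto_mx (rho : C -> C) : torus_auto rho ->
  exists A : 'M[R]_n, [/\ forall a, rho (cexp a) = cexp (a *m A), A \in unitmx
    & forall a, cexp (a *m A) = cone n -> cexp a = cone n].
Proof.
move=> [er [sigma es H]]; have [A rA] := torus_endo_mx er; have [B sB] := torus_endo_mx es.
have K a : cexp (a *m A *m B) = cexp a.
  by rewrite -sB -rA; have [] := H (cexp a) (torus_cexp a).
have AB : A *m B = 1%:M.
  by apply: cexp_mulmx_inj => a; rewrite mulmx1 mulmxA K.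
exists A; split => //; first by have [] := mulmx1_unit AB.
by move=> a aA; rewrite -K -sB aA -cexp0 sB mul0mx.
Qed.

End TorusEndomorphisms.

(** * Charts and torus actions *)

Section ChartTheory.
Context {R : realType} {M : topologicalType} {E : normedModType R}.
Variable c : chart M E.
Hypothesis cc : is_chart c.
Implicit Types W : set M.

Lemma chart_open_dom : open (dom c). Proof. by case: cc. Qed.

Lemma chart_fwd_cont x : dom c x -> {for x, continuous (fwd c)}.
Proof. by case: cc => _ _ H _ _; exact: H. Qed.

Lemma chart_bwdK x : dom c x -> bwd c (fwd c x) = x.
Proof. by case: cc => _ _ _ _; exact. Qed.

Lemma chart_imageE W :
  fwd c @` (dom c `&` W) = (fwd c @` dom c) `&` bwd c @^-1` W.
Proof.
apply/seteqP; split=> u.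
  by move=> [x [dx Wx] <-]; split; [exists x|rewrite /= chart_bwdK].
by move=> [[x dx <-]]; rewrite /= chart_bwdK // => Wx; exists x.
Qed.

Lemma chart_open_image W : open W -> open (fwd c @` (dom c `&` W)).
Proof.
move=> oW; rewrite chart_imageE; apply: open_setI_preimage => //; by case: cc.
Qed.

Lemma chart_bwd_cont W u : (fwd c @` (dom c `&` W)) u -> {for u, continuous (bwd c)}.
Proof. by move=> [x [dx _] <-]; case: cc => _ _ _ H _; apply: H; exists x. Qed.

Lemma chart_bwd_in W u : (fwd c @` (dom c `&` W)) u -> dom c (bwd c u) /\ W (bwd c u).
Proof. by move=> [x [dx Wx] <-]; rewrite chart_bwdK. Qed.

Lemma chart_fwdK W u : (fwd c @` (dom c `&` W)) u -> fwd c (bwd c u) = u.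
Proof. by move=> [x [dx Wx] <-]; rewrite chart_bwdK. Qed.

End ChartTheory.

Section SmoothFunctions.
Context {R : realType} {m : nat} {M : manifold R m}.
Implicit Types (W : set M) (V X : normedModType R).

Definition sm V (u : M -> V) W :=
  forall c, atlas c -> smooth_on (u \o bwd c) (fwd c @` (dom c `&` W)).

Lemma sm_sub V (u : M -> V) W W' : W' `<=` W -> sm u W -> sm u W'.
Proof.
move=> sub su c ac; apply: smooth_sub (su c ac).
by move=> _ [x [dx Wx] <-]; exists x => //; split => //; exact: sub.
Qed.

Lemma sm_loc V (u : M -> V) W :
  (forall x, W x -> exists2 W', W' x & sm u W') -> sm u W.
Proof.
move=> H c ac; apply: smooth_loc => _ [x [dx Wx] <-]; have [W' W'x su] := H x Wx.
by exists (fwd c @` (dom c `&` W')); [exists x|exact: su].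
Qed.

Lemma sm_eq V (u v : M -> V) W : open W -> (forall x, W x -> u x = v x) ->
  sm u W -> sm v W.
Proof.
move=> oW uv su c ac; have cc := atlas_chart ac.
apply: smooth_eq (su c ac); first exact: chart_open_image.
by move=> z /(chart_bwd_in cc)[_]; exact: uv.
Qed.

Lemma sm_comp V X (G : V -> X) (u : M -> V) W (Z : set V) :
  fdim V -> fdim X -> open W -> open Z -> (forall x, W x -> Z (u x)) ->
  sm u W -> smooth_on G Z -> sm (fun x => G (u x)) W.
Proof.
move=> fV fX oW oZ WZ su sG c ac; have cc := atlas_chart ac.
apply: (@smooth_comp _ _ _ _ G (u \o bwd c) _ Z) => //.
- exact: chart_open_image.
- by move=> z /(chart_bwd_in cc)[_]; exact: WZ.
exact: su.
Qed.

Lemma sm_cont V (u : M -> V) W x : open W -> sm u W -> W x -> {for x, continuous u}.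
Proof.
move=> oW su Wx; have [c ac dx] := atlas_cover x; have cc := atlas_chart ac.
have cu : {for x, continuous ((u \o bwd c) \o fwd c)}.
  apply: continuous_comp; first exact: chart_fwd_cont.
  by apply: smooth_cont (su c ac) _; exists x.
have E : \forall y \near x, ((u \o bwd c) \o fwd c) y = u y.
  have : nbhs x (dom c) by apply: open_nbhs_nbhs; split => //; exact: chart_open_dom.
  by apply: filterS => y dy /=; rewrite (chart_bwdK cc).
have ux := nbhs_singleton E.
apply: cvg_trans; first exact: near_eq_cvg E.
by rewrite -ux; exact: cu.
Qed.

Definition compat (F : normedModType R) (f : chart M F) :=
  is_chart f /\ forall c, atlas c -> compatible c f.

Section Compat.
Variables (F : normedModType R) (f : chart M F).
Hypotheses (fF : fdim F) (cf : compat f).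

Lemma compat_sm : sm (fwd f) (dom f).
Proof. by move=> c ac; have [_ /(_ c ac)[]] := cf. Qed.

(** The chart [f] need not belong to the atlas and may take values in another space; near each point
    [u \o bwd f] factors through a chart [c] of the atlas. *)
Lemma compat_pull V (u : M -> V) W : fdim V -> open W -> sm u W ->
  smooth_on (u \o bwd f) (fwd f @` (dom f `&` W)).
Proof.
move=> fV oW su; have [icf H] := cf.
apply: smooth_loc => _ [x [dx Wx] <-].
have [c ac dcx] := atlas_cover x; have cc := atlas_chart ac.
pose A := fwd f @` (dom f `&` (dom c `&` W)).
have oA : open A by apply: chart_open_image => //; apply: openI => //; exact: chart_open_dom.
exists A; first by exists x.
have Ain z : A z -> [/\ dom f (bwd f z), dom c (bwd f z), W (bwd f z) & fwd f (bwd f z) = z].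
  by move=> Az; have [? [? ?]] := chart_bwd_in icf Az; split => //; exact: (chart_fwdK icf) Az.
apply: (@smooth_eq _ _ _ (fun z => (u \o bwd c) ((fwd c \o bwd f) z))) => //.
  by move=> z /Ain[_ dz _ _] /=; rewrite (chart_bwdK cc).
apply: (@smooth_comp _ _ _ _ (u \o bwd c) (fwd c \o bwd f) A (fwd c @` (dom c `&` W))) => //.
- exact: fdim_rV.
- exact: chart_open_image.
- by move=> z /Ain[_ dz Wz _]; exists (bwd f z).
- have [_ s2] := H c ac; apply: smooth_sub s2.
  by move=> z /Ain[h1 h2 _ <-]; exists (bwd f z).
exact: su.
Qed.

Lemma compat_push V (G : F -> V) (Z : set F) : fdim V -> open Z -> smooth_on G Z ->
  sm (fun x => G (fwd f x)) (dom f `&` fwd f @^-1` Z).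
Proof.
move=> fV oZ sG; apply: (@sm_comp _ _ G (fwd f) _ Z) => //.
- apply: open_setI_preimage => //; first exact: (chart_open_dom cf.1).
  by move=> x; exact: (chart_fwd_cont cf.1).
- by move=> x [].
by apply: sm_sub compat_sm => x [].
Qed.

End Compat.

End SmoothFunctions.

Section Action.
Context {R : realType} {m n : nat} {M : manifold R m}.
Variable act : @Cn R n -> M -> M.
Hypothesis hact : smooth_torus_action act.
Local Notation C := (@Cn R n).
Implicit Types (W : set M) (V : normedModType R) (a b : 'rV[R]_n).

(** The action lifted to the covering R^n, where group elements can be scaled, cut off, and made to
    depend smoothly on the point. *)
Definition tact a (y : M) : M := act (cexp a) y.

Lemma tact0 y : tact 0 y = y.
Proof. by rewrite /tact cexp0; case: hact. Qed.

Lemma tactD a b y : tact (a + b) y = tact a (tact b y).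
Proof. by rewrite /tact cexpD; case: hact => _ H _ _; apply: H; exact: torus_cexp. Qed.

Lemma tactC a b y : tact a (tact b y) = tact b (tact a y).
Proof. by rewrite -!tactD addrC. Qed.

Lemma tactNK a y : tact (- a) (tact a y) = y.
Proof. by rewrite -tactD addNr tact0. Qed.

Lemma tactKN a y : tact a (tact (- a) y) = y.
Proof. by rewrite -tactD subrr tact0. Qed.

Lemma same_orbitP x y : same_orbit act x y <-> exists a, y = tact a x.
Proof.
split; last by move=> [a ->]; exists (cexp a) => //; exact: torus_cexp.
by move=> [t /torusP[a ->] ->]; exists a.
Qed.

Definition saturated W := forall a y, W y -> W (tact a y).

Lemma saturatedE W a y : saturated W -> W (tact a y) <-> W y.
Proof. by move=> sW; split; [move=> /(sW (- a)); rewrite tactNK|exact: sW]. Qed.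

Lemma saturatedI W W' : saturated W -> saturated W' -> saturated (W `&` W').
Proof. by move=> s1 s2 a y [h1 h2]; split; [exact: s1|exact: s2]. Qed.

Lemma saturatedU W W' : saturated W -> saturated W' -> saturated (W `|` W').
Proof. by move=> s1 s2 a y [h|h]; [left; exact: s1|right; exact: s2]. Qed.

Lemma tact_cont (eta : M -> 'rV[R]_n) y : {for y, continuous eta} ->
  {for y, continuous (fun y => tact (eta y) y)}.
Proof.
move=> ce; have [_ _ H _] := hact.
apply: (@continuous_comp _ _ _ (fun y => (eta y, y)) (fun p : 'rV[R]_n * M => act (cexp p.1) p.2)).
  by apply: continuous_pair => //; exact: cvg_id.
exact: H.
Qed.

Lemma tact_cont1 a : continuous (tact a).
Proof. by move=> y; apply: (@tact_cont (fun=> a)); exact: cst_continuous. Qed.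

Definition act_domain (c d : chart M 'rV[R]_m) : set ('rV[R]_n * 'rV[R]_m) :=
  [set p | (fwd c @` dom c) p.2 /\ dom d (act (cexp p.1) (bwd c p.2))].

Lemma open_act_domain c d : atlas c -> atlas d -> open (act_domain c d).
Proof.
move=> ac ad; have cc := atlas_chart ac.
apply: (@open_setI_preimage _ _ (fun p : 'rV[R]_n * 'rV[R]_m => act (cexp p.1) (bwd c p.2))
   (snd @^-1` (fwd c @` dom c))).
- apply: open_comp; first by move=> p _; exact: cvg_snd.
  by case: cc.
- move=> p p2; have [_ _ H _] := hact.
  apply: (@continuous_comp _ _ _ (fun p => (p.1, bwd c p.2)) (fun p : 'rV[R]_n * M => act (cexp p.1) p.2)); last exact: H.
  apply: continuous_pair; first exact: cvg_fst.
  apply: (@continuous_comp _ _ _ snd (bwd c)); first exact: cvg_snd.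
  by case: cc => _ _ _ H' _; exact: H'.
- exact: chart_open_dom (atlas_chart ad).
Qed.

(** The action is smooth from chart to chart, jointly in both arguments; near each point it is
    composed with [y |-> (eta y, y)], using a chart [d] at the image point. *)
Lemma sm_tact V (u : M -> V) (eta : M -> 'rV[R]_n) W W' : fdim V ->
  open W -> open W' -> sm eta W -> sm u W' ->
  sm (fun y => u (tact (eta y) y)) (W `&` [set y | W' (tact (eta y) y)]).
Proof.
move=> fV oW oW' se su; apply: sm_loc => x [Wx W'x].
have [d ad ddx] := atlas_cover (tact (eta x) x).
have cd := atlas_chart ad.
pose W1 := W `&` [set y | (dom d `&` W') (tact (eta y) y)].
have oW1 : open W1.
  apply: (@open_setI_preimage _ _ (fun y => tact (eta y) y)) => //.
    by move=> y Wy; apply: tact_cont; exact: sm_cont se Wy.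
  by apply: openI => //; exact: chart_open_dom.
exists W1; first by [].
move=> c ac; have cc := atlas_chart ac.
have [_ _ _ /(_ c d ac ad) sa] := hact.
pose A := fwd c @` (dom c `&` W1); have oA : open A by exact: chart_open_image.
pose B := act_domain c d.
have oB : open B by exact: open_act_domain.
have Ain z : A z -> [/\ dom c (bwd c z), W (bwd c z), dom d (tact (eta (bwd c z)) (bwd c z)),
    W' (tact (eta (bwd c z)) (bwd c z)) & fwd c (bwd c z) = z].
  move=> Az; have [? [? [? ?]]] := chart_bwd_in cc Az; split => //.
  exact: (chart_fwdK cc) Az.
apply: (@smooth_eq _ _ _ (fun z => (u \o bwd d) (fwd d (tact (eta (bwd c z)) (bwd c z))))) => //.
  by move=> z /Ain[_ _ h _ _] /=; rewrite (chart_bwdK cd).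
apply: (@smooth_comp _ _ _ _ (u \o bwd d) (fun z => fwd d (tact (eta (bwd c z)) (bwd c z))) A
  (fwd d @` (dom d `&` W'))) => //.
- exact: fdim_rV.
- exact: chart_open_image.
- by move=> z /Ain[_ _ h1 h2 _]; exists (tact (eta (bwd c z)) (bwd c z)).
- apply: (@smooth_comp _ _ _ _ (fun p : 'rV[R]_n * 'rV[R]_m => fwd d (act (cexp p.1) (bwd c p.2)))
    (fun z => (eta (bwd c z), z)) A B) => //.
  + exact: fdim_prod (fdim_rV _) (fdim_rV _).
  + exact: fdim_rV.
  + by move=> z /Ain[h1 h2 h3 h4 h5]; split => //=; exists (bwd c z).
  + apply: smooth_pair => //; last exact: smooth_id.
    by apply: smooth_sub (se c ac) => z /Ain[h1 h2 _ _ <-]; exists (bwd c z).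
- exact: su.
Qed.

(* [A] represents the automorphism of the torus, on its Lie algebra; the last
   clause says that the automorphism is injective. *)
Definition std (f : chart M C) (A : 'M[R]_n) :=
  [/\ compat f, saturated (dom f),
      forall a y, dom f y -> fwd f (tact a y) = cmul (cexp (a *m A)) (fwd f y),
      A \in unitmx
    & forall a, cexp (a *m A) = cone n -> cexp a = cone n].

Lemma std_exists x : locally_standard act -> exists f A, std f A /\ dom f x.
Proof.
move=> /(_ x)[f [rho [dx df au cf eqf]]]; have [A [rA Au Ai]] := torus_auto_mx au.
exists f, A; split => //; split => //.
- by move=> a y dy; apply: df => //; exact: torus_cexp.
- by move=> a y dy; rewrite -rA; apply: eqf => //; exact: torus_cexp.
Qed.

End Action.

(** * Standard charts and real structures *)

Section StandardCharts.
Context {R : realType} {m n : nat} {M : manifold R m}.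
Variable act : @Cn R n -> M -> M.
Hypothesis hact : smooth_torus_action act.
Local Notation C := (@Cn R n).
Local Notation tact := (tact act).
Local Notation saturated := (saturated act).
Local Notation std := (std act).
Implicit Types (W S : set M) (V X : normedModType R) (a b : 'rV[R]_n) (f : chart M C).

Lemma std_chart f A : std f A -> is_chart f. Proof. by case=> -[]. Qed.

Lemma std_inj f A x y : std f A -> dom f x -> dom f y -> fwd f x = fwd f y -> x = y.
Proof.
move=> /std_chart cf dx dy E.
by rewrite -(chart_bwdK cf dx) -(chart_bwdK cf dy) E.
Qed.

Lemma std_eq f A a x y : std f A -> dom f x -> dom f y ->
  cmul (cexp (a *m A)) (fwd f x) = fwd f y <-> tact a x = y.
Proof.
move=> sf dx dy; have [_ sd ef _ _] := sf; rewrite -ef //; split=> [|-> //].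
by apply: (std_inj sf) => //; exact: sd.
Qed.

Lemma std_nneg f A x : std f A -> dom f x -> exists a, nneg (fwd f (tact a x)).
Proof.
move=> [_ sd ef Au _] dx; have [b bn] := nneg_rot (fwd f x).
by exists (b *m invmx A); rewrite ef // mulmxKV.
Qed.

Lemma std_image_invariant f A W : std f A -> saturated W ->
  invariant (fwd f @` (dom f `&` W)).
Proof.
move=> [_ sd ef Au _] sW a _ [x [dx Wx] <-]; exists (tact (a *m invmx A) x).
  by split; [exact: sd|exact: sW].
by rewrite ef // mulmxKV.
Qed.

Lemma std_restrict f A W : std f A -> open W -> saturated W ->
  std (Chart (dom f `&` W) (fwd f) (bwd f)) A.
Proof.
move=> [[cf H] sd ef Au Ai] oW sW; split => //=.
- split=> [|c ac].
    split=> //=.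
    + by apply: openI => //; exact: (chart_open_dom cf).
    + exact: (chart_open_image cf).
    + by move=> x [dx _]; exact: (chart_fwd_cont cf).
    + by move=> u; exact: (chart_bwd_cont cf).
    + by move=> x [dx _]; exact: (chart_bwdK cf).
  have [h1 h2] := H c ac; split.
    by apply: smooth_sub h1 => _ [x [dx [dfx _]] <-]; exists x.
  by apply: smooth_sub h2 => _ [x [dx [dfx _]] <-]; exists x.
- exact: saturatedI.
- by move=> a y [dy _]; exact: ef.
Qed.

Definition inv_on X (eta : M -> X) W := forall a y, W y -> eta (tact a y) = eta y.

(** Invariance of [eta] makes the twist by [- eta] the inverse of the twist by [eta], and
    commutativity of the torus keeps the twisted chart equivariant for the same matrix [A]. *)
Lemma std_twist f A W (eta : M -> 'rV[R]_n) : std f A -> open W -> saturated W ->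
  sm eta W -> inv_on eta W ->
  std (Chart (dom f `&` W) (fun y => fwd f (tact (eta y) y))
        (fun z => tact (- eta (bwd f z)) (bwd f z))) A.
Proof.
move=> [[cf H] sd ef Au Ai] oW sW se ie.
have odf := chart_open_dom cf.
have K y : W y -> tact (- eta (tact (eta y) y)) (tact (eta y) y) = y.
  by move=> Wy; rewrite ie // tactNK.
have K' y : W y -> tact (eta (tact (- eta y) y)) (tact (- eta y) y) = y.
  by move=> Wy; rewrite ie // tactKN.
have ce y : W y -> {for y, continuous eta} by exact: sm_cont.
have cN y : W y -> {for y, continuous (fun y => - eta y)}.
  by move=> Wy; apply: continuousN; exact: ce.
have imE : (fun y => fwd f (tact (eta y) y)) @` (dom f `&` W) = fwd f @` (dom f `&` W).
  apply/seteqP; split=> _ [y [dy Wy] <-].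
    by exists (tact (eta y) y) => //; split; [exact: sd|exact: sW].
  exists (tact (- eta y) y); first by split; [exact: sd|exact: sW].
  by rewrite K'.
split => //=.
- split=> [|c ac].
    split=> /=.
    + exact: openI.
    + by rewrite imE; exact: (chart_open_image cf).
    + move=> x [dx Wx].
      apply: (@continuous_comp _ _ _ (fun y => tact (eta y) y) (fwd f)).
        exact: (tact_cont hact (ce _ Wx)).
      exact: (chart_fwd_cont cf (sd _ _ dx)).
    + move=> u uW'; have uW : (fwd f @` (dom f `&` W)) u by rewrite -imE.
      have [du Wu] := chart_bwd_in cf uW.
      apply: (@continuous_comp _ _ _ (bwd f) (fun y => tact (- eta y) y)).
        exact: (chart_bwd_cont cf uW).
      exact: (tact_cont hact (cN _ Wu)).
    + by move=> x [dx Wx]; rewrite (chart_bwdK cf) ?K //; exact: sd.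
  have cc := atlas_chart ac; split.
    have := @sm_tact _ _ _ _ _ hact C (fwd f) eta W (dom f) (fdimC n) oW odf se (compat_sm (conj cf H)) c ac.
    apply: smooth_sub => _ [x [dx [dfx Wx]] <-]; exists x => //; split => //.
    by split => //; exact: sd.
  have cmc : compat c by split=> // d ad; exact: atlas_compatible.
  have smN : sm (fun y => - eta y) W.
    apply: (@sm_comp _ _ _ _ _ (fun v => - v) eta W setT) => //; [exact: fdim_rV|exact: fdim_rV|exact: openT|].
    move=> k; apply: Ck_linear => //; first exact: openT.
      by move=> t x y; rewrite opprD scalerN.
    by move=> x; apply: continuousN; exact: cvg_id.
  have sc := @sm_tact _ _ _ _ _ hact _ (fwd c) _ W (dom c) (fdim_rV m) oW (chart_open_dom cc) smN (compat_sm cmc).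
  have oW2 : open (W `&` [set y | dom c (tact (- eta y) y)]).
    apply: (@open_setI_preimage _ _ (fun y => tact (- eta y) y)) => //.
      by move=> y Wy; exact: (tact_cont hact (cN _ Wy)).
    exact: (chart_open_dom cc).
  have := compat_pull (conj cf H) (fdim_rV m) oW2 sc.
  apply: smooth_sub => _ [x [dcx [dx Wx]] <-]; exists (tact (eta x) x) => //.
  split; first exact: sd.
  by split; [exact: sW|rewrite /= K].
- exact: saturatedI.
- by move=> a y [dy Wy]; rewrite ie // tactC // ef //; exact: sd.
Qed.

Definition real_chart f A S := std f A /\ forall y, dom f y -> S y <-> (fwd f y).2 = 0.

Definition real_str S W := forall x, W x -> exists f A, real_chart f A S /\ dom f x.

(** For real [z], both sides say that [sin b_k z_k = 0] for all [k], where [b = a *m A]. The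
    right-hand side mentions neither the chart nor [S], which allows two real structures to be
    compared on an orbit once a point of each is known. *)
Lemma real_orbit f A S x a : real_chart f A S -> dom f x -> S x ->
  S (tact a x) <-> tact (a + a) x = x.
Proof.
move=> [sf Sf] dx; have [_ sd ef _ _] := sf.
rewrite (Sf _ dx) (Sf _ (sd a x dx)) -(std_eq (a + a) sf dx dx) ef // => z2.
rewrite mulmxDl; set b := a *m A; set z := fwd f x in z2 *.
have z2k k : z.2 0 k = 0 by rewrite z2 mxE.
have sq k : cos (b 0 k) ^+ 2 = 1 - sin (b 0 k) ^+ 2 by rewrite -(cos2Dsin2 (b 0 k)) addrK.
split=> E.
  have bz k : sin (b 0 k) * z.1 0 k = 0.
    have : (cmul (cexp b) z).2 0 k = 0 by rewrite E mxE.
    by rewrite cmul2 cexp1 cexp2 z2k mulr0 add0r.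
  have bz' k : cos (b 0 k) ^+ 2 * z.1 0 k = z.1 0 k.
    by rewrite sq mulrBl mul1r expr2 -mulrA bz mulr0 subr0.
  rewrite cexpD -cmulA; apply: Cn_eq => k.
    rewrite !cmul1 cmul2 cexp1 cexp2 z2k !mulr0 add0r subr0.
    by rewrite bz mulr0 subr0 mulrA -expr2 bz'.
  rewrite !cmul2 cmul1 cexp1 cexp2 z2k !mulr0 add0r subr0.
  by rewrite bz mulr0 add0r mulrCA bz mulr0.
apply/rowP => k; rewrite cmul2 cexp1 cexp2 z2k [RHS]mxE mulr0 add0r.
have := congr1 (fun w : C => w.1 0 k) E; rewrite cexpD -cmulA !cmul1 cmul2 cexp1 cexp2 z2k !mulr0 subr0 add0r.
move=> H; have : sin (b 0 k) ^+ 2 * z.1 0 k = 0 by rewrite !mulrA -!expr2 sq in H; lra.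
by move/eqP; rewrite mulf_eq0 sqrf_eq0 -mulf_eq0 => /eqP.
Qed.

Lemma real_str_loc S S' W W' : real_str S W -> open W' -> saturated W' -> W' `<=` W ->
  (forall y, W' y -> S y <-> S' y) -> real_str S' W'.
Proof.
move=> rS oW' sW' sub SS' x W'x; have [f [A [[sf Sf] dx]]] := rS x (sub _ W'x).
exists (Chart (dom f `&` W') (fwd f) (bwd f)), A; split; last by split.
split; first exact: std_restrict.
by move=> y /= [dy W'y]; rewrite -SS' //; exact: Sf.
Qed.

Lemma real_str_twist S W (eta : M -> 'rV[R]_n) : real_str S W -> open W -> saturated W ->
  sm eta W -> inv_on eta W -> real_str [set y | S (tact (eta y) y)] W.
Proof.
move=> rS oW sW se ie x Wx; have [f [A [[sf Sf] dx]]] := rS x Wx.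
exists (Chart (dom f `&` W) (fun y => fwd f (tact (eta y) y))
  (fun z => tact (- eta (bwd f z)) (bwd f z))), A; split; last by split.
split; first exact: std_twist sf oW sW se ie.
by move=> y /= [dy Wy]; apply: Sf; case: sf => _ sd _ _ _; exact: sd.
Qed.

Lemma real_str_exists x : locally_standard act -> exists S W,
  [/\ open W, saturated W, W x & real_str S W].
Proof.
move=> ls; have [f [A [sf dx]]] := std_exists x ls; have [[cf _] sd _ _ _] := sf.
exists [set y | dom f y /\ (fwd f y).2 = 0], (dom f); split => //.
  exact: chart_open_dom.
move=> y dy; exists f, A; split => //; split => // z dz.
by split=> [[]|].
Qed.

Lemma real_str_meet S W x : real_str S W -> W x -> exists a, S (tact a x).
Proof.
move=> rS /rS[f [A [[sf Sf] dx]]]; have [_ sd _ _ _] := sf.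
have [a [a2 _]] := std_nneg sf dx.
by exists a; apply/Sf => //; exact: sd.
Qed.

Section Difference.
Variables (S1 S2 : set M) (f1 f2 : chart M C) (A1 A2 : 'M[R]_n) (x : M).
Hypotheses (r1 : real_chart f1 A1 S1) (r2 : real_chart f2 A2 S2)
  (d1 : dom f1 x) (d2 : dom f2 x) (nx : nneg (fwd f1 x)).

Let s1 : std f1 A1 := r1.1.
Let s2 : std f2 A2 := r2.1.
Let Z := fwd f1 @` (dom f1 `&` dom f2).
Let l k : 'I_n -> R := fun j => (invmx A1 *m A2) j k.
Let u k z : R := (fwd f2 (bwd f1 z)).1 0 k.
Let v k z : R := (fwd f2 (bwd f1 z)).2 0 k.
Let r := fwd f1 x.

Let oZ : open Z.
Proof. by apply: chart_open_image (std_chart s1) _ _; exact: (chart_open_dom (std_chart s2)). Qed.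

Let iZ : invariant Z.
Proof. by apply: std_image_invariant s1 _; case: s2. Qed.

Let Zr : Z r. Proof. by exists x. Qed.

Let sphi : smooth_on (fwd f2 \o bwd f1) Z.
Proof.
have [cf1 _ _ _ _] := s1; have [cf2 _ _ _ _] := s2.
exact: (compat_pull cf1 (fdimC n) (chart_open_dom cf2.1) (compat_sm cf2)).
Qed.

(** The transition map intertwines [A1] and [A2], so its component [k] has the column [k] of
    [invmx A1 *m A2] as weight. *)
Lemma difference_equivariant k : equivariant (l k) (u k) (v k) Z.
Proof.
move=> a _ [y [dy1 dy2] <-]; have [_ sd1 e1 Au1 _] := s1; have [_ sd2 e2 _ _] := s2.
pose b := a *m invmx A1.
have -> : cmul (cexp a) (fwd f1 y) = fwd f1 (tact b y) by rewrite e1 // mulmxKV.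
have -> : weight (l k) a = (b *m A2) 0 k by rewrite -mulmxA mxE.
rewrite /u /v !(chart_bwdK (std_chart s1)) //; last exact: sd1.
by rewrite e2 // cmul1 cmul2 cexp1 cexp2.
Qed.

(** The transition map is invertible, so no component has zero differential. If the component [k]
    vanishes at [r], rotating the coordinate [k] of the second chart fixes [x]; seen in the first
    chart, this direction has weight 1 and is zero on the nonzero coordinates of [r]. *)
Lemma difference_nondegenerate k : (u k r != 0 \/ v k r != 0) \/
  ((exists w, 'D_w (u k) r != 0 \/ 'D_w (v k) r != 0) /\
   exists2 a, weight (l k) a != 0 & forall j, a 0 j * r.1 0 j = 0).
Proof.
have [cf1 sd1 e1 Au1 _] := s1; have [cf2 sd2 e2 Au2 _] := s2.
have [uv|] := pselect (u k r != 0 \/ v k r != 0); first by left.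
move=> /not_orP[/negP/negPn/eqP ur /negP/negPn/eqP vr]; right.
rewrite /u /v /r (chart_bwdK cf1.1) // in ur vr.
split.
  pose q := fwd f2 x.
  have sq : smooth_on (fwd f1 \o bwd f2) (fwd f2 @` (dom f2 `&` dom f1)).
    exact: (compat_pull cf2 (fdimC n) (chart_open_dom cf1.1) (compat_sm cf1)).
  have oQ : open (fwd f2 @` (dom f2 `&` dom f1)).
    by apply: chart_open_image cf2.1 _ _; exact: (chart_open_dom cf1.1).
  have Qq : (fwd f2 @` (dom f2 `&` dom f1)) q by exists x.
  have dq := smooth_diff sq Qq.
  have dphi : differentiable (fwd f2 \o bwd f1) ((fwd f1 \o bwd f2) q).
    by rewrite /= (chart_bwdK cf2.1) //; exact: smooth_diff sphi Zr.
  have E : \forall z \near q, (fwd f2 \o bwd f1) ((fwd f1 \o bwd f2) z) = z.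
    have : nbhs q (fwd f2 @` (dom f2 `&` dom f1)) by exact: open_nbhs_nbhs.
    apply: filterS => _ [y [dy2 dy1] <-] /=.
    by rewrite (chart_bwdK cf2.1) // (chart_bwdK cf1.1).
  exists ('D_(axis k 1 0) (fwd f1 \o bwd f2) q); left.
  have := near_eq_derive (axis k 1 0) E; rewrite derive_id.
  rewrite (@derive_comp _ _ _ _ (fwd f2 \o bwd f1) (fwd f1 \o bwd f2) q _ dq dphi).
  have -> : (fwd f1 \o bwd f2) q = r by rewrite /= (chart_bwdK cf2.1).
  set w := 'D_ _ _ q => H.
  have := congr1 (fun z : C => z.1 0 k) H; rewrite derive_re ?axis1 ?eqxx; last exact: smooth_diff sphi Zr.
  by rewrite /u => ->; rewrite mulr1n oner_neq0.
pose b := delta_mx 0 k *m invmx A2 : 'rV[R]_n; exists (b *m A1).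
  have -> : weight (l k) (b *m A1) = (b *m A1 *m (invmx A1 *m A2)) 0 k by rewrite mxE.
  by rewrite -mulmxA mulKVmx // /b mulmxKV // mxE !eqxx oner_neq0.
have fixx t : tact (t *: b) x = x.
  apply/(std_eq _ s2 d2 d2); rewrite -scalemxAl mulmxKV //.
  apply: Cn_eq => j; rewrite ?cmul1 ?cmul2 cexp1 cexp2 !mxE eqxx /=;
    have [->|_] := eqVneq j k; rewrite ?ur ?vr ?mulr0 ?cos0 ?sin0; ring.
move=> j; have [-> |aj] := eqVneq ((b *m A1) 0 j) 0; first by rewrite mul0r.
(* The parameter at which the coordinate [j] of the first chart turns by pi; as it is fixed, that
   coordinate is zero. *)
have := fixx (pi / (b *m A1) 0 j) => /(std_eq _ s1 d1 d1).
move=> /(congr1 (fun z : C => z.1 0 j)); rewrite cmul1 cexp1 cexp2 -scalemxAl mxE divfK //.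
rewrite cospi sinpi -/r => H; have -> : r.1 0 j = 0 by lra.
by rewrite mulr0.
Qed.

Lemma difference_at : exists (W : set M) (eta : M -> 'rV[R]_n),
  [/\ [/\ open W, saturated W & W x], sm eta W, inv_on eta W
    & forall y, W y -> S2 y <-> S1 (tact (eta y) y)].
Proof.
have [cf1 sd1 e1 Au1 _] := s1; have [cf2 sd2 e2 Au2 _] := s2.
have su k : smooth_on (u k) Z by exact: smooth_re.
have sv k : smooth_on (v k) Z by exact: smooth_im.
have P k := phase oZ iZ (su k) (sv k) (difference_equivariant k) Zr nx (difference_nondegenerate k).
have /choice[psi /choice[Zk PP]] := P.
pose Z' := Z `&` [set z | forall k, Zk k z].
have oZ' : open Z' by apply: openI => //; apply: open_forall => k; have [[]] := PP k.
have iZ' : invariant Z'.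
  move=> a z [Zz Zkz]; split; first exact: iZ.
  by move=> k; have [[_ H _ _] _ _ _] := PP k; exact: H.
have sub k : Z' `<=` Zk k by move=> z [_]; apply.
(* On the orthant, turning the second chart by minus [psi] makes all components real; [invmx A2]
   converts this into a parameter of the given action. *)
pose G z : 'rV[R]_n := (\row_k psi k z) *m invmx A2.
have sG : smooth_on G Z'.
  apply: smooth_mx => // i j; under eq_fun do rewrite mxE.
  apply: smooth_sum => // k _; apply: smoothM => //; last exact: smooth_cst.
  under eq_fun do rewrite mxE; have [_ s _ _] := PP k; exact: smooth_sub s.
have GA z : G z *m A2 = \row_k psi k z by rewrite /G mulmxKV.
pose W := dom f1 `&` fwd f1 @^-1` Z'.
have Wd2 y : W y -> dom f2 y.
  by move=> [dy [[y' [dy' dy2] E] _]]; rewrite -(std_inj s1 dy' dy E).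
exists W, (fun y => G (fwd f1 y)).
have sW : saturated W.
  by move=> a y [dy Zy]; split; [exact: sd1|rewrite /= e1 //; exact: iZ'].
have iG a y : W y -> G (fwd f1 (tact a y)) = G (fwd f1 y).
  move=> [dy Zy]; rewrite e1 // /G; congr (_ *m _); apply/rowP => k; rewrite !mxE.
  by have [_ _ H _] := PP k; apply: H; exact: sub.
split => //.
- split => //.
    apply: open_setI_preimage => //; first exact: (chart_open_dom cf1.1).
    by move=> y; exact: (chart_fwd_cont cf1.1).
  split => //; split=> // k; by have [[_ _ H _] _ _ _] := PP k.
- exact: (compat_push (fdimC n) cf1 (fdim_rV n) oZ' sG).
(* The orbit of [y] contains [y0] in the orthant of the first chart, and [u0], which is real for
   [S2]. By [real_orbit] from these two base points, both memberships become the condition that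
   twice [h - a] fixes the base point, and [y0] and [u0] have the same stabilizer. *)
move=> y Wy; have [a an] := std_nneg s1 Wy.1; set y0 := tact a y in an.
have Wy0 : W y0 by exact: sW.
set h := G (fwd f1 y); have hE : G (fwd f1 y0) = h by exact: iG.
have S1y0 : S1 y0 by apply/(r1.2 _ Wy0.1); case: an.
pose u0 := tact (- h) y0.
have d2y0 := Wd2 _ Wy0; have d2u0 : dom f2 u0 by exact: sd2.
have S2u0 : S2 u0.
  apply/(r2.2 _ d2u0); rewrite e2 // mulNmx -hE GA; apply/rowP => k.
  rewrite cmul2 cexp1 cexp2 !mxE cosN sinN.
  have [_ _ _ H] := PP k; have := H _ (sub k _ Wy0.2) an.
  rewrite /u /v (chart_bwdK cf1.1) //; [lra|exact: Wy0.1].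
have yE : y = tact (h - a) u0 by rewrite /u0 -tactD // addrAC subrr add0r tactNK.
have hyE : tact h y = tact (h - a) y0 by rewrite /y0 -tactD // subrK.
rewrite hyE (real_orbit _ r1 Wy0.1 S1y0) {1}yE (real_orbit _ r2 d2u0 S2u0).
rewrite /u0 tactC //; split=> [E|-> //].
by rewrite -[LHS](tactKN hact h) E tactKN.
Qed.

End Difference.

Lemma difference S1 S2 W x : real_str S1 W -> real_str S2 W -> W x ->
  exists (W' : set M) (eta : M -> 'rV[R]_n),
  [/\ [/\ open W', saturated W' & W' x], sm eta W', inv_on eta W'
    & forall y, W' y -> S2 y <-> S1 (tact (eta y) y)].
Proof.
move=> rS1 rS2 Wx; have [f1 [A1 [r1 d1]]] := rS1 x Wx; have [f2 [A2 [r2 d2]]] := rS2 x Wx.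
have [a an] := std_nneg r1.1 d1.
have [_ sd1 _ _ _] := r1.1; have [_ sd2 _ _ _] := r2.1.
have [W' [eta [[oW sW Wa] h1 h2 h3]]] := difference_at r1 r2 (sd1 a x d1) (sd2 a x d2) an.
by exists W', eta; split => //; split => //; apply/(saturatedE hact a x sW).
Qed.

End StandardCharts.

Lemma compact_finite_cover (X : topologicalType) (K : set X) (U : X -> set X) :
  compact K -> (forall x, K x -> open (U x) /\ U x x) ->
  exists2 s : seq X, (forall x, x \in s -> K x)
    & forall y, K y -> exists2 x, x \in s & U x y.
Proof.
move=> /compact_near_coveringP cK HU.
pose good (s : seq X) := forall x, x \in s -> K x.
(* The filter of large lists: sets that contain all lists of points of [K] extending some given
   list. *)
pose F : set_system (seq X) := fun A => exists2 s0, good s0 &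
  forall s, good s -> (forall x, x \in s0 -> x \in s) -> A s.
have FF : Filter F.
  split; first by exists [::].
    move=> A B [s gs sA] [t gt tB]; exists (s ++ t).
      by move=> x; rewrite mem_cat => /orP[/gs|/gt].
    move=> r gr sub; split.
      by apply: sA => // x xs; apply: sub; rewrite mem_cat xs.
    by apply: tB => // x xs; apply: sub; rewrite mem_cat xs orbT.
  by move=> A B AB [s gs sA]; exists s => // t gt sub; apply: AB; exact: sA.
have [|s gs H] := cK _ F (fun s y => exists2 x, x \in s & U x y) FF.
  move=> x Kx; have [oU Ux] := HU x Kx.
  exists (U x, [set s : seq X | x \in s]) => /=; last by move=> [y s] /= [Uy xs]; exists x.
  split; first exact: open_nbhs_nbhs.
  exists [:: x]; first by move=> y; rewrite inE => /eqP ->.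
  by move=> s _; apply; rewrite inE.
by exists s => //; exact: H.
Qed.

(** * Invariant bump functions *)

Section Bumps.
Context {R : realType} {m n : nat} {M : manifold R m}.
Variable act : @Cn R n -> M -> M.
Hypotheses (hact : smooth_torus_action act) (cM : compact [set: M]).
Local Notation C := (@Cn R n).
Local Notation tact := (tact act).
Local Notation saturated := (saturated act).
Local Notation std := (std act).
Local Notation inv_on := (inv_on act).
Implicit Types (W S : set M) (V X : normedModType R) (a b : 'rV[R]_n) (f : chart M C).

(* [O] witnesses that the closure of the support is contained in [dom f]. *)
Definition bump f (phi : M -> R) (O : set M) :=
  [/\ [/\ sm phi setT, inv_on phi setT & forall y, 0 <= phi y],
      open O, (forall y, dom f y \/ O y) & forall y, O y -> phi y = 0].

Definition spread (r z : C) : R := \sum_k (mod2 z k - mod2 r k) ^+ 2.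

Lemma smooth_spread r (Z : set C) : open Z -> smooth_on (spread r) Z.
Proof.
move=> oZ; apply: smooth_sum => // k _.
have H : smooth_on (fun z : C => mod2 z k - mod2 r k) Z.
  by apply: smoothB => //; [apply: smooth_mod2 => //; exact: smooth_id|exact: smooth_cst].
exact: smoothM.
Qed.

Lemma spread_lt r z (e : R) : 0 < e -> spread r z < e ^+ 2 ->
  forall k, `|mod2 z k - mod2 r k| < e.
Proof.
move=> e0 ze k; rewrite -(@ltr_pXn2r _ 2) ?nnegrE ?normr_ge0 ?ltW //.
rewrite real_normK ?num_real //; apply: le_lt_trans ze.
by rewrite /spread (bigD1 k) //= lerDl sumr_ge0 // => i _; exact: sqr_ge0.
Qed.

Lemma compact_spread r (d : R) : compact [set z | spread r z <= d].
Proof.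
pose c := 1 + `|d| + \sum_k `|mod2 r k|.
have c1 : 1 <= c by rewrite /c -addrA lerDl addr_ge0 // sumr_ge0.
pose B := [set v : 'rV[R]_n | forall k, `[- c, c]%classic (v 0 k)].
have cB : compact B by exact: (@rV_compact R n (fun=> `[- c, c]%classic) (fun=> @segment_compact R (- c) c)).
apply: (subclosed_compact _ (compact_setX cB cB)).
  apply: (@preimage_closed _ _ (spread r) [set x | x <= d]); last exact: closed_le.
  by move=> z _; exact: (smooth_cont (smooth_spread r openT) I).
move=> z /= zd.
have H k : mod2 z k <= c.
  have h : (mod2 z k - mod2 r k) ^+ 2 <= d.
    apply: le_trans zd; rewrite /spread (bigD1 k) //= lerDl sumr_ge0 // => i _; exact: sqr_ge0.
  have h2 : `|mod2 r k| <= \sum_k `|mod2 r k| by rewrite (bigD1 k) //= lerDl sumr_ge0.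
  have h3 := ler_norm (mod2 r k); have h4 := ler_norm d; rewrite /c.
  have h5 : mod2 z k - mod2 r k <= 1 + (mod2 z k - mod2 r k) ^+ 2.
    by move: (mod2 z k - mod2 r k) => t; nra.
  lra.
(* Since [c >= 1], a number whose square is at most [c] is itself at most [c] in absolute value. *)
have K k (x y : R) : mod2 z k = x ^+ 2 + y ^+ 2 -> `[- c, c]%classic x.
  move=> E; have := H k; rewrite E => h; rewrite /= in_itv /=; nra.
split=> k /=; apply: (K k); first by [].
by rewrite /mod2 addrC.
Qed.

(** A function of the moduli is invariant. Its extension by zero is smooth because it vanishes
    outside the image of a compact set; this image is closed, M being Hausdorff, so [dom f] and the
    open complement [O] of the image cover M. *)
Lemma bump_exists f A x : std f A -> dom f x -> exists phi O,
  bump f phi O /\ 0 < phi x.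
Proof.
move=> sf dx; have [[cf H] sd ef Au Ai] := sf; set r := fwd f x.
pose Z := fwd f @` dom f.
have oZ : open Z by case: cf.
have iZ : invariant Z.
  have := std_image_invariant sf (W := setT) (fun _ _ _ => I).
  by rewrite setIT.
have [e e0 eZ] := invariant_moduli oZ iZ (imageP _ dx : Z r).
(* Strictly below [e^2], so that the closed set of points of spread at most [d] stays in the image
   of the chart. *)
pose d := e ^+ 2 / 2.
have e20 : 0 < e ^+ 2 by rewrite exprn_gt0.
have d0 : 0 < d by rewrite divr_gt0.
have KZ z : spread r z <= d -> Z z.
  by move=> zd; apply: eZ; apply: spread_lt => //; rewrite /d in zd; lra.
pose K := [set z | spread r z <= d].
have cK : compact (bwd f @` K).
  apply: continuous_compact; last exact: compact_spread.
  apply: continuous_in_subspaceT => z; rewrite inE => /KZ [y dy <-].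
  by case: cf => _ _ _ h _; apply: h; exists y.
pose O := ~` (bwd f @` K).
have oO : open O.
  by apply: closed_openC; apply: compact_closed => //; exact: manifold_hausdorff.
have dO y : dom f y \/ O y.
  have [dy|ndy] := pselect (dom f y); [by left|right].
  by move=> [z /KZ[y' dy' <-]]; rewrite (chart_bwdK cf) // => yE; apply: ndy; rewrite -yE.
pose phi y := if `[< dom f y >] then flat 0 (d - spread r (fwd f y)) else 0.
have phiE y : dom f y -> phi y = flat 0 (d - spread r (fwd f y)).
  by move=> dy; rewrite /phi ifT //; exact/asboolP.
have phi0 y : ~ dom f y -> phi y = 0.
  by move=> dy; rewrite /phi ifF //; exact/asboolPn.
have Ophi y : O y -> phi y = 0.
  move=> Oy; have [dy|/phi0 //] := pselect (dom f y); rewrite phiE // /flat ifF //.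
  apply/negbTE; rewrite subr_gt0 -leNgt; apply: ltW; rewrite ltNge; apply/negP => h.
  by apply: Oy; exists (fwd f y) => //; rewrite (chart_bwdK cf).
exists phi, O; split; last by rewrite phiE // flat_gt0 /spread big1 ?subr0 // => k _; rewrite subrr expr0n.
split => //; split.
- apply: sm_loc => y _; have [dy|Oy] := dO y.
    exists (dom f) => //.
    apply: (@sm_eq _ _ _ _ (fun y => flat 0 (d - spread r (fwd f y)))).
    + exact: chart_open_dom.
    + by move=> z dz; rewrite phiE.
    have sG : smooth_on (fun z : C => flat 0 (d - spread r z)) setT.
      apply: smooth_flat; first exact: openT.
      apply: smoothB; [exact: openT|exact: smooth_cst|].
      by apply: smooth_spread; exact: openT.
    have := compat_push (fdimC n) (conj cf H) (fdimR (R := R)) openT sG.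
    by rewrite preimage_setT setIT.
  exists O => //; apply: (@sm_eq _ _ _ _ (fun=> 0)) => //.
    by move=> z /Ophi.
  by move=> c ac; exact: smooth_cst.
- move=> a y _; have [dy|ndy] := pselect (dom f y).
    have dt : dom f (tact a y) by exact: sd.
    rewrite !phiE // ef // /spread; congr (flat 0 (_ - _)); apply: eq_bigr => k _.
    by rewrite mod2_rot.
  rewrite !phi0 // => /(sd (- a)); by rewrite tactNK.
- move=> y; rewrite /phi; case: ifP => // _; exact: flat_ge0.
Qed.

(** [P] restricts the charts: to domains inside a given open set for cut-offs, to charts in which a
    real subset is the real part for the metric. *)
Lemma finite_bumps (P : chart M C -> 'M[R]_n -> Prop) (K : set M) : compact K ->
  (forall x, K x -> exists f A, [/\ std f A, P f A & dom f x]) ->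
  exists (N : nat) (f : 'I_N -> chart M C) (A : 'I_N -> 'M[R]_n)
    (phi : 'I_N -> M -> R) (O : 'I_N -> set M),
  (forall i, [/\ std (f i) (A i), P (f i) (A i) & bump (f i) (phi i) (O i)]) /\
  forall x, K x -> exists i, 0 < phi i x.
Proof.
move=> cK H.
have H' : forall x, exists q : chart M C * 'M[R]_n * (M -> R) * set M, K x ->
    [/\ std q.1.1.1 q.1.1.2, P q.1.1.1 q.1.1.2, bump q.1.1.1 q.1.2 q.2 & 0 < q.1.2 x].
  move=> x; have [Kx|nK] := pselect (K x); last first.
    (* An arbitrary value outside [K], so that choice applies to all points of M. *)
    by exists ((Chart set0 (fun=> 0) (fun=> x) : chart M C), (0 : 'M[R]_n), (fun=> 0), set0) => /nK.
  have [f [A [sf Pf dx]]] := H x Kx; have [phi [Z [bf px]]] := bump_exists sf dx.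
  by exists (f, A, phi, Z).
have /choice[q qP] := H'.
have [|D DK cov] := @compact_finite_cover M K (fun x => [set y | 0 < (q x).1.2 y]) cK.
  move=> x Kx; have [_ _ [[s _ _] _ _ _] px] := qP x Kx; split => //.
  apply: (@open_comp _ _ (q x).1.2 [set t | 0 < t]); last exact: open_gt.
  by move=> y _; apply: (sm_cont openT s).
have [x0 _] := manifold_nonempty M.
pose pt (i : 'I_(size D)) := nth x0 D i.
have ptK i : K (pt i).
  by apply: DK; exact: mem_nth.
exists (size D), (fun i => (q (pt i)).1.1.1), (fun i => (q (pt i)).1.1.2),
  (fun i => (q (pt i)).1.2), (fun i => (q (pt i)).2); split.
  by move=> i; have [] := qP _ (ptK i).
move=> x /cov[y Dy yx]; have yD : (index y D < size D)%N by rewrite index_mem.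
by exists (Ordinal yD); rewrite /pt /= nth_index.
Qed.

(** Constant below 1/3 and above 2/3, so that it is 0 and 1 on neighbourhoods of 0 and 1 and not
    merely at these points. *)
Definition step (t : R) : R := flat 0 (t - 1 / 3) / (flat 0 (t - 1 / 3) + flat 0 (2 / 3 - t)).

Lemma step_den (t : R) : 0 < flat 0 (t - 1 / 3) + flat 0 (2 / 3 - t).
Proof.
have [h|h] := leP t (1 / 2).
  by apply: ltr_wpDl; rewrite ?flat_ge0 // flat_gt0; lra.
by apply: ltr_pwDl; rewrite ?flat_ge0 // flat_gt0; lra.
Qed.

Lemma smooth_step : smooth_on step setT.
Proof.
have oT := @openT R.
have s1 : smooth_on (fun t : R => flat 0 (t - 1 / 3)) setT.
  by apply: smooth_flat => //; apply: smoothB => //; [exact: smooth_id|exact: smooth_cst].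
have s2 : smooth_on (fun t : R => flat 0 (2 / 3 - t)) setT.
  by apply: smooth_flat => //; apply: smoothB => //; [exact: smooth_cst|exact: smooth_id].
apply: smoothM => //; apply: smooth_inv => //; last exact: smoothD.
by move=> t _; rewrite gt_eqF // step_den.
Qed.

Lemma step0 (t : R) : t < 1 / 3 -> step t = 0.
Proof.
by move=> h; rewrite /step {1}/flat ifF ?mul0r //; apply/negbTE; rewrite -leNgt; lra.
Qed.

Lemma step1 (t : R) : 2 / 3 < t -> step t = 1.
Proof.
move=> h; have := step_den t; rewrite /step; have -> : flat 0 (2 / 3 - t) = 0 :> R.
  by rewrite /flat ifF //; apply/negbTE; rewrite -leNgt; lra.
by rewrite addr0 => t0; rewrite divff // gt_eqF.
Qed.

(** A finite sum [S] of bumps supported in [W] vanishes off [W] and, by compactness, is at least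
    some [e > 0] on [K]. Then [step (S / e)] is 0 and 1 on open sets. *)
Lemma cutoff (K W : set M) : locally_standard act ->
  closed K -> open W -> saturated W -> K `<=` W ->
  exists (chi : M -> R) (O W' : set M),
  [/\ [/\ sm chi setT, inv_on chi setT, open O, forall y, W y \/ O y & forall y, O y -> chi y = 0],
      [/\ open W', saturated W' & K `<=` W'] & forall y, W' y -> chi y = 1].
Proof.
move=> ls clK oW sW KW.
have cK : compact K by apply: (subclosed_compact clK cM).
have := @finite_bumps (fun f _ => dom f `<=` W) K cK; case.
  move=> x Kx; have [f [A [sf dx]]] := std_exists x ls.
  exists (Chart (dom f `&` W) (fwd f) (bwd f)), A; split.
  - exact: std_restrict.
  - by move=> y [].
  - by split => //; exact: KW.
move=> N [f [A [phi [Z [H pos]]]]].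
pose S y := \sum_i phi i y.
have sS : sm S setT.
  move=> c ac; apply: smooth_sum.
    by apply: chart_open_image (atlas_chart ac) _ _; exact: openT.
  by move=> i _; have [_ _ [[s _ _] _ _ _]] := H i; exact: s.
have iS : inv_on S setT.
  by move=> a y _; apply: eq_bigr => i _; have [_ _ [[_ h _] _ _ _]] := H i; exact: h.
have ph0 i y : 0 <= phi i y by have [_ _ [[_ _ h] _ _ _]] := H i.
have S0 y : ~ W y -> S y = 0.
  move=> Wy; rewrite /S big1 // => i _; have [_ sub [_ _ /(_ y)[/sub //|Oy] h]] := H i.
  exact: h.
have SK y : K y -> 0 < S y.
  move=> /pos[i pi]; rewrite /S (bigD1 i) //=; apply: ltr_pwDl => //.
  by apply: sumr_ge0 => j _; exact: ph0.
have cS : continuous S by move=> y; exact: (sm_cont openT sS).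
have [e e0 eS] : exists2 e : R, 0 < e & forall y, K y -> e <= S y.
  have [[x0 Kx0]|K0] := pselect (K !=set0); last first.
    by exists 1 => // y Ky; exfalso; apply: K0; exists y.
  have [|x] := @compact_EVT_min _ R S K (ex_intro _ x0 Kx0) cK.
    exact: continuous_subspaceT.
  by rewrite inE => Kx xmin; exists (S x); [exact: SK|move=> y Ky; apply: xmin; rewrite inE].
have oc (B : set R) : open B -> open [set y | B (S y / e)].
  move=> oB; apply: (@open_comp _ _ (fun y => S y / e) B) => // y _.
  by apply: continuousM; [exact: cS|exact: cst_continuous].
exists (fun y => step (S y / e)), [set y | S y / e < 1 / 3], [set y | 2 / 3 < S y / e].
split; first split.
- apply: (@sm_comp _ _ _ _ _ step (fun y => S y / e) setT setT) => //.
  + exact: fdimR.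
  + exact: fdimR.
  + exact: openT.
  + exact: openT.
  + move=> c ac; apply: smoothM; last exact: smooth_cst.
      by apply: chart_open_image (atlas_chart ac) _ _; exact: openT.
    exact: sS.
  exact: smooth_step.
- by move=> a y _; rewrite iS.
- apply: (oc [set t | t < 1 / 3]); exact: open_lt.
- move=> y; have [Wy|/S0 Sy] := pselect (W y); first by left.
  by right; rewrite /= Sy mul0r; lra.
- by move=> y /step0.
- split.
  + apply: (oc [set t | 2 / 3 < t]); exact: open_gt.
  + by move=> a y; rewrite /= iS.
  + move=> y /eS h; rewrite /= ltr_pdivlMr //; lra.
- by move=> y /step1.
Qed.

End Bumps.

(** * Gluing over the polytope *)

Section Bisection.
Context {R : realType} {n : nat}.
Implicit Types a b p v : 'rV[R]_n.

Definition box a b := [set v : 'rV[R]_n | forall k, a 0 k <= v 0 k <= b 0 k].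

Definition upd a (i : 'I_n) (c : R) : 'rV[R]_n := \row_k (if k == i then c else a 0 k).

Lemma updE a i c k : upd a i c 0 k = if k == i then c else a 0 k.
Proof. by rewrite mxE. Qed.

Definition box_close (e : R) p a b := forall k, `|a 0 k - p 0 k| < e /\ `|b 0 k - p 0 k| < e.

Variable Q : 'rV[R]_n -> 'rV[R]_n -> Prop.
Hypotheses
  (Qloc : forall p, exists2 e : R, 0 < e & forall a b, box_close e p a b -> Q a b)
  (Qglue : forall a b i c, a 0 i <= c <= b 0 i ->
     Q a (upd b i c) -> Q (upd a i c) b -> Q a b).

Let le_row a b := forall k, a 0 k <= b 0 k.

Let halve1 a b i : le_row a b -> ~ Q a b -> exists a' b',
  [/\ le_row a' b', ~ Q a' b', le_row a a', le_row b' b &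
    forall k, b' 0 k - a' 0 k = if k == i then (b 0 k - a 0 k) / 2 else b 0 k - a 0 k].
Proof.
move=> ab nQ; set c := (a 0 i + b 0 i) / 2; have abi := ab i.
have h1 : a 0 i <= c by rewrite /c; lra.
have h2 : c <= b 0 i by rewrite /c; lra.
have [Q1|nQ1] := pselect (Q a (upd b i c)); last first.
  exists a, (upd b i c); split => // k; rewrite ?updE; have [->|] := eqVneq k i => //.
  by rewrite /c; lra.
exists (upd a i c), b; split => // [k||k|k]; rewrite ?updE.
- by have [->|] := eqVneq k i => //.
- by move=> Q2; apply: nQ; apply: (Qglue (i := i) (c := c)) => //; rewrite h1.
- by have [->|] := eqVneq k i => //.
- by have [->|] := eqVneq k i => //; rewrite /c; lra.
Qed.

Let halve a b : le_row a b -> ~ Q a b -> exists a' b',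
  [/\ le_row a' b', ~ Q a' b', le_row a a', le_row b' b &
    forall k, b' 0 k - a' 0 k = (b 0 k - a 0 k) / 2].
Proof.
move=> ab nQ.
(* One coordinate at a time, since [Qglue] cuts along a single wall. *)
have H (s : seq 'I_n) : uniq s -> exists a' b',
    [/\ le_row a' b', ~ Q a' b', le_row a a', le_row b' b &
    forall k, b' 0 k - a' 0 k = if k \in s then (b 0 k - a 0 k) / 2 else b 0 k - a 0 k].
  elim: s => [_|i s IH /= /andP[si /IH[a' [b' [h1 h2 h3 h4 h5]]]]]; first by exists a, b; split=> // k; exact: lexx.
  have [a'' [b'' [g1 g2 g3 g4 g5]]] := halve1 i h1 h2.
  exists a'', b''; split => // k; first exact: le_trans (h3 k) (g3 k).
    exact: le_trans (g4 k) (h4 k).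
  by rewrite g5 h5 inE; have [->|//] := eqVneq k i; rewrite (negbTE si).
have [a' [b' [h1 h2 h3 h4 h5]]] := H _ (enum_uniq 'I_n).
by exists a', b'; split => // k; rewrite h5 mem_enum.
Qed.

(** If [Q] fails on a box, repeated halving gives nested boxes where it fails, shrinking to a point
    [p], which contradicts [Qloc] at [p]. In contrast with a finite subcover, pieces are only ever
    glued along walls, which are boxes and hence convex. *)
Lemma bisection a b : (forall k, a 0 k <= b 0 k) -> Q a b.
Proof.
move=> ab; apply: contrapT => nQ.
pose T := {q : 'rV[R]_n * 'rV[R]_n | le_row q.1 q.2 /\ ~ Q q.1 q.2}.
have H (q : T) : exists q' : T, [/\ le_row (sval q).1 (sval q').1, le_row (sval q').2 (sval q).2 &
    forall k, (sval q').2 0 k - (sval q').1 0 k = ((sval q).2 0 k - (sval q).1 0 k) / 2].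
  case: q => -[a1 b1] [/= h1 h2]; have [a' [b' [g1 g2 g3 g4 g5]]] := halve h1 h2.
  by exists (exist _ (a', b') (conj g1 g2)).
have /choice[next nextP] := H.
pose q0 : T := exist _ (a, b) (conj ab nQ).
pose q j := iter j next q0; pose A j := (sval (q j)).1; pose B j := (sval (q j)).2.
have qS j : q j.+1 = next (q j) by [].
have AB j : le_row (A j) (B j) by case: (svalP (q j)).
have nQAB j : ~ Q (A j) (B j) by case: (svalP (q j)).
have len j k : B j 0 k - A j 0 k = (b 0 k - a 0 k) / 2 ^+ j.
  elim: j => [|j IH]; first by rewrite expr0 divr1.
  have [_ _ E] := nextP (q j); rewrite /A /B qS E -/(A j) -/(B j) IH exprSr invfM mulrA.
  by [].
have mA i j k : (i <= j)%N -> A i 0 k <= A j 0 k.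
  elim: j => [|j IH]; first by rewrite leqn0 => /eqP ->.
  rewrite leq_eqVlt => /predU1P[-> //|ij]; apply: le_trans (IH ij) _.
  by have [h _ _] := nextP (q j); exact: h.
have mB i j k : (i <= j)%N -> B j 0 k <= B i 0 k.
  elim: j => [|j IH]; first by rewrite leqn0 => /eqP ->.
  rewrite leq_eqVlt => /predU1P[-> //|ij]; apply: le_trans (IH ij).
  by have [_ h _] := nextP (q j); exact: h.
have AleB i j k : A i 0 k <= B j 0 k.
  have [ij|ji] := leqP i j; first exact: le_trans (mA i j k ij) (AB j k).
  exact: le_trans (AB i k) (mB j i k (ltnW ji)).
pose p : 'rV[R]_n := \row_k sup (range (fun j => A j 0 k)).
have pA j k : A j 0 k <= p 0 k.
  rewrite mxE; apply: ub_le_sup; last by exists j.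
  by exists (B 0%N 0 k) => _ [i _ <-]; exact: AleB.
have pB j k : p 0 k <= B j 0 k.
  rewrite mxE; apply: ge_sup; first by exists (A 0%N 0 k); exists 0%N.
  by move=> _ [i _ <-]; exact: AleB.
have [e e0 He] := Qloc p.
pose D := \sum_k (b 0 k - a 0 k).
have D0 k : b 0 k - a 0 k <= D.
  by rewrite /D (bigD1 k) //= lerDl sumr_ge0 // => i _; rewrite subr_ge0; exact: ab.
(* Since [2 ^ j > j], it suffices that [j] exceeds [D / e]. *)
have [j jD] : exists j : nat, D / e < j%:R.
  exists (Num.bound `|D / e|); apply: le_lt_trans (ler_norm _) _; exact: archi_boundP.
have Dj k : B j 0 k - A j 0 k < e.
  rewrite len; apply: (le_lt_trans (y := D / 2 ^+ j)).
    by rewrite ler_pM2r ?D0 // invr_gt0 exprn_gt0.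
  rewrite ltr_pdivrMr ?exprn_gt0 // mulrC -ltr_pdivrMr //; apply: lt_trans jD _.
  by rewrite -natrX ltr_nat ltn_expl.
apply: (nQAB j); apply: He => k; have h1 := pA j k; have h2 := pB j k; have h3 := Dj k.
by split; rewrite ltr_norml; lra.
Qed.

End Bisection.

(** * Density of free points and uniqueness of twists *)

Section FreePoints.
Context {R : realType} {m n : nat} {M : manifold R m}.
Variable act : @Cn R n -> M -> M.
Hypotheses (hact : smooth_torus_action act) (ls : locally_standard act).
Local Notation C := (@Cn R n).
Local Notation tact := (tact act).
Local Notation saturated := (saturated act).
Local Notation std := (std act).
Local Notation inv_on := (inv_on act).
Implicit Types (W S : set M) (a b : 'rV[R]_n) (f : chart M C).

Definition free x := forall a, tact a x = x -> cexp a = cone n.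

Lemma free_moduli f A x : std f A -> dom f x -> (forall k, mod2 (fwd f x) k != 0) -> free x.
Proof.
move=> sf dx zx a ax; have [_ _ _ _] := sf; apply.
have /(std_eq a sf dx dx) E := ax; apply: Cn_eq => k.
  rewrite cexp1 [(cone n).1 0 k]mxE; have := zx k; rewrite /mod2; set z := fwd f x in E *.
  have := congr1 (fun w : C => w.1 0 k) E; have := congr1 (fun w : C => w.2 0 k) E.
  rewrite cmul1 cmul2 cexp1 cexp2; set c := cos _; set s := sin _.
  move: (z.1 0 k) (z.2 0 k) => p q H1 H2 nz.
  have : (c - 1) * (p ^+ 2 + q ^+ 2) = 0.
    transitivity ((c * p - s * q - p) * p + (c * q + s * p - q) * q); first by ring.
    by rewrite H1 H2 !subrr !mul0r addr0.
  by move/eqP; rewrite mulf_eq0 (negbTE nz) orbF subr_eq0 => /eqP.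
rewrite cexp2 [(cone n).2 0 k]mxE; have := zx k; rewrite /mod2; set z := fwd f x in E *.
have := congr1 (fun w : C => w.1 0 k) E; have := congr1 (fun w : C => w.2 0 k) E.
rewrite cmul1 cmul2 cexp1 cexp2; set c := cos _; set s := sin _.
move: (z.1 0 k) (z.2 0 k) => p q H1 H2 nz.
have : s * (p ^+ 2 + q ^+ 2) = 0.
  transitivity ((c * q + s * p - q) * p - (c * p - s * q - p) * q); first by ring.
  by rewrite H1 H2 !subrr !mul0r subr0.
by move/eqP; rewrite mulf_eq0 (negbTE nz) orbF => /eqP.
Qed.

Lemma generic_dense (U : set M) x : open U -> U x ->
  exists y f A, [/\ U y, std f A, dom f y & forall k, mod2 (fwd f y) k != 0].
Proof.
move=> oU Ux; have [f [A [sf dx]]] := std_exists x ls; have cf := std_chart sf.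
set z := fwd f x; pose Z := fwd f @` (dom f `&` U).
have oZ : open Z by exact: chart_open_image.
have Zz : Z z by exists x.
have /nbhs_ballP[e /= e0 He] := near_line (cone n) oZ Zz.
have [|d d0 Hd] := @pos_lower_bound R 'I_n (fun k => if z.1 0 k == 0 then 1 else `|z.1 0 k|).
  by move=> k; case: ifPn => //; rewrite normr_gt0.
(* All real coordinates are increased by [s] at once. As [s] is below the absolute value of each
   nonzero one, none of these becomes zero, and those that were zero become [s]. *)
pose s := Num.min e d / 2.
have s0 : 0 < s by rewrite divr_gt0 // lt_min e0.
have se : s < e by rewrite ltr_pdivrMr //; have := ge_min e e d; rewrite lexx /=; lra.
have sd : s < d by rewrite ltr_pdivrMr //; have := ge_min d e d; rewrite lexx orbT /=; lra.
have /He /= [y [dy Uy] yE] : ball 0 e s by rewrite /ball /= sub0r normrN gtr0_norm.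
exists y, f, A; split => // k; rewrite yE /mod2.
rewrite gt_eqF // ltr_wpDr ?sqr_ge0 // exprn_even_gt0 //= !mxE mulr1.
have := Hd k; case: ifPn => [/eqP ->|zk h]; first by rewrite add0r gt_eqF.
apply/eqP => E; have zE : z.1 0 k = - s by lra.
by move: h; rewrite zE normrN gtr0_norm //; lra.
Qed.

Lemma free_dense (U : set M) x : open U -> U x -> exists2 y, U y & free y.
Proof.
move=> oU Ux; have [y [f [A [Uy sf dy zy]]]] := generic_dense oU Ux.
by exists y => //; exact: free_moduli sf dy zy.
Qed.

(** At a free point, [real_orbit] makes twice the difference of the twists a period, so that its
    sines vanish. The points where a sine is nonzero form an open set, which would contain a free
    point if it were not empty. *)
Lemma lift_unique S1 S2 W (eta eta' : M -> 'rV[R]_n) : open W -> saturated W ->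
  real_str act S1 W -> real_str act S2 W -> sm eta W -> sm eta' W ->
  inv_on eta W -> inv_on eta' W ->
  (forall y, W y -> S2 y <-> S1 (tact (eta y) y)) ->
  (forall y, W y -> S2 y <-> S1 (tact (eta' y) y)) ->
  forall y k, W y -> sin ((eta' y - eta y) 0 k) = 0.
Proof.
move=> oW sW r1 r2 se se' ie ie' H H' y k Wy; apply: contrapT => ny.
pose U := W `&` [set y | sin ((eta' y - eta y) 0 k) != 0].
have ce (e : M -> 'rV[R]_n) z : sm e W -> W z -> {for z, continuous (fun y => e y 0 k)}.
  move=> s Wz; apply: (@continuous_comp _ _ _ e (fun v : 'rV[R]_n => v 0 k)).
    exact: sm_cont s Wz.
  exact: coord_continuous.
have oU : open U.
  apply: (@open_setI_preimage _ _ (fun y => sin ((eta' y - eta y) 0 k)) W [set x | x != 0]) => //.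
    move=> z Wz; apply: (@continuous_comp _ _ _ (fun y => (eta' y - eta y) 0 k) sin).
      rewrite (_ : (fun y => _) = (fun y => eta' y 0 k - eta y 0 k)); last first.
        by apply/funext => w; rewrite !mxE.
      by apply: continuousB; exact: ce.
    exact: continuous_sin.
have [|x [Wx /eqP nx] fx] := @free_dense U y oU; first by split => //; exact/eqP.
have [b S2b] := real_str_meet r2 Wx; set z := tact b x in S2b.
have Wz : W z by exact: sW.
have ez : eta z = eta x by exact: ie.
have ez' : eta' z = eta' x by exact: ie'.
have S1z : S1 (tact (eta z) z) by apply/H.
have S1z' : S1 (tact (eta' z) z) by apply/H'.
have [f [A [rf df]]] := r1 _ (sW (eta z) _ Wz).
have := real_orbit (eta' z - eta z) rf df S1z.
rewrite -tactD // subrK ez ez' => -[/(_ _)H1 _].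
rewrite ez' in S1z'; have {}H1 := H1 S1z'.
have : tact ((eta' x - eta x) + (eta' x - eta x)) x = x.
  apply: (can_inj (tactNK hact b)); apply: (can_inj (tactNK hact (eta x))).
  by rewrite (tactC hact b) (tactC hact (eta x)).
move: (eta' x - eta x) nx => d nd /fx /(congr1 (fun w : C => w.1 0 k)).
have dk : (d + d) 0 k = d 0 k + d 0 k by rewrite mxE.
rewrite cexp1 [(cone n).1 0 k]mxE dk cosD -!expr2 cos2sin2 => h; have : sin (d 0 k) ^+ 2 == 0 by apply/eqP; lra.
by rewrite sqrf_eq0 => /eqP.
Qed.

End FreePoints.

(** * Gluing along the walls of boxes *)

Section Gluing.
Context {R : realType} {m n : nat} {M : manifold R m}.
Variable act : @Cn R n -> M -> M.
Variable proj : M -> 'rV[R]_n.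
Hypotheses (hact : smooth_torus_action act) (cM : compact [set: M])
  (ls : locally_standard act) (cproj : continuous proj)
  (oproj : forall U, open U -> exists2 V, open V & proj @` U = range proj `&` V)
  (fproj : forall x y, proj x = proj y <-> same_orbit act x y).
Local Notation C := (@Cn R n).
Local Notation tact := (tact act).
Local Notation saturated := (saturated act).
Local Notation inv_on := (inv_on act).
Local Notation real_str := (real_str act).
Implicit Types (W S : set M) (D : set 'rV[R]_n) (a b p v w : 'rV[R]_n).

Definition cvx D := forall v w (t : R), 0 <= t <= 1 -> D v -> D w ->
  D ((1 - t) *: v + t *: w).

Hypothesis xproj : cvx (range proj).

Lemma proj_tact a y : proj (tact a y) = proj y.
Proof. by apply/esym/fproj/(same_orbitP act y); exists a. Qed.

Lemma saturated_proj W x y : saturated W -> proj x = proj y -> W x -> W y.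
Proof. by move=> sW /fproj/(same_orbitP act x)[a ->]; exact: sW. Qed.

Lemma closed_range_proj : closed (range proj).
Proof.
apply: compact_closed; first exact: norm_hausdorff.
by apply: continuous_compact => //; exact: continuous_subspaceT.
Qed.

Lemma row_ball p (V : set 'rV[R]_n) : open V -> V p ->
  exists2 e : R, 0 < e & forall v, (forall k, `|v 0 k - p 0 k| < e) -> V v.
Proof.
move=> oV Vp; have /nbhs_ballP[e /= e0 He] : nbhs p V by exact: open_nbhs_nbhs.
exists e => // v H; apply: He; split => // i k; rewrite ord1 -ball_normE /= distrC; exact: H.
Qed.

Lemma box_in_ball e p a b v k : box_close e p a b -> box a b v -> `|v 0 k - p 0 k| < e.
Proof.
move=> /(_ k)[h1 h2] /(_ k) h3; rewrite ltr_norml in h1; rewrite ltr_norml in h2.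
by rewrite ltr_norml; lra.
Qed.

(** The projection is open, so a saturated neighbourhood of the orbit over [p] contains all points
    over small boxes around [p]. If [p] is outside [D] or outside the range of [proj], both closed,
    no point over [D] lies over small boxes and the empty set serves. *)
Lemma box_local (good : set M -> Prop) D p : closed D -> good set0 ->
  (forall x, proj x = p -> D p -> exists W, [/\ open W, saturated W, W x & good W]) ->
  exists2 e : R, 0 < e & forall a b, box_close e p a b ->
    exists2 W, good W & forall y, D (proj y) -> box a b (proj y) -> W y.
Proof.
move=> clD g0 H.
have out (V : set 'rV[R]_n) : open V -> V p -> (forall y, V (proj y) -> ~ D (proj y)) ->
    exists2 e : R, 0 < e & forall a b, box_close e p a b ->
    exists2 W, good W & forall y, D (proj y) -> box a b (proj y) -> W y.
  move=> oV Vp VD; have [e e0 He] := row_ball oV Vp; exists e => // a b cab; exists set0 => // y Dy yab.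
  by apply: (VD y) => //; apply: He => k; exact: box_in_ball cab yab.
have [Dp|nDp] := pselect (D p); last first.
  by apply: (out (~` D)) => //; exact: closed_openC.
have [[x _ xp]|nx] := pselect (range proj p); last first.
  apply: (out (~` (range proj))) => //; first exact: closed_openC closed_range_proj.
  by move=> y ny; exfalso; apply: ny; exists y.
have [W [oW sW Wx gW]] := H x xp Dp; have [V oV WV] := oproj oW.
have Vp : V p by have : (proj @` W) p by [exists x]; rewrite WV => -[].
have [e e0 He] := row_ball oV Vp; exists e => // a b cab; exists W => // y _ yab.
have Vy : V (proj y) by apply: He => k; exact: box_in_ball cab yab.
have : (proj @` W) (proj y) by rewrite WV; split => //; exists y.
by move=> [z Wz /saturated_proj]; apply.
Qed.

Lemma closed_box a b : closed (box a b).
Proof.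
rewrite (_ : box a b = \bigcap_k [set v : 'rV[R]_n | a 0 k <= v 0 k <= b 0 k]); last first.
  by apply/seteqP; split=> v /= H => [k _|k]; exact: H.
apply: closed_bigI => k _.
apply: (@preimage_closed _ _ (fun v : 'rV[R]_n => v 0 k) `[a 0 k, b 0 k]%classic).
  by move=> v _; exact: coord_continuous.
exact: interval_closed.
Qed.

Lemma cvx_box a b : cvx (box a b).
Proof.
move=> v w t /andP[t0 t1] vab wab k; have := vab k; have := wab k; rewrite !mxE.
move=> /andP[h1 h2] /andP[h3 h4]; apply/andP; split; nra.
Qed.

Lemma box_wall a b v i c : a 0 i <= c <= b 0 i -> box (upd a i c) (upd b i c) v ->
  box a (upd b i c) v /\ box (upd a i c) b v.
Proof.
move=> /andP[ac cb] H; split=> k; have := H k; rewrite !updE;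
  have [->|//] := eqVneq k i; move=> /andP[h1 h2]; apply/andP; split => //.
- exact: le_trans h1.
- exact: le_trans cb.
Qed.

Lemma box_lower a b v i c : box a b v -> v 0 i <= c -> box a (upd b i c) v.
Proof.
move=> H vc k; rewrite updE; have [->|//] := eqVneq k i.
by rewrite vc andbT; have /andP[] := H i.
Qed.

Lemma box_upper a b v i c : box a b v -> c <= v 0 i -> box (upd a i c) b v.
Proof.
move=> H vc k; rewrite updE; have [->|//] := eqVneq k i.
by rewrite vc; have /andP[] := H i.
Qed.

Lemma sin_eq0_close (x y : R) : sin x = 0 -> sin y = 0 -> `|x - y| < 1 -> x = y.
Proof.
move=> sx sy; rewrite ltr_norml => /andP[h1 h2].
have sxy : sin (x - y) = 0 by rewrite sinB sx sy mul0r mulr0 subr0.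
have [xy|yx|//] := ltgtP x y.
  have : 0 < sin (- (x - y)) by apply: sin2_gt0; lra.
  by rewrite sinN sxy oppr0 ltxx.
have : 0 < sin (x - y) by apply: sin2_gt0; lra.
by rewrite sxy ltxx.
Qed.

(** The zeros of the sine are discrete, so [u] is locally constant, which is the local hypothesis of
    bisection. Convexity of [D] and of the range is needed when gluing, to reach the wall. *)
Lemma invariant_const D W (u : M -> R) : closed D -> cvx D -> open W ->
  saturated W -> (forall y, D (proj y) -> W y) -> (forall y, W y -> {for y, continuous u}) ->
  inv_on u W -> (forall y, W y -> sin (u y) = 0) ->
  forall x y, D (proj x) -> D (proj y) -> u x = u y.
Proof.
move=> clD xD oW sW DW cu iu su x y Dx Dy.
pose Q a b := forall y z, D (proj y) -> box a b (proj y) -> D (proj z) -> box a b (proj z) -> u y = u z.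
have Qall a b : (forall k, a 0 k <= b 0 k) -> Q a b.
  apply: bisection => [p|a' b' i c aci Q1 Q2 y1 y2 Dy1 y1ab Dy2 y2ab].
    have [|w pw Dp|e e0 He] := @box_local (fun W => forall y z, W y -> W z -> u y = u z) D p clD.
    - by [].
    - have Ww : W w by apply: DW; rewrite pw.
      pose W' := W `&` [set y | `|u y - u w| < 1].
      exists W'; split.
      + apply: (@open_setI_preimage _ _ (fun y => `|u y - u w|) W [set x | x < 1]) => //.
        move=> z Wz; apply: (@continuous_comp _ _ _ (fun y => u y - u w) Num.norm).
          by apply: continuousB; [exact: cu|exact: cst_continuous].
        exact: norm_continuous.
      + by move=> a' z [Wz h]; split; [exact: sW|rewrite /= iu].
      + by split => //=; rewrite subrr normr0.
      + have E z : W' z -> u z = u w by move=> [Wz h]; apply: sin_eq0_close => //; exact: su.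
        by move=> y1 y2 /E -> /E ->.
    exists e => // a' b' cab y1 y2 Dy1 y1ab Dy2 y2ab; have [W' gW' H] := He _ _ cab.
    by apply: gW'; exact: H.
  (* A segment from one half of the box to the other crosses the wall. *)
  have cross z1 z2 : D (proj z1) -> box a' b' (proj z1) -> proj z1 0 i <= c ->
      D (proj z2) -> box a' b' (proj z2) -> c <= proj z2 0 i -> u z1 = u z2.
    move=> D1 ab1 c1 D2 ab2 c2.
    have [t t01 tc] : exists2 t : R, 0 <= t <= 1 & (1 - t) * proj z1 0 i + t * proj z2 0 i = c.
      have [E|ne] := eqVneq (proj z1 0 i) (proj z2 0 i).
        by exists 0; [rewrite lexx ler01|rewrite E in c1 *; lra].
      have d0 : 0 < proj z2 0 i - proj z1 0 i.
        by rewrite subr_gt0 lt_neqAle ne; apply: le_trans c1 c2.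
      exists ((c - proj z1 0 i) / (proj z2 0 i - proj z1 0 i)).
        by rewrite divr_ge0 ?(ltW d0) ?subr_ge0 //= ler_pdivrMr // mul1r lerB.
      by field; rewrite gt_eqF.
    have [w _ wE] := xproj t01 (imageT proj z1) (imageT proj z2).
    have wc : proj w 0 i = c by rewrite wE !mxE.
    have wab : box a' b' (proj w) by rewrite wE; exact: cvx_box.
    have Dw : D (proj w) by rewrite wE; exact: xD.
    transitivity (u w); [apply: Q1|apply: Q2] => //.
    + exact: box_lower.
    + by apply: box_lower => //; rewrite wc.
    + by apply: box_upper => //; rewrite wc.
    + exact: box_upper.
  have [c1|c1] := leP (proj y1 0 i) c; have [c2|c2] := leP (proj y2 0 i) c.
  + by apply: Q1 => //; exact: box_lower.
  + by apply: cross => //; exact: ltW.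
  + by apply/esym; apply: cross => //; exact: ltW.
  + by apply: Q2 => //; apply: box_upper => //; exact: ltW.
pose a : 'rV[R]_n := \row_k Num.min (proj x 0 k) (proj y 0 k).
pose b : 'rV[R]_n := \row_k Num.max (proj x 0 k) (proj y 0 k).
apply: (Qall a b) => // k; rewrite !mxE ?ge_min ?le_max ?lexx ?orbT //.
Qed.

Definition lifted S1 S2 W (eta : M -> 'rV[R]_n) :=
  [/\ open W, saturated W, sm eta W, inv_on eta W & forall y, W y -> S2 y <-> S1 (tact (eta y) y)].

(** Twice [kappa] is a period, so by [real_orbit] the action of [kappa] preserves [S1]. *)
Lemma lift_shift S1 S2 W V W' eta (kappa : 'rV[R]_n) : lifted S1 S2 W eta -> real_str S1 V ->
  (forall y, W' y -> W y /\ V y) -> open W' -> saturated W' ->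
  (forall k, sin (kappa 0 k) = 0) -> lifted S1 S2 W' (fun y => eta y + kappa).
Proof.
move=> [oW sW se ie H] rV sub oW' sW' sk.
have k2 z : tact (kappa + kappa) z = z.
  rewrite -[RHS](tact0 hact) /tact; congr (act _ z); apply: Cn_eq => k.
    by rewrite !cexp1 [(0 : 'rV[R]_n) 0 k]mxE cos0 mxE cosD -!expr2 cos2sin2 sk expr0n /= !subr0.
  by rewrite !cexp2 [(0 : 'rV[R]_n) 0 k]mxE sin0 mxE sinD sk mul0r mulr0 addr0.
have shift z : V z -> S1 z -> S1 (tact kappa z).
  by move=> Vz S1z; have [f [A [rf df]]] := rV z Vz; apply/(real_orbit kappa rf df S1z).
split => //.
- move=> c ac; apply: smoothD; last exact: smooth_cst.
    exact: chart_open_image (atlas_chart ac) _ oW'.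
  by apply: (sm_sub _ se) => // y /sub[].
- by move=> a y /sub[Wy _]; rewrite ie.
- move=> y W'y; have [Wy Vy] := sub _ W'y; rewrite H // addrC tactD //.
  have Vt z a : W' z -> V (tact a z) by move=> Wz; have [] := sub _ (sW' a _ Wz).
  split=> [|h]; first by apply: shift; exact: Vt.
  rewrite -[tact (eta y) y]k2 tactD //; apply: shift => //.
  by rewrite -tactD //; exact: Vt.
Qed.

Lemma open_proj_lt i c : open [set y | proj y 0 i < c].
Proof.
apply: (@open_comp _ _ (fun y => proj y 0 i) [set x | x < c]); last exact: open_lt.
move=> y _; apply: (@continuous_comp _ _ _ proj (fun v : 'rV[R]_n => v 0 i)).
  exact: cproj.
exact: coord_continuous.
Qed.

Lemma open_proj_gt i c : open [set y | c < proj y 0 i].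
Proof.
apply: (@open_comp _ _ (fun y => proj y 0 i) [set x | c < x]); last exact: open_gt.
move=> y _; apply: (@continuous_comp _ _ _ proj (fun v : 'rV[R]_n => v 0 i)).
  exact: cproj.
exact: coord_continuous.
Qed.

Lemma sm_union (V : normedModType R) (u : M -> V) W W' : sm u W -> sm u W' -> sm u (W `|` W').
Proof.
by move=> s1 s2; apply: sm_loc => y [Wy|Wy]; [exists W|exists W'].
Qed.

Definition lower W i c := W `&` [set y | proj y 0 i < c].
Definition upper W i c := W `&` [set y | c < proj y 0 i].

Lemma lower_open W i c : open W -> open (lower W i c).
Proof. by move=> oW; apply: openI => //; exact: open_proj_lt. Qed.

Lemma upper_open W i c : open W -> open (upper W i c).
Proof. by move=> oW; apply: openI => //; exact: open_proj_gt. Qed.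

Lemma lower_saturated W i c : saturated W -> saturated (lower W i c).
Proof. by move=> sW a y [Wy yc]; split; [exact: sW|rewrite /= proj_tact]. Qed.

Lemma upper_saturated W i c : saturated W -> saturated (upper W i c).
Proof. by move=> sW a y [Wy yc]; split; [exact: sW|rewrite /= proj_tact]. Qed.

Definition paste T (p q : M -> T) i c y := if proj y 0 i < c then p y else q y.

(** Off the wall the pasted function is locally one of the two lifts; on [W12], a neighbourhood of
    the wall in the application, it is both. *)
Lemma lift_patch S1 S2 W1 W2 W12 eta1 eta2 i c :
  lifted S1 S2 W1 eta1 -> lifted S1 S2 W2 eta2 -> open W12 -> saturated W12 ->
  (forall y, W12 y -> [/\ W1 y, W2 y & eta1 y = eta2 y]) ->
  lifted S1 S2 (lower W1 i c `|` upper W2 i c `|` W12) (paste eta1 eta2 i c).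
Proof.
move=> [p1 s1 sm1 i1 H1] [p2 s2 sm2 i2 H2] o12 s12 E12.
have pl y : lower W1 i c y -> paste eta1 eta2 i c y = eta1 y by move=> [_ /= yc]; rewrite /paste yc.
have pu y : upper W2 i c y -> paste eta1 eta2 i c y = eta2 y.
  by move=> [_ /= yc]; rewrite /paste ltNge (ltW yc).
have p12 y : W12 y -> paste eta1 eta2 i c y = eta1 y.
  by move=> /E12[_ _ E]; rewrite /paste; case: ifP.
have ol := lower_open i c p1; have ou := upper_open i c p2.
split.
- by apply: openU => //; exact: openU.
- by apply: saturatedU => //; apply: saturatedU; [exact: lower_saturated|exact: upper_saturated].
- apply: sm_union; first apply: sm_union.
  + apply: (@sm_eq _ _ _ _ eta1) => //; first by move=> y /pl ->.
    by apply: sm_sub sm1 => y [].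
  + apply: (@sm_eq _ _ _ _ eta2) => //; first by move=> y /pu ->.
    by apply: sm_sub sm2 => y [].
  + apply: (@sm_eq _ _ _ _ eta1) => //; first by move=> y /p12 ->.
    by apply: sm_sub sm1 => y /E12[].
- move=> a y [[ly|uy]|wy].
  + by rewrite !pl ?i1 //; [case: ly|exact: lower_saturated].
  + by rewrite !pu ?i2 //; [case: uy|exact: upper_saturated].
  + by rewrite !p12 ?i1 //; [case: (E12 _ wy)|exact: s12].
- move=> y [[ly|uy]|wy].
  + by rewrite pl // H1 //; case: ly.
  + by rewrite pu // H2 //; case: uy.
  + by rewrite p12 // H1 //; case: (E12 _ wy).
Qed.

(** Where two boxes meet along a wall, their lifts differ by half periods, constant over the part of
    [D] in the wall because it is convex. Shifting one lift by this constant makes both agree near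
    that part. *)
Lemma lift_exists S1 S2 V D : closed D -> cvx D -> open V -> saturated V ->
  real_str S1 V -> real_str S2 V -> (forall y, D (proj y) -> V y) ->
  forall a b, (forall k, a 0 k <= b 0 k) -> exists W eta,
  [/\ lifted S1 S2 W eta, W `<=` V & forall y, D (proj y) -> box a b (proj y) -> W y].
Proof.
move=> clD xD oV sV r1 r2 DV; apply: bisection => [p|a b i c aci].
  have [|x xp Dp|e e0 He] := @box_local (fun W => exists2 eta, lifted S1 S2 W eta & W `<=` V) D p clD.
  - exists (fun=> 0); last by [].
    split => //; first exact: open0.
    by move=> d ad; exact: smooth_cst.
  - have Vx : V x by apply: DV; rewrite xp.
    have [W [eta [[oW sW Wx] se ie H]]] := difference hact r1 r2 Vx.
    exists (W `&` V); split => //; [exact: openI|exact: saturatedI|].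
    exists eta; last by move=> y [].
    split => //; [exact: openI|exact: saturatedI|by apply: sm_sub se => y []| |].
    + by move=> d y [Wy _]; exact: ie.
    + by move=> y [Wy _]; exact: H.
  exists e => // a b /He[W [eta le WV] H].
  by exists W, eta.
move=> [W1 [eta1 [l1 V1 H1]]] [W2 [eta2 [l2 V2 H2]]].
have [p1 s1 sm1 i1 E1] := l1; have [p2 s2 sm2 i2 E2] := l2.
pose W := W1 `&` W2.
have oW : open W by exact: openI.
have sW : saturated W by exact: saturatedI.
have subW1 : W `<=` W1 by move=> y [].
have subW2 : W `<=` W2 by move=> y [].
pose del y k := (eta1 y - eta2 y) 0 k.
have sdel y k : W y -> sin (del y k) = 0.
  apply: (@lift_unique _ _ _ _ act hact ls S1 S2 W eta2 eta1) => //.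
  - by move=> z [/V1 /r1].
  - by move=> z [/V1 /r2].
  - exact: sm_sub sm2.
  - exact: sm_sub sm1.
  - by move=> d z [_ Wz]; exact: i2.
  - by move=> d z [Wz _]; exact: i1.
  - by move=> z [_ Wz]; exact: E2.
  - by move=> z [Wz _]; exact: E1.
have cdel y k : W y -> {for y, continuous (fun y => del y k)}.
  move=> Wy; rewrite /del; under [X in {for _, continuous X}]eq_fun do rewrite !mxE.
  have ce (e : M -> 'rV[R]_n) : sm e W -> {for y, continuous (fun y => e y 0 k)}.
    move=> s; apply: (@continuous_comp _ _ _ e (fun v : 'rV[R]_n => v 0 k)).
      exact: sm_cont s Wy.
    exact: coord_continuous.
  by apply: continuousB; apply: ce; [exact: sm_sub sm1|exact: sm_sub sm2].
have idel y k d : W y -> del (tact d y) k = del y k.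
  by move=> [Wy1 Wy2]; rewrite /del i1 // i2.
pose D' := D `&` box (upd a i c) (upd b i c).
have D'W y : D' (proj y) -> W y.
  by move=> [Dy /(box_wall aci)[h1 h2]]; split; [exact: H1|exact: H2].
have [kappa [sk Hk]] : exists kappa : 'rV[R]_n, (forall k, sin (kappa 0 k) = 0) /\
    forall y k, D' (proj y) -> del y k = kappa 0 k.
  (* If no point lies over the part of [D] in the wall, nothing has to match and 0 is taken. *)
  have [[x D'x]|nx] := pselect (exists x, D' (proj x)); last first.
    exists 0; split=> [k|y k D'y]; first by rewrite mxE sin0.
    by exfalso; apply: nx; exists y.
  exists (eta1 x - eta2 x); split=> [k|y k D'y]; first by apply: sdel; exact: D'W.
  apply: (@invariant_const D' W (fun y => del y k)) => //.
  - apply: closedI => //; exact: closed_box.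
  - by move=> v w t t01 [Dv bv] [Dw bw]; split; [exact: xD|exact: cvx_box].
  - by move=> z Wz; exact: cdel.
  - by move=> d z Wz; exact: idel.
  - by move=> z Wz; exact: sdel.
have l2' : lifted S1 S2 W2 (fun y => eta2 y + kappa).
  by apply: lift_shift l2 r1 _ _ _ _ => // y W2y; split => //; exact: V2.
(* Half periods less than 1 apart are equal, so the lifts agree on this open set and not only over
   the wall. *)
pose W12 := [set y | W y /\ forall k, `|del y k - kappa 0 k| < 1].
have oW12 : open W12.
  rewrite openE => y [Wy Hy].
  apply: (@filterI _ (nbhs y) _ W [set y | forall k, `|del y k - kappa 0 k| < 1]).
    exact: open_nbhs_nbhs.
  apply: (@filter_forall _ _ _ (nbhs y) _) => k.
    have : nbhs y (W `&` [set y | `|del y k - kappa 0 k| < 1]).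
      apply: open_nbhs_nbhs; split; last by split => //; exact: Hy.
      apply: (@open_setI_preimage _ _ (fun y => `|del y k - kappa 0 k|) W [set x | x < 1]) => // z Wz.
      apply: (@continuous_comp _ _ _ (fun y => del y k - kappa 0 k) Num.norm).
        by apply: continuousB; [exact: cdel|exact: cst_continuous].
      exact: norm_continuous.
    by apply: filterS => z [].
have sW12 : saturated W12.
  by move=> d y [Wy Hy]; split; [exact: sW|move=> k; rewrite idel].
have E12 y : W12 y -> [/\ W1 y, W2 y & eta1 y = eta2 y + kappa].
  move=> [[Wy1 Wy2] Hy]; split => //; apply/rowP => k; rewrite [RHS]mxE.
  have <- : del y k = kappa 0 k by apply: sin_eq0_close => //; exact: sdel.
  by rewrite /del !mxE addrC subrK.
have := lift_patch i c l1 l2' oW12 sW12 E12; set Wf := (X in lifted _ _ X _) => lf.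
exists Wf, (paste eta1 (fun y => eta2 y + kappa) i c); split => //.
  by move=> y [[[/V1]|[/V2]]|[[/V1]]].
move=> y Dy yab; have [yc|yc|yc] := ltgtP (proj y 0 i) c.
- left; left; split => //; apply: H1 => //; apply: box_lower => //; exact: ltW.
- left; right; split => //; apply: H2 => //; apply: box_upper => //; exact: ltW.
right; have D'y : D' (proj y).
  split => //; apply: box_lower; last by rewrite yc.
  by apply: box_upper => //; rewrite yc.
by split=> [|k]; [exact: D'W|rewrite Hk // subrr normr0].
Qed.

(** The wall [D] is itself a box, so [lift_exists] provides [eta] near it. Nothing is known of [eta]
    elsewhere, and only its cut-off [e] is smooth and invariant on the whole of M. *)
Lemma real_str_glue S1 S2 W1 W2 a b i c : open W1 -> saturated W1 -> open W2 ->
  saturated W2 -> real_str S1 W1 -> real_str S2 W2 -> a 0 i <= c <= b 0 i ->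
  (forall k, a 0 k <= b 0 k) ->
  (forall y, box a (upd b i c) (proj y) -> W1 y) ->
  (forall y, box (upd a i c) b (proj y) -> W2 y) ->
  exists S W, [/\ open W, saturated W, real_str S W & forall y, box a b (proj y) -> W y].
Proof.
move=> p1 s1 p2 s2 r1 r2 aci ab H1 H2; pose V := W1 `&` W2.
have oV : open V by exact: openI.
have sV : saturated V by exact: saturatedI.
pose D := box (upd a i c) (upd b i c).
have DV y : D (proj y) -> V y.
  by move=> /(box_wall aci)[h1 h2]; split; [exact: H1|exact: H2].
have [|||W [eta [[oW sW se ie E] WV DW]]] :=
  @lift_exists S1 S2 V D (@closed_box _ _) (@cvx_box _ _) oV sV _ _ DV (upd a i c) (upd b i c).
- by move=> y [/r1].
- by move=> y [_ /r2].
- by move=> k; rewrite !updE; case: ifP.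
pose K := [set y | D (proj y)].
have cK : closed K.
  apply: (@preimage_closed _ _ proj D); last exact: closed_box.
  by move=> y _; exact: cproj.
have KW : K `<=` W by move=> y Dy; exact: DW.
have [chi [Z [W' [[schi ichi oZ WZ Z0] [oW' sW' KW'] W'1]]]] := cutoff hact cM ls cK oW sW KW.
pose e y := chi y *: eta y.
have oT : open [set: M] := openT.
have se' : sm e setT.
  apply: sm_loc => y _; have [Wy|Zy] := WZ y.
    exists W => // d ad; have oA := chart_open_image (atlas_chart ad) oW.
    apply: smooth_mx => // p q; rewrite /e; under eq_fun do rewrite /= mxE.
    apply: smoothM => //; last by apply: smooth_coord => //; exact: se.
    have : sm chi W by exact: sm_sub schi.
    exact.
  exists Z => //; apply: (@sm_eq _ _ _ _ (fun=> 0)) => //.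
    by move=> z /Z0; rewrite /e => ->; rewrite scale0r.
  by move=> d ad; exact: smooth_cst.
have ie' : inv_on e setT.
  move=> d y _; rewrite /e ichi //; have [Wy|Zy] := WZ y; first by rewrite ie.
  by rewrite Z0 // !scale0r.
pose S1' := [set y | S1 (tact (e y) y)].
have r1' : real_str S1' W1.
  by apply: real_str_twist => //; [exact: sm_sub se'|move=> d y _; exact: ie'].
pose U := W `&` W'.
have oU : open U by exact: openI.
have sU : saturated U by exact: saturatedI.
have SU y : U y -> S1' y <-> S2 y.
  by move=> [Wy W'y]; rewrite E // /S1' /= /e W'1 // scale1r.
pose S : set M := paste S1' S2 i c.
exists S, (lower W1 i c `|` upper W2 i c `|` U).
have rl : real_str S (lower W1 i c).
  apply: (real_str_loc r1'); [exact: lower_open|exact: lower_saturated|by move=> y []|].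
  by move=> y [_ /= yc]; rewrite /S /paste yc.
have ru : real_str S (upper W2 i c).
  apply: (real_str_loc r2); [exact: upper_open|exact: upper_saturated|by move=> y []|].
  by move=> y [_ /= yc]; rewrite /S /paste ltNge (ltW yc).
have rU : real_str S U.
  apply: (real_str_loc r1'); [exact: oU|exact: sU|by move=> y [/WV[]]|].
  by move=> y /SU Ey; rewrite /S /paste; case: ifP.
split.
- by apply: openU => //; apply: openU; [exact: lower_open|exact: upper_open].
- by apply: saturatedU => //; apply: saturatedU; [exact: lower_saturated|exact: upper_saturated].
- by move=> y [[/rl|/ru]|/rU].
move=> y yab; have [yc|yc|yc] := ltgtP (proj y 0 i) c.
- left; left; split => //; apply: H1 => //; apply: box_lower => //; exact: ltW.
- left; right; split => //; apply: H2 => //; apply: box_upper => //; exact: ltW.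
right; have Dy : D (proj y).
  apply: box_lower; last by rewrite yc.
  by apply: box_upper => //; rewrite yc.
by split; [exact: KW|exact: KW'].
Qed.

Lemma real_str_global : exists S, real_str S setT.
Proof.
(* The order of the corners is built into [Q], since the gluing hypothesis of [bisection] knows it
   only in the direction of the cut. *)
pose Q a b := (forall k, a 0 k <= b 0 k) -> exists S W,
  [/\ open W, saturated W, real_str S W & forall y, box a b (proj y) -> W y].
have Qall a b : (forall k, a 0 k <= b 0 k) -> Q a b.
  apply: bisection => [p|a' b' i c aci Q1 Q2 ab].
    have [|x xp _|e e0 He] := @box_local (fun W => exists S, [/\ open W, saturated W & real_str S W]) setT p closedT.
    - by exists set0; split => //; exact: open0.
    - have [S [W [oW sW Wx rS]]] := real_str_exists x ls.
      by exists W; split => //; exists S.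
    exists e => // a' b' cab ab; have [W [S [oW sW rS]] H] := He _ _ cab.
    by exists S, W; split => // y; exact: H.
  have /andP[ac cb] := aci.
  have [|S1 [W1 [p1 s1 r1 H1]]] := Q1; first by move=> k; rewrite updE; case: eqP => [->|].
  have [|S2 [W2 [p2 s2 r2 H2]]] := Q2; first by move=> k; rewrite updE; case: eqP => [->|].
  exact: (real_str_glue p1 s1 p2 s2 r1 r2 aci ab H1 H2).
(* By compactness a single box contains the whole range of [proj]. *)
have [c Hc] : exists c : R, forall y k, `|proj y 0 k| <= c.
  have : bounded_set (range proj).
    by apply: compact_bounded; apply: continuous_compact => //; exact: continuous_subspaceT.
  move=> [c0 [_ Hc]]; exists (c0 + 1) => y k.
  have /= h := Hc (c0 + 1) _ (proj y) (imageT proj y).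
  apply: le_trans (h _); last by rewrite ltrDl.
  by rewrite [leRHS]/Num.norm /= mx_normrE; apply/bigmax_geP; right; exists (0, k).
pose a : 'rV[R]_n := const_mx (- c); pose b : 'rV[R]_n := const_mx c.
have [y0 _] := manifold_nonempty M.
have c0 : 'I_n -> 0 <= c by move=> k; exact: le_trans (normr_ge0 _) (Hc y0 k).
have ab k : a 0 k <= b 0 k by rewrite !mxE -subr_ge0 opprK addr_ge0 ?c0.
have [S [W [oW sW rS H]]] := Qall a b ab ab; exists S => y _; apply: rS; apply: H => k.
by rewrite !mxE -ler_norml.
Qed.

End Gluing.

(** * The section *)

Section Jacobians.
Context {R : realType}.

Lemma jacobian_near p q (F G : 'rV[R]_p -> 'rV[R]_q) x :
  (\near x, F x = G x) -> differentiable F x -> jacobian F x = jacobian G x.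
Proof.
move=> E dF; have dG := near_eq_differentiable E dF.
apply/row_matrixP => i; apply: etrans (rowE _ _) (etrans _ (esym (rowE _ _))).
apply: etrans (esym (deriveEjacobian (delta_mx 0 i) dF)) _.
apply: etrans _ (deriveEjacobian (delta_mx 0 i) dG).
exact: (near_eq_derive _ E).
Qed.

Lemma jacobian_comp p q r (G : 'rV[R]_q -> 'rV[R]_r) (F : 'rV[R]_p -> 'rV[R]_q) x :
  differentiable F x -> differentiable G (F x) ->
  jacobian (fun y => G (F y)) x = jacobian F x *m jacobian G (F x).
Proof.
move=> dF dG; have dGF := @differentiable_comp _ _ _ _ F G x dF dG.
apply/row_matrixP => i; apply: etrans (rowE _ _) (etrans _ (esym (rowE _ _))); rewrite mulmxA -(deriveEjacobian _ dF) -(deriveEjacobian _ dG).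
by rewrite -[LHS](deriveEjacobian _ dGF) derive_comp.
Qed.

Lemma jacobian_linear p q (L : 'rV[R]_p -> 'rV[R]_q) x v : linear L -> continuous L ->
  v *m jacobian L x = L v.
Proof.
move=> Ll cL.
pose A := GRing.isLinear.Build _ _ _ _ _ Ll.
pose LL : {linear 'rV[R]_p -> 'rV[R]_q} := HB.pack L A.
have dL : differentiable LL x by exact: linear_differentiable.
by rewrite -deriveEjacobian // deriveE // (@diff_lin _ _ _ LL).
Qed.

(** Jacobian matrices are taken between spaces of row vectors, while C^n is a product. With real
    parts first, being real or imaginary becomes the vanishing of a block. *)
Definition rvec n (z : @Cn R n) : 'rV[R]_(n + n) := row_mx z.1 z.2.

Definition cvec n (v : 'rV[R]_(n + n)) : @Cn R n := (lsubmx v, rsubmx v).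

Lemma rvecK n : cancel (@rvec n) (@cvec n).
Proof. by move=> [x y]; rewrite /cvec /rvec row_mxKl row_mxKr. Qed.

Lemma rvec_linear n : linear (@rvec n).
Proof. by move=> t z w; rewrite /rvec scale_row_mx add_row_mx. Qed.

Lemma smooth_rvec n (V : normedModType R) (f : V -> @Cn R n) A : open A ->
  smooth_on f A -> smooth_on (fun x => rvec (f x)) A.
Proof.
move=> oA sf; apply: smooth_mx => // i j; rewrite /rvec; under eq_fun do rewrite mxE.
case: (fintype.split j) => k; apply: smooth_coord => //; [exact: smooth_fst|exact: smooth_snd].
Qed.

Lemma smooth_cvec n (V : normedModType R) (f : V -> 'rV[R]_(n + n)) A : open A ->
  smooth_on f A -> smooth_on (fun x => cvec (f x)) A.
Proof.
move=> oA sf; apply: smooth_pair => //; apply: smooth_mx => // i j;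
  under eq_fun do rewrite mxE; exact: smooth_coord.
Qed.

Lemma continuous_rvec n : continuous (@rvec n).
Proof.
move=> z; have s := @smooth_rvec n (@Cn R n) id setT openT (smooth_id setT).
exact: (smooth_cont s I).
Qed.

End Jacobians.

Section ManifoldJacobians.
Context {R : realType} {m : nat} {M : manifold R m}.

Lemma sm_id c (ac : @atlas R m M c) : sm (fwd c) (dom c).
Proof. by move=> d ad; have [] := atlas_compatible ad ac. Qed.

(** The chain rule through a chart [c] at the intermediate point of M; the factorization through [c]
    holds near [u] only, whence the continuity of [gamma]. *)
Lemma jacobian_sm p q c W (h : M -> 'rV[R]_q) (gamma : 'rV[R]_p -> M) u :
  atlas c -> dom c (gamma u) -> open W -> W (gamma u) -> sm h W ->
  {for u, continuous gamma} -> differentiable (fwd c \o gamma) u ->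
  jacobian (h \o gamma) u = jacobian (fwd c \o gamma) u *m jacobian (h \o bwd c) (fwd c (gamma u)).
Proof.
move=> ac dc oW Wu sh cg dg; have cc := atlas_chart ac.
have dh : differentiable (h \o bwd c) ((fwd c \o gamma) u).
  by apply: smooth_diff (sh c ac) _; exists (gamma u).
have -> : jacobian (h \o gamma) u = jacobian (fun y => (h \o bwd c) ((fwd c \o gamma) y)) u.
  apply/esym/jacobian_near; last exact: (@differentiable_comp _ _ _ _ (fwd c \o gamma) (h \o bwd c)).
  have nc : nbhs (gamma u) (dom c) by apply: open_nbhs_nbhs; split => //; exact: chart_open_dom.
  apply: (@filterS _ (nbhs u) _ _ _ _ (cg _ nc)) => y dy /=; by rewrite (chart_bwdK cc).
exact: jacobian_comp.
Qed.

End ManifoldJacobians.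

(** * The manifold of real points *)

Section RealPoints.
Context {R : realType} {m n : nat} {M : manifold R m}.
Variables (act : @Cn R n -> M -> M) (S : set M).
Hypotheses (hact : smooth_torus_action act) (rS : real_str act S setT).
Local Notation C := (@Cn R n).
Local Notation tact := (tact act).
Local Notation std := (std act).
Local Notation real_chart := (real_chart act).
Implicit Types (f : chart M C).

Definition real_points := set_type S.
Local Notation T := real_points.
Variable s0 : T.

Definition incl (s : T) : M := val s.

Lemma incl_in s : S (incl s). Proof. exact: set_mem (valP s). Qed.

Lemma incl_inj : injective incl. Proof. exact: val_inj. Qed.

Lemma incl_continuous : continuous incl.
Proof. exact: (@initial_continuous _ _ (@set_val M S)). Qed.

Lemma real_points_openP (U : set T) : open U <-> exists2 W, open W & incl @^-1` W = U.
Proof. by []. Qed.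

Lemma continuous_incl (X : topologicalType) (g : X -> T) x :
  {for x, continuous (incl \o g)} -> {for x, continuous g}.
Proof.
move=> cg U; rewrite nbhsE => -[V [/real_points_openP[W oW <-] Wx] sub].
have : nbhs (incl (g x)) W by exact: open_nbhs_nbhs.
move=> /cg Wn; apply: (@filterS _ (nbhs x) _ (fun y => W (incl (g y))) _ _ Wn) => y Wy.
exact: sub.
Qed.

(** The inverse maps of charts are total functions; [s0] is the value outside [S]. *)
Definition to_real (y : M) : T := insubd s0 y.

Lemma to_realK y : S y -> incl (to_real y) = y.
Proof. by move=> Sy; rewrite /incl insubdK // mem_set. Qed.

Lemma inclK s : to_real (incl s) = s.
Proof. by apply: incl_inj; rewrite to_realK //; exact: incl_in. Qed.

(** For a real chart [f] the imaginary part is zero on [S], so the real part alone is a chart of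
    [S]. *)
Definition slice f : chart T 'rV[R]_n :=
  Chart (incl @^-1` dom f) (fun s => (fwd f (incl s)).1) (fun u => to_real (bwd f (u, 0))).

Section Slice.
Variables (f : chart M C) (A : 'M[R]_n).
Hypothesis rf : real_chart f A S.

Lemma slice_fwd s : dom f (incl s) -> fwd f (incl s) = ((fwd f (incl s)).1, 0).
Proof. by move=> ds; have /(rf.2 _ ds) <- := incl_in s; case: (fwd f _). Qed.

Lemma slice_image W u : (fwd (slice f) @` (dom (slice f) `&` incl @^-1` W)) u <->
  (fwd f @` (dom f `&` W)) (u, 0).
Proof.
split=> [[s [ds Ws] <-]|[y [dy Wy] yu]].
  by exists (incl s) => //; exact: slice_fwd.
have Sy : S y by apply/(rf.2 _ dy); rewrite yu.
exists (to_real y); first by rewrite /= to_realK.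
by rewrite /= to_realK // yu.
Qed.

Lemma slice_bwd W u : (fwd f @` (dom f `&` W)) (u, 0) ->
  incl (to_real (bwd f (u, 0))) = bwd f (u, 0).
Proof.
move=> [y [dy Wy] yu]; have cf := std_chart rf.1; rewrite -yu (chart_bwdK cf) //.
by rewrite to_realK //; apply/(rf.2 _ dy); rewrite yu.
Qed.

Lemma continuous_real_part : continuous (fun u : 'rV[R]_n => ((u, 0) : C)).
Proof.
move=> u; have := @continuous_pair _ _ _ id (fun _ : 'rV[R]_n => (0 : 'rV[R]_n)) u.
by apply; [exact: cvg_id|exact: cst_continuous].
Qed.

Lemma slice_open W : open W -> open (fwd (slice f) @` (dom (slice f) `&` incl @^-1` W)).
Proof.
move=> oW.
rewrite (_ : fwd _ @` _ = (fun u : 'rV[R]_n => ((u, 0) : C)) @^-1` (fwd f @` (dom f `&` W))).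
  apply: open_comp; first by move=> u _; exact: continuous_real_part.
  exact: chart_open_image (std_chart rf.1) _ oW.
by apply/seteqP; split=> u /slice_image.
Qed.

Lemma slice_chart : is_chart (slice f).
Proof.
have cf := std_chart rf.1; split.
- by apply: open_comp; [move=> s _; exact: incl_continuous|exact: chart_open_dom].
- by have := slice_open openT; rewrite preimage_setT setIT.
- move=> s ds; apply: (@continuous_comp _ _ _ (fwd f \o incl) fst).
    apply: (@continuous_comp _ _ _ incl (fwd f)); first exact: incl_continuous.
    exact: chart_fwd_cont.
  exact: cvg_fst.
- move=> u; have -> : fwd (slice f) @` dom (slice f) = fwd (slice f) @` (dom (slice f) `&` incl @^-1` setT).
    by rewrite preimage_setT setIT.
  move=> uD; apply: continuous_incl.
  have E : \forall v \near u, (bwd f \o (fun u : 'rV[R]_n => ((u, 0) : C))) v = (incl \o bwd (slice f)) v.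
    have : nbhs u (fwd (slice f) @` (dom (slice f) `&` incl @^-1` setT)).
      by apply: open_nbhs_nbhs; split => //; exact: slice_open openT.
    by apply: filterS => v /slice_image /slice_bwd /= ->.
  have Eu := nbhs_singleton E; apply: cvg_trans; first exact: near_eq_cvg E.
  rewrite -Eu; apply: continuous_comp; first exact: continuous_real_part.
  by have /slice_image := uD; exact: (chart_bwd_cont cf).
- by move=> s ds; apply: incl_inj; rewrite /= -slice_fwd // (chart_bwdK cf) // inclK.
Qed.

(** Between a slice and its real chart the inclusion is [u |-> (u, 0)], so smooth functions on M
    restrict to smooth functions. Both the compatibility of slices and the smoothness of the
    inclusion rest on this. *)
Lemma slice_smooth (V : normedModType R) (h : M -> V) W : fdim V -> open W -> sm h W ->
  smooth_on (h \o incl \o bwd (slice f)) (fwd (slice f) @` (dom (slice f) `&` incl @^-1` W)).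
Proof.
move=> fV oW sh; have oU := slice_open oW; have [cf _ _ _ _] := rf.1.
apply: (@smooth_eq _ _ _ (fun u => (h \o bwd f) ((u, 0) : C))) => //.
  by move=> u /slice_image /slice_bwd /= ->.
apply: (@smooth_comp _ _ _ _ (h \o bwd f) (fun u : 'rV[R]_n => ((u, 0) : C)) _ (fwd f @` (dom f `&` W))) => //.
- exact: fdimC.
- exact: chart_open_image (std_chart rf.1) _ oW.
- by move=> u /slice_image.
- by apply: smooth_pair => //; [exact: smooth_id|exact: smooth_cst].
- exact: (compat_pull cf).
Qed.

End Slice.

Lemma slice_compatible f A f' A' : real_chart f A S -> real_chart f' A' S ->
  compatible (slice f) (slice f').
Proof.
have H g B g' B' : real_chart g B S -> real_chart g' B' S ->
    smooth_on (fwd (slice g') \o bwd (slice g)) (fwd (slice g) @` (dom (slice g) `&` dom (slice g'))).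
  move=> rg rg'; have [cg' _ _ _ _] := rg'.1.
  have od := chart_open_dom cg'.1.
  have := slice_smooth rg (fdimC n) od (compat_sm cg').
  by move=> /(smooth_fst (slice_open rg od)).
by move=> rf rf'; split; [exact: H rf rf'|rewrite setIC; exact: H rf' rf].
Qed.

Definition slice_atlas : set (chart T 'rV[R]_n) :=
  [set b | exists f A, real_chart f A S /\ b = slice f].

Lemma real_points_hausdorff : hausdorff_space T.
Proof.
have := @manifold_hausdorff _ _ M; rewrite !open_hausdorff => H x y xy.
have [|[U V] [Ux Vy] [oU oV UV]] := H (incl x) (incl y).
  by apply: contra xy => /eqP /incl_inj ->.
exists (incl @^-1` U, incl @^-1` V) => /=.
  by move: Ux Vy; rewrite !inE.
split; [by exists U|by exists V|].
apply/eqP/seteqP; split=> s // [Us Vs]; have : (U `&` V) (incl s) by [].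
by move/eqP: UV => ->.
Qed.

Lemma real_points_second_countable : @second_countable T.
Proof.
have [B cB [oB bB]] := @manifold_second_countable _ _ M.
exists [set incl @^-1` U | U in B]; first exact: card_le_trans (card_image_le _ _) cB.
split=> [_ [U BU <-]|s V]; first by exists U => //; exact: oB.
rewrite nbhsE => -[V' [/real_points_openP[W oW <-] Ws] sub].
have : nbhs (incl s) W by exact: open_nbhs_nbhs.
move=> /bB[U [BU Us] UW]; exists (incl @^-1` U) => /=.
  by split => //; exists U.
by move=> t Ut; apply: sub; exact: UW.
Qed.

Lemma slice_cover s : exists2 b, slice_atlas b & dom b s.
Proof.
by have [f [A [rf df]]] := rS (I : setT (incl s)); exists (slice f) => //; exists f, A.
Qed.

Hypothesis connT : connected [set: T].

Definition real_manifold : manifold R n.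
Proof.
apply: (@Manifold R n T slice_atlas) => //.
- exact: real_points_hausdorff.
- exact: real_points_second_countable.
- by exists s0.
- by move=> _ [f [A [rf ->]]]; exact: slice_chart rf.
- exact: slice_cover.
- by move=> _ _ [f [A [rf ->]]] [f' [A' [rf' ->]]]; exact: slice_compatible rf rf'.
Defined.

End RealPoints.

(** * Convexity and vertices of polytopes *)

Section Polytopes.
Context {R : realType} {n : nat}.
Implicit Types (P : set 'rV[R]_n) (v x y : 'rV[R]_n).

Lemma polytope_cvx P : polytope P -> cvx P.
Proof.
move=> [k [V ->]] v v' t /andP[t0 t1] [w [w0 w1 ->]] [w' [w0' w1' ->]].
exists ((1 - t) *: w + t *: w'); split.
- by move=> i; rewrite !mxE addr_ge0 // mulr_ge0 // subr_ge0.
- under eq_bigr do rewrite !mxE.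
  by rewrite big_split /= -!mulr_sumr w1 w1' !mulr1 subrK.
- by rewrite mulmxDl !scalemxAl.
Qed.

Definition dot x y : R := \sum_k x 0 k * y 0 k.

Lemma dot_self_eq0 x : dot x x = 0 -> x = 0.
Proof.
move=> /eqP; rewrite psumr_eq0; last by move=> k _; rewrite -expr2 sqr_ge0.
move=> /allP H; apply/rowP => k; have := H k (mem_index_enum _).
by rewrite implyTb -expr2 sqrf_eq0 mxE => /eqP.
Qed.

Lemma dot_self_ge0 x : 0 <= dot x x.
Proof. by apply: sumr_ge0 => k _; rewrite -expr2 sqr_ge0. Qed.

Lemma dotE x y : dot x y = (x *m y^T) 0 0.
Proof. by rewrite mxE; apply: eq_bigr => k _; rewrite !mxE. Qed.

(* A generating point of maximal norm is a vertex: the linear form [dot v] is at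
   most |v|^2 at the generating points, with equality only at [v]. *)
Lemma polytope_vertex P : polytope P -> P !=set0 -> exists2 v, P v & face P [set v].
Proof.
move=> [k [V ->]] [x0 [w0 [_ s1 _]]].
have [i0] : exists i0 : 'I_k, True.
  case: k V w0 s1 => [|k] V w0 s1; last by exists ord0.
  by move/eqP: s1; rewrite big_ord0 eq_sym oner_eq0.
move=> _; pose N i := dot (row i V) (row i V).
have [i Ni] : exists i, forall j, N j <= N i.
  by case: (@Order.TotalTheory.arg_maxP _ _ _ i0 xpredT N isT) => i _ H; exists i => j; exact: H.
set v := row i V.
have key j : dot (row j V - v) (row j V - v) = N j + N i - 2 * dot (row j V) v.
  rewrite /N /dot -big_split /= mulr_sumr -sumrB; apply: eq_bigr => l _; rewrite !mxE; ring.
have le j : dot (row j V) v <= N i.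
  have := dot_self_ge0 (row j V - v); rewrite key; have := Ni j; lra.
have lin w : dot (w *m V) v = \sum_j w 0 j * dot (row j V) v.
  rewrite dotE -mulmxA mxE; apply: eq_bigr => j _; congr (_ * _).
  by rewrite mxE; apply: eq_bigr => l _; rewrite !mxE.
exists v.
  exists (delta_mx 0 i); split; last by rewrite -rowE.
    by move=> j; rewrite mxE; case: (_ && _).
  by rewrite (bigD1 i) //= big1 ?addr0 ?mxE ?eqxx // => j ji; rewrite mxE (negbTE ji) andbF.
exists v^T, (N i); split.
  move=> _ [w [w_ge0 w1 ->]]; rewrite -dotE lin -[leRHS]mul1r -w1 mulr_suml.
  by apply: ler_sum => j _; rewrite ler_wpM2l.
apply/seteqP; split=> [_ ->|x [[w [w_ge0 w1 xE]] /=]].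
  split; last by rewrite -dotE.
  exists (delta_mx 0 i); split; last by rewrite -rowE.
    by move=> j; rewrite mxE; case: (_ && _).
  by rewrite (bigD1 i) //= big1 ?addr0 ?mxE ?eqxx // => j ji; rewrite mxE (negbTE ji) andbF.
rewrite -dotE xE lin => E.
have : \sum_j w 0 j * (N i - dot (row j V) v) = 0.
  by under eq_bigr do rewrite mulrBr; rewrite sumrB E -mulr_suml w1 mul1r subrr.
move=> /eqP; rewrite psumr_eq0; last by move=> j _; rewrite mulr_ge0 // subr_ge0.
move=> /allP H; rewrite mulmx_sum_row; transitivity (\sum_j w 0 j *: v).
  apply: eq_bigr => j _; have := H j (mem_index_enum _); rewrite implyTb mulf_eq0.
  move=> /orP[/eqP -> |/eqP h]; first by rewrite !scale0r.
  congr (_ *: _); apply/eqP; rewrite -subr_eq0; apply/eqP/dot_self_eq0/le_anti.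
  by rewrite dot_self_ge0 andbT key; have := Ni j; lra.
by rewrite -scaler_suml w1 scale1r.
Qed.

Lemma affine_dim_point v d : affine_dim [set v] d -> d = 0%N.
Proof.
move=> [p [B [-> _ /(_ 0) H <-]]]; apply/eqP; rewrite mxrank_eq0 -submx0; apply: H => x ->.
by rewrite subrr; exact: sub0mx.
Qed.

End Polytopes.

(** * Differentials of the orbit maps *)

Section Orbits.
Context {R : realType} {m n : nat} {M : manifold R m}.
Variables (act : @Cn R n -> M -> M).
Hypotheses (hact : smooth_torus_action act) (ls : locally_standard act).
Local Notation C := (@Cn R n).
Local Notation tact := (tact act).
Local Notation std := (std act).
Implicit Types (f : chart M C) (c : chart M 'rV[R]_m).

Lemma orbit_continuous x : continuous (fun a : 'rV[R]_n => tact a x).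
Proof.
move=> a; have [_ _ H _] := hact.
apply: (@continuous_comp _ _ _ (fun a => (a, x)) (fun p : 'rV[R]_n * M => act (cexp p.1) p.2)).
  apply: (@continuous_pair _ _ _ id (fun=> x)); [exact: cvg_id|exact: cst_continuous].
exact: H.
Qed.

Lemma orbit_differentiable c x a : atlas c -> dom c (tact a x) ->
  differentiable (fwd c \o (fun a : 'rV[R]_n => tact a x)) a.
Proof.
move=> ac dc; have [d ad dx] := atlas_cover x; have cd := atlas_chart ad.
have [_ _ _ /(_ d c ad ac) sa] := hact.
pose B := act_domain act d c.
pose A := [set a | dom c (tact a x)].
have oA : open A.
  apply: (@open_comp _ _ (fun a => tact a x)); last exact: (chart_open_dom (atlas_chart ac)).
  by move=> b _; exact: orbit_continuous.
have oB : open B by exact: open_act_domain.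
have s1 : smooth_on (fun b : 'rV[R]_n => fwd c (act (cexp b) (bwd d (fwd d x)))) A.
  apply: (@smooth_comp _ _ _ _ (fun p : 'rV[R]_n * 'rV[R]_m => fwd c (act (cexp p.1) (bwd d p.2)))
    (fun b => (b, fwd d x)) A B) => //.
  + exact: fdim_prod (fdim_rV _) (fdim_rV _).
  + exact: fdim_rV.
  + by move=> b Ab; split => /=; [exists x|rewrite (chart_bwdK cd)].
  + by apply: smooth_pair => //; [exact: smooth_id|exact: smooth_cst].
by rewrite (chart_bwdK cd) // in s1; exact: smooth_diff s1 _.
Qed.

Definition std_jacobian f c x := jacobian ((fun y => rvec (fwd f y)) \o bwd c) (fwd c x).

Lemma sm_rvec f : compat f -> sm (fun y => rvec (fwd f y)) (dom f).
Proof.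
move=> cf c ac; apply: smooth_rvec; last exact: (compat_sm cf).
exact: chart_open_image (atlas_chart ac) _ (chart_open_dom cf.1).
Qed.

(** The chart turns the orbit map into [a |-> exp (i a A) z], whose differential at 0 is the
    rotation field. *)
Lemma orbit_mx_std f A c x v : std f A -> dom f x -> atlas c -> dom c x ->
  v *m orbit_mx act c x *m std_jacobian f c x = rvec (rot_field (v *m A) (fwd f x)).
Proof.
move=> sf dx ac dcx; have [cf sd ef _ _] := sf.
have t0 : tact 0 x = x by exact: tact0.
pose gamma a : M := tact a x; pose h y := rvec (fwd f y).
have dg0 : dom c (gamma 0) by rewrite /gamma t0.
have df0 : dom f (gamma 0) by rewrite /gamma t0.
have dg := orbit_differentiable ac dg0.
have E := jacobian_sm ac dg0 (chart_open_dom cf.1) df0 (sm_rvec cf) (@orbit_continuous x 0) dg.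
rewrite /gamma t0 in E; rewrite -mulmxA -[X in _ *m X]E.
have Eh : h \o gamma = fun a => rvec (cmul (cexp (a *m A)) (fwd f x)).
  by apply/funext => a; rewrite /h /= /gamma ef.
have sr : smooth_on (fun b : 'rV[R]_n => cmul (cexp (b *m A)) (fwd f x)) setT.
  apply: smooth_cmul; [exact: openT| |exact: smooth_cst].
  apply: smooth_cexp; first exact: openT.
  apply: smooth_mx => [|i j]; first exact: openT.
  under eq_fun do rewrite mxE; apply: smooth_sum => [|k _]; first exact: openT.
  apply: smoothM; [exact: openT| |exact: smooth_cst].
  by apply: smooth_coord; [exact: openT|exact: smooth_id].
have dr : differentiable (fun b : 'rV[R]_n => rvec (cmul (cexp (b *m A)) (fwd f x))) 0.
  exact: (smooth_diff (smooth_rvec openT sr) I).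
rewrite -/h -/gamma [X in jacobian X]Eh -deriveEjacobian //.
rewrite (@derive_comp_linear _ _ _ _ (@rvec R n)); last exact: (smooth_diff sr I).
- congr rvec; have := @is_derive_line R _ _ (fun b : 'rV[R]_n => cmul (cexp (b *m A)) (fwd f x)) 0 v (0 : R).
  rewrite scale0r addr0 => /(_ (smooth_diff sr I)) [_ <-].
  have [_ h'] := is_derive_rot (v *m A) (fwd f x); apply: etrans h'.
  have -> // : (fun t : R => cmul (cexp ((0 + t *: v) *m A)) (fwd f x)) =
    fun t : R => cmul (cexp (t *: (v *m A))) (fwd f x).
  by apply/funext => t; rewrite add0r scalemxAl.
- exact: rvec_linear.
- exact: continuous_rvec.
Qed.

(** A change of charts multiplies the matrix by a Jacobian on the right, which cannot increase the
    rank; exchanging the charts gives equality. *)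
Lemma orbit_dim_exists x : exists k, orbit_dim act x k.
Proof.
have [c0 ac0 dc0] := atlas_cover x; exists (\rank (orbit_mx act c0 x)) => d0 ad0 dd0.
have H c d : atlas c -> atlas d -> dom c x -> dom d x ->
    (\rank (orbit_mx act d x) <= \rank (orbit_mx act c x))%N.
  move=> ac ad dc dd; have t0 : tact 0 x = x by exact: tact0.
  have dc' : dom c (tact 0 x) by rewrite t0.
  have dd' : dom d (tact 0 x) by rewrite t0.
  have -> : orbit_mx act d x = jacobian (fwd d \o (fun a : 'rV[R]_n => tact a x)) 0 by [].
  rewrite (jacobian_sm ac dc' (chart_open_dom (atlas_chart ad)) dd' (sm_id ad)
    (@orbit_continuous x 0) (orbit_differentiable ac dc')).
  exact: mxrankM_maxl.
by apply: anti_leq; apply/andP; split; [exact: H|exact: H].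
Qed.

(** If the differential of the orbit map is zero, so are all rotation fields at the image of [x].
    The rotation of the coordinate [k] alone has velocity zero only if that coordinate is zero, and
    the origin of C^n is fixed. *)
Lemma fixed_point x : orbit_dim act x 0 -> forall a, tact a x = x.
Proof.
move=> H a; have [f [A [sf dx]]] := std_exists x ls; have [c ac dc] := atlas_cover x.
have o0 : orbit_mx act c x = 0 by apply/eqP; rewrite -mxrank_eq0 (H c ac dc).
have [cf sd ef Au _] := sf; apply/(std_eq a sf dx dx).
have z0 k : (fwd f x).1 0 k = 0 /\ (fwd f x).2 0 k = 0.
  have := orbit_mx_std (delta_mx 0 k *m invmx A) sf dx ac dc.
  rewrite o0 mulmx0 mul0mx mulmxKV // => /(congr1 (@cvec R n)); rewrite rvecK => E.
  have := congr1 (fun z : C => z.1 0 k) E; have := congr1 (fun z : C => z.2 0 k) E.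
  by rewrite /= !mxE !eqxx !mul1r => /esym -> /esym/eqP; rewrite oppr_eq0 => /eqP ->.
by apply: Cn_eq => k; rewrite ?cmul1 ?cmul2; have [-> ->] := z0 k; rewrite !mulr0 ?subr0 ?addr0.
Qed.

End Orbits.

(** * Connectedness of the real points *)

Section Connectedness.
Context {R : realType} {m n : nat} {M : manifold R m}.
Variables (act : @Cn R n -> M -> M) (S : set M) (proj : M -> 'rV[R]_n).
Hypotheses (hact : smooth_torus_action act) (cM : compact [set: M])
  (ls : locally_standard act) (rS : real_str act S setT) (cproj : continuous proj)
  (oproj : forall U, open U -> exists2 V, open V & proj @` U = range proj `&` V)
  (fproj : forall x y, proj x = proj y <-> same_orbit act x y).
Local Notation C := (@Cn R n).
Local Notation tact := (tact act).
Implicit Types (f : chart M C) (z w : C).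

Lemma real_closed : closed S.
Proof.
rewrite -[S]setCK; apply: open_closedC; rewrite openE => y Sy; have [f [A [rf dy]]] := rS (I : setT y).
have cf := std_chart rf.1.
have nb : nbhs y (dom f `&` fwd f @^-1` [set z | z.2 != 0]).
  apply: open_nbhs_nbhs; split; last first.
    by split => //=; apply/eqP => z2; apply: Sy; apply/(rf.2 _ dy).
  apply: open_setI_preimage; [exact: (chart_open_dom cf)|by move=> x; exact: (chart_fwd_cont cf)|].
  apply: (@open_comp _ _ snd [set v : 'rV[R]_n | v != 0]); first by move=> z _; exact: cvg_snd.
  rewrite (_ : [set v | _] = ~` [set 0]); last by apply/seteqP; split=> v /eqP.
  by apply: closed_openC; apply: accessible_closed_set1; apply: hausdorff_accessible; exact: norm_hausdorff.
by apply: filterS nb => x [dx /eqP x2] Sx; apply: x2; apply/(rf.2 _ dx).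
Qed.

Lemma mod2_orbit z w : (forall k, mod2 z k = mod2 w k) -> exists a, cmul (cexp a) z = w.
Proof.
move=> H; have [a [za2 za1]] := nneg_rot z; have [b [wb2 wb1]] := nneg_rot w.
have E : cmul (cexp a) z = cmul (cexp b) w.
  apply: Cn_eq => k; last by rewrite za2 wb2.
  apply/eqP; rewrite -(@eqrXn2 _ 2 _ _ _ (za1 k) (wb1 k)) //.
  by rewrite -!mod2_real // !mod2_rot H.
by exists (- b + a); rewrite cexpD -cmulA E cexpNK.
Qed.

Lemma sqrt_close (p q : R) : 0 <= p -> 0 <= q -> (Num.sqrt p - Num.sqrt q) ^+ 2 <= `|p - q|.
Proof.
move=> p0 q0; rewrite -{2}(sqr_sqrtr p0) -{2}(sqr_sqrtr q0).
move: (sqrtr_ge0 p) (sqrtr_ge0 q); move: (Num.sqrt p) (Num.sqrt q) => s t s0 t0.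
have [st|ts] := leP s t.
  by rewrite ler0_norm; [|nra]; nra.
by rewrite gtr0_norm; [|nra]; nra.
Qed.

(* A point with moduli close to those of a real point [r] is in the orbit of the
   real point with the same moduli and the signs of [r]. *)
Lemma real_nearby (W : set M) x : open W -> W x -> S x ->
  exists U, [/\ open U, U x & forall y, U y -> exists a, S (tact a y) /\ W (tact a y)].
Proof.
move=> oW Wx Sx; have [f [A [rf dx]]] := rS (I : setT x).
have [cf sd ef Au _] := rf.1; set r := fwd f x.
have r2 : r.2 = 0 by apply/(rf.2 _ dx).
pose Z := fwd f @` (dom f `&` W).
have oZ : open Z by apply: chart_open_image oW; exact: cf.1.
have [e e0 He] : exists2 e : R, 0 < e & forall w, (forall k, `|w.1 0 k - r.1 0 k| < e) -> w.2 = 0 -> Z w.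
  have /nbhs_ballP[e /= e0 He] : nbhs r Z by apply: open_nbhs_nbhs; split => //; exists x.
  exists e => // w w1 w2; apply: He; apply: Cn_ball => // k; first by rewrite distrC.
  by rewrite r2 w2 subrr normr0.
exists (dom f `&` fwd f @^-1` [set z | forall k, `|mod2 z k - mod2 r k| < e ^+ 2]); split.
- apply: open_setI_preimage; [exact: (chart_open_dom cf.1)|by move=> y; exact: (chart_fwd_cont cf.1)|].
  exact: open_moduli.
- by split => //= k; rewrite subrr normr0 exprn_gt0.
move=> y [dy /= Hy]; set z := fwd f y in Hy.
pose s k : R := if r.1 0 k < 0 then -1 else 1.
have s2 k : s k ^+ 2 = 1 by rewrite /s; case: ifP => _; rewrite ?sqrrN expr1n.
pose w : C := (\row_k (s k * Num.sqrt (mod2 z k)), 0).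
have rE k : r.1 0 k = s k * Num.sqrt (mod2 r k).
  rewrite (mod2_real k r2) sqrtr_sqr /s; case: ltP => h.
    by rewrite ltr0_norm // mulN1r opprK.
  by rewrite ger0_norm // mul1r.
have [|a aE] := @mod2_orbit z w.
  by move=> k; rewrite [RHS]mod2_real // mxE exprMn s2 mul1r sqr_sqrtr // mod2_ge0.
have [|//|y' [dy' Wy'] y'E] := He w.
  move=> k; rewrite mxE rE -mulrBr normrM.
  have -> : `|s k| = 1 by rewrite /s; case: ifP => _; rewrite ?normrN normr1.
  rewrite mul1r -(@ltr_pXn2r _ 2) ?nnegrE ?normr_ge0 ?ltW // real_normK ?num_real //.
  by apply: le_lt_trans (Hy k); apply: sqrt_close; exact: mod2_ge0.
exists (a *m invmx A); have dt : dom f (tact (a *m invmx A) y) by exact: sd.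
have -> : tact (a *m invmx A) y = y'.
  by apply: (std_inj rf.1) => //; rewrite ef // mulmxKV // -/z aE.
by split => //; apply/(rf.2 _ dy'); rewrite y'E.
Qed.

(** [U] is the union of all open sets whose points can be moved by the torus into [S] and [W] at
    once. It contains the points of [S] in [W] by [real_nearby] and has the same image as these, so
    the openness of [proj] applies. *)
Lemma proj_real_open W : open W -> exists2 V, open V & proj @` (S `&` W) = range proj `&` V.
Proof.
move=> oW; pose U := \bigcup_(U in [set U | open U /\ forall y, U y -> exists a, S (tact a y) /\ W (tact a y)]) U.
have oU : open U by apply: bigcup_open => U' [].
have [V oV E] := oproj oU; exists V => //; rewrite -E.
apply/seteqP; split=> [_ [y [Sy Wy] <-]|_ [y [U' [_ H] /H[a [Sa Wa]]] <-]].
  exists y => //; have [U' [oU' U'y H]] := real_nearby oW Wy Sy.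
  by exists U'.
by exists (tact a y) => //; exact: (proj_tact fproj).
Qed.

Hypothesis fixed : exists x, forall a, tact a x = x.

Lemma real_points_connected : connected [set: real_points S].
Proof.
move=> B [s Bs] [B1 [W oW WB] BE] [B2 clB2 BE2].
rewrite !setTI in BE BE2; subst B1 B2; apply: contrapT => BT.
have [t Bt] : exists t, ~ B t.
  by apply: contrapT => H; apply: BT; apply/seteqP; split=> // t _; apply: contrapT => nt; apply: H; exists t.
have /real_points_openP[W' oW' W'B] : open (~` B) by exact: closed_openC.
(* [W] and [W'] are open in M and cut out complementary parts of [S], though they may meet outside
   [S]. *)
have WB' u : W (incl u) <-> B u by have -> := congr1 (fun X : set _ => X u) BE.
have W'B' u : W' (incl u) <-> ~ B u.
  by have := congr1 (fun X => X u) W'B => /= ->.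
(* On [S] the set [X] is also the complement of the open [Y], so its part of [S] is compact and has
   a closed image. The range is connected as the image of M. *)
have key (X Y : set M) : open X -> open Y -> (forall y, S y -> X y <-> ~ Y y) ->
    (exists2 y, S y & X y) -> proj @` (S `&` X) = range proj.
  move=> oX oY XY [y Sy Xy].
  have cP : connected (range proj).
    apply: connected_continuous_connected; first exact: manifold_connected.
    exact: continuous_subspaceT.
  apply: cP; first by exists (proj y); exists y.
    exact: proj_real_open.
  exists (proj @` (S `&` X)); last by apply/seteqP; split=> [_ [u Hu <-]|u []//]; split; [exists u|exists u].
  apply: compact_closed; first exact: norm_hausdorff.
  apply: continuous_compact; first exact: continuous_subspaceT.
  have -> : S `&` X = S `&` ~` Y by apply/seteqP; split=> u [Su /(XY u Su)].
  apply: (subclosed_compact _ cM) => //.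
  by apply: closedI; [exact: real_closed|exact: open_closedC].
have incl_to y : S y -> exists u : real_points S, incl u = y.
  by move=> Sy; exists (SigSub (mem_set Sy)).
have XY y : S y -> W y <-> ~ W' y.
  move=> /incl_to[u <-]; rewrite WB' W'B'; split=> [h|/contrapT //]; exact.
have YX y : S y -> W' y <-> ~ W y.
  by move=> /incl_to[u <-]; rewrite WB' W'B'.
have E1 : proj @` (S `&` W) = range proj.
  by apply: (key W W') => //; exists (incl s); [exact: incl_in|exact/WB'].
have E2 : proj @` (S `&` W') = range proj.
  by apply: (key W' W) => //; exists (incl t); [exact: incl_in|exact/W'B'].
have [x fx] := fixed.
have over y : proj y = proj x -> y = x.
  by move=> /esym/fproj/(same_orbitP act x)[a ->]; exact: fx.
have : range proj (proj x) by exists x.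
rewrite -{1}E1 => -[y [Sy Wy] /over yx].
have : range proj (proj x) by exists x.
rewrite -{1}E2 => -[y' [Sy' Wy'] /over yx'].
by have /(XY y' Sy') : W y' by rewrite yx' -yx.
Qed.

End Connectedness.

(** * The metric *)

Section InvariantMetric.
Context {R : realType} {m n : nat} {M : manifold R m}.
Variables (act : @Cn R n -> M -> M).
Hypotheses (hact : smooth_torus_action act).
Local Notation C := (@Cn R n).
Local Notation tact := (tact act).
Local Notation std := (std act).
Local Notation J := std_jacobian.
Implicit Types (f : chart M C) (c d : chart M 'rV[R]_m).

Lemma chart_bwd_cont1 c x : atlas c -> dom c x -> {for fwd c x, continuous (bwd c)}.
Proof. by move=> ac dx; have [_ _ _ H _] := atlas_chart ac; apply: H; exists x. Qed.

Lemma std_jacobian_change f c d x : compat f -> dom f x -> atlas c -> atlas d ->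
  dom c x -> dom d x -> J f c x = tangent_mx c d id x *m J f d x.
Proof.
move=> cf dx ac ad dcx ddx; have cc := atlas_chart ac.
have xE : bwd c (fwd c x) = x by exact: (chart_bwdK cc).
have dd' : dom d (bwd c (fwd c x)) by rewrite xE.
have df' : dom f (bwd c (fwd c x)) by rewrite xE.
have ds : differentiable (fwd d \o bwd c) (fwd c x).
  by apply: smooth_diff (sm_id ad ac) _; exists x.
have := jacobian_sm ad dd' (chart_open_dom cf.1) df' (sm_rvec cf) (chart_bwd_cont1 ac dcx) ds.
by rewrite xE.
Qed.

(** The chart [f] has a smooth inverse, so the identity matrix factors through [J f c x]. Positivity
    of the metric comes from here. *)
Lemma std_jacobian_inj f c x (v : 'rV[R]_m) : compat f -> dom f x -> atlas c -> dom c x ->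
  v *m J f c x = 0 -> v = 0.
Proof.
move=> cf dx ac dcx; have cc := atlas_chart ac; have ocd := chart_open_dom cc.
have xE : bwd c (fwd c x) = x by exact: (chart_bwdK cc).
pose F := (fun y => rvec (fwd f y)) \o bwd c.
pose B := @cvec R n @^-1` (fwd f @` (dom f `&` dom c)).
pose G v := fwd c (bwd f (cvec v)).
have sF : differentiable F (fwd c x).
  by apply: smooth_diff (sm_rvec cf ac) _; exists x.
have oT := @openT 'rV[R]_(n + n).
have sc : smooth_on (@cvec R n) setT.
  by apply: (@smooth_cvec _ _ _ id) => //; exact: smooth_id.
have oB : open B.
  apply: (@open_comp _ _ (@cvec R n)); first by move=> w _; exact: (smooth_cont sc I).
  exact: chart_open_image cf.1 _ ocd.
have Bx : B (F (fwd c x)).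
  have -> : F (fwd c x) = rvec (fwd f x) by rewrite /F /= xE.
  by rewrite /B /preimage /= rvecK; exists x.
have sG : smooth_on G B.
  apply: (@smooth_comp _ _ _ _ (fwd c \o bwd f) (@cvec R n) B (fwd f @` (dom f `&` dom c))) => //.
  - exact: fdimC.
  - exact: fdim_rV.
  - exact: chart_open_image cf.1 _ ocd.
  - exact: smooth_sub sc.
  - exact: (compat_pull cf (fdim_rV m) ocd (sm_id ac)).
have dG := smooth_diff sG Bx.
have dGF := @differentiable_comp _ _ _ _ F G _ sF dG.
have E : \forall u \near fwd c x, G (F u) = u.
  have : nbhs (fwd c x) (fwd c @` (dom c `&` dom f)).
    apply: open_nbhs_nbhs; split; last by exists x.
    exact: chart_open_image cc _ (chart_open_dom cf.1).
  apply: filterS => _ [y [dcy dfy] <-].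
  by rewrite /F /G /= (chart_bwdK cc) // rvecK (chart_bwdK cf.1).
have := jacobian_near E dGF; rewrite (jacobian_comp sF dG) => K v0.
have id1 : v *m jacobian id (fwd c x) = v.
  by apply: (@jacobian_linear _ _ _ id) => // w; exact: cvg_id.
by rewrite -id1 -K mulmxA -/(J f c x) v0 mul0mx.
Qed.

Lemma cvecK : cancel (@cvec R n) (@rvec R n).
Proof. by move=> v; exact: hsubmxK. Qed.

Lemma rvec_dot (z w : C) : rvec z *m (rvec w)^T = z.1 *m w.1^T + z.2 *m w.2^T.
Proof. by rewrite /rvec tr_row_mx mul_row_col. Qed.

Lemma rvec_rot b (z w : C) :
  rvec (cmul (cexp b) z) *m (rvec (cmul (cexp b) w))^T = rvec z *m (rvec w)^T.
Proof.
rewrite !rvec_dot; apply/rowP => i; rewrite !mxE -!big_split /=; apply: eq_bigr => k _.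
rewrite !mxE (ord1 i).
have := cos2Dsin2 (b 0 k); move: (cos _) (sin _) => p q pq.
transitivity ((p ^+ 2 + q ^+ 2) * (z.1 0 k * w.1 0 k + z.2 0 k * w.2 0 k)); first by ring.
by rewrite pq mul1r.
Qed.

Lemma mx_dot_eq p q (A B : 'M[R]_(p, q)) :
  (forall v w : 'rV[R]_p, (v *m A) *m (w *m A)^T = (v *m B) *m (w *m B)^T) -> A *m A^T = B *m B^T.
Proof.
move=> H; apply/matrixP => i j; have := H (delta_mx 0 i) (delta_mx 0 j).
rewrite !trmx_mul !mulmxA -(mulmxA _ A) -(mulmxA _ B) trmx_delta -!rowE -!colE.
by move/matrixP/(_ 0 0); rewrite !mxE.
Qed.

Definition rot_row b (v : 'rV[R]_(n + n)) : 'rV[R]_(n + n) := rvec (cmul (cexp b) (cvec v)).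

Lemma smooth_rot b : smooth_on (rot_row b) setT.
Proof.
apply: smooth_rvec; first exact: openT.
apply: smooth_cmul; [exact: openT|exact: smooth_cst|].
by apply: smooth_cvec; [exact: openT|exact: smooth_id].
Qed.

Lemma rot_linear b : linear (rot_row b).
Proof.
move=> t v w; rewrite /rot_row -rvec_linear; congr rvec.
by apply: Cn_eq => k; rewrite !mxE; ring.
Qed.

Lemma jacobian_rot b u v :
  v *m jacobian (rot_row b) u = rot_row b v.
Proof.
apply: (jacobian_linear u v (rot_linear b)) => w.
exact: (smooth_cont (smooth_rot b) I).
Qed.

(** In the chart [f] the torus element acts by the linear map [rot_row], which is orthogonal and its
    own differential. So the action changes the Jacobian by an orthogonal factor, which cancels in
    [J J^T]. *)
Lemma std_jacobian_act f A c d a x : std f A -> dom f x -> atlas c -> atlas d ->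
  dom c x -> dom d (tact a x) ->
  exists O : 'M[R]_(n + n), O *m O^T = 1%:M /\
    tangent_mx c d (tact a) x *m J f d (tact a x) = J f c x *m O.
Proof.
move=> sf dx ac ad dcx ddx; have cc := atlas_chart ac; have [cf sd ef _ _] := sf.
have xE : bwd c (fwd c x) = x by exact: (chart_bwdK cc).
pose gamma := tact a \o bwd c.
have dd' : dom d (gamma (fwd c x)) by rewrite /gamma /= xE.
have df' : dom f (gamma (fwd c x)) by rewrite /gamma /= xE; exact: sd.
have oU : open (setT `&` [set y | dom d (tact a y)]).
  rewrite setTI; apply: (@open_comp _ _ (tact a)); first by move=> y _; exact: tact_cont1.
  exact: chart_open_dom (atlas_chart ad).
have sa : sm (fun y => fwd d (tact a y)) (setT `&` [set y | dom d (tact a y)]).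
  apply: (sm_tact hact (eta := fun=> a) (u := fwd d)); [exact: fdim_rV|exact: openT| | |exact: sm_id].
    exact: chart_open_dom (atlas_chart ad).
  by move=> e ae; exact: smooth_cst.
have ds : differentiable (fwd d \o gamma) (fwd c x).
  by apply: smooth_diff (sa c ac) _; exists x.
have cg : {for fwd c x, continuous gamma}.
  apply: continuous_comp; first exact: chart_bwd_cont1.
  exact: tact_cont1.
have E := jacobian_sm ad dd' (chart_open_dom cf.1) df' (sm_rvec cf) cg ds.
pose F := (fun y => rvec (fwd f y)) \o bwd c.
have dF : differentiable F (fwd c x) by apply: smooth_diff (sm_rvec cf ac) _; exists x.
pose Q := rot_row (a *m A).
have dQ v : differentiable Q v by exact: (smooth_diff (smooth_rot _) I).
have near : \forall u \near fwd c x, Q (F u) = ((fun y => rvec (fwd f y)) \o gamma) u.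
  have : nbhs (fwd c x) (fwd c @` (dom c `&` dom f)).
    apply: open_nbhs_nbhs; split; last by exists x.
    exact: chart_open_image cc _ (chart_open_dom cf.1).
  apply: filterS => _ [y [dcy dfy] <-].
  by rewrite /Q /rot_row /F /gamma /= (chart_bwdK cc) // rvecK ef.
have := jacobian_near near (@differentiable_comp _ _ _ _ F Q _ dF (dQ _)).
rewrite (jacobian_comp dF (dQ _)) E => E2.
exists (jacobian Q (F (fwd c x))); split.
  rewrite -[RHS](mulmx1 1%:M) -{2}trmx1; apply: mx_dot_eq => v w.
  by rewrite !jacobian_rot /rot_row rvec_rot !mulmx1 !cvecK.
have gE : gamma (fwd c x) = tact a x by rewrite /gamma /= xE.
by rewrite gE in E2; exact: (esym E2).
Qed.

Variables (N : nat) (f : 'I_N -> chart M C) (A : 'I_N -> 'M[R]_n)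
  (phi : 'I_N -> M -> R) (O : 'I_N -> set M).
Hypotheses (sf : forall i, std (f i) (A i))
  (bf : forall i, bump act (f i) (phi i) (O i))
  (pos : forall x, exists i, 0 < phi i x).

(** [J J^T] is the Gram matrix of the pulled back flat metric. Outside [dom (f i)] the Jacobian is
    meaningless, but its weight is zero. *)
Definition pullback_metric c x : 'M[R]_m :=
  \sum_i phi i x *: (J (f i) c x *m (J (f i) c x)^T).

Let cf i : compat (f i). Proof. by case: (sf i). Qed.

Let phi0 i x : phi i x != 0 -> dom (f i) x.
Proof.
by have [_ _ H h] := bf i; have [//|/h ->] := H x; rewrite eqxx.
Qed.

Lemma pullback_eq T1 (B : 'I_N -> 'M[R]_(T1, n + n)) (B' : 'I_N -> 'M[R]_(T1, n + n)) x :
  (forall i, dom (f i) x -> B i *m (B i)^T = B' i *m (B' i)^T) ->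
  \sum_i phi i x *: (B i *m (B i)^T) = \sum_i phi i x *: (B' i *m (B' i)^T).
Proof.
move=> H; apply: eq_bigr => i _; have [->|/phi0 dx] := eqVneq (phi i x) 0.
  by rewrite !scale0r.
by rewrite H.
Qed.

Lemma pullback_conj p (T1 : 'M[R]_(p, m)) c x :
  T1 *m pullback_metric c x *m T1^T =
  \sum_i phi i x *: ((T1 *m J (f i) c x) *m (T1 *m J (f i) c x)^T).
Proof.
rewrite mulmx_sumr mulmx_suml; apply: eq_bigr => i _.
by rewrite -scalemxAr -scalemxAl trmx_mul !mulmxA.
Qed.

Lemma pullback_riemannian : riemannian_metric pullback_metric.
Proof.
split.
- move=> c x _ _; rewrite /pullback_metric raddf_sum; apply: eq_bigr => i _ /=.
  by rewrite linearZ /= trmx_mul trmxK.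
- move=> c x v ac dx v0; rewrite pullback_conj summxE.
  have sq (w : 'rV[R]_(n + n)) : (w *m w^T) 0 0 = dot w w by rewrite dotE.
  have [i pi] := pos x; rewrite (bigD1 i) //=; apply: ltr_pwDl.
    rewrite mxE sq mulr_gt0 // lt_neqAle dot_self_ge0 andbT eq_sym.
    apply: contra v0 => /eqP /dot_self_eq0 E; apply/eqP.
    by apply: std_jacobian_inj E => //; apply: phi0; rewrite gt_eqF.
  apply: sumr_ge0 => j _; rewrite mxE sq mulr_ge0 ?dot_self_ge0 //.
  by have [[_ _ h] _ _ _] := bf j.
- move=> c ac; have cc := atlas_chart ac.
  have oc : open (fwd c @` dom c) by case: cc.
  apply: smooth_mx => // p q; rewrite /pullback_metric /comp.
  under eq_fun do rewrite summxE.
  apply: smooth_sum => // i _; under eq_fun do rewrite mxE.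
  have [[sp _ _] oO cov zO] := bf i.
  (* On [O i] the weight is identically zero; on [dom (f i)] the entries of the Jacobian are
     derivatives of a smooth function. These two open sets cover M. *)
  apply: smooth_loc => _ [x dx <-]; have [dfx|Ox] := cov x; last first.
    exists (fwd c @` (dom c `&` O i)); first by exists x.
    apply: (@smooth_eq _ _ _ (fun=> 0)); last exact: smooth_cst.
      exact: chart_open_image cc _ oO.
    by move=> _ [y [dy Oy] <-]; rewrite (chart_bwdK cc) // zO // mul0r.
  pose B := fwd c @` (dom c `&` dom (f i)); exists B; first by exists x.
  have oB : open B by exact: chart_open_image cc _ (chart_open_dom (cf i).1).
  apply: smoothM => //.
    by apply: smooth_sub (sp c ac) => _ [y [dy _] <-]; exists y.
  under eq_fun do rewrite mxE; apply: smooth_sum => // k _.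
  have sJ r s : smooth_on (fun u => J (f i) c (bwd c u) r s) B.
    have sF : smooth_on ((fun y => rvec (fwd (f i) y)) \o bwd c) B by exact: (sm_rvec (cf i) ac).
    apply: (@smooth_eq _ _ _ (fun u => ('D_(delta_mx 0 r) ((fun y => rvec (fwd (f i) y)) \o bwd c) u) 0 s)) => //.
      move=> u Bu; rewrite (deriveEjacobian _ (smooth_diff sF Bu)) -rowE mxE /J /std_jacobian.
      by rewrite (chart_fwdK cc Bu).
    by apply: smooth_coord => //; exact: smooth_derive.
  by apply: smoothM => //; under eq_fun do rewrite mxE; exact: sJ.
- move=> c d x ac ad dc dd; rewrite pullback_conj; apply: pullback_eq => i dx.
  by rewrite (std_jacobian_change (cf i) dx ac ad dc dd).
Qed.

Lemma pullback_isometric t : torus t -> isometric pullback_metric (act t).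
Proof.
move=> /torusP[a ->] c d x ac ad dc dd; rewrite pullback_conj.
have -> : \sum_i phi i (act (cexp a) x) *: ((tangent_mx c d (act (cexp a)) x *m J (f i) d (act (cexp a) x)) *m
    (tangent_mx c d (act (cexp a)) x *m J (f i) d (act (cexp a) x))^T) =
  \sum_i phi i x *: ((tangent_mx c d (tact a) x *m J (f i) d (tact a x)) *m
    (tangent_mx c d (tact a) x *m J (f i) d (tact a x))^T).
  by apply: eq_bigr => i _; have [[_ h _] _ _ _] := bf i; rewrite -[act _ x]/(tact a x) h.
apply: pullback_eq => i dx.
have [Q [QQ ->]] := std_jacobian_act (sf i) dx ac ad dc dd.
by rewrite trmx_mul mulmxA -(mulmxA (J _ _ _)) QQ mulmx1.
Qed.

End InvariantMetric.

Lemma mulmx_orthogonal (R : realType) p q n1 n2 (A : 'M[R]_(p, n1 + n2)) (B : 'M[R]_(q, n1 + n2)) :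
  rsubmx A = 0 -> lsubmx B = 0 -> A *m B^T = 0.
Proof.
move=> A0 B0; rewrite -[A]hsubmxK A0 -[B]hsubmxK B0 tr_row_mx mul_row_col.
by rewrite trmx0 mulmx0 mul0mx addr0.
Qed.

(** * Orthogonality of the real points to the orbits *)

Section RealSection.
Context {R : realType} {m n : nat} {M : manifold R m}.
Variables (act : @Cn R n -> M -> M) (S : set M).
Hypotheses (hact : smooth_torus_action act) (ls : locally_standard act)
  (rS : real_str act S setT).
Variable s0 : real_points S.
Hypothesis connT : connected [set: real_points S].
Local Notation C := (@Cn R n).
Local Notation J := std_jacobian.
Local Notation Sigma := (real_manifold rS s0 connT).
Local Notation iota := (@incl R m M S : Sigma -> M).
Implicit Types (f : chart M C) (c : chart M 'rV[R]_m).

Lemma incl_differentiable (b : chart Sigma 'rV[R]_n) c s : atlas b -> atlas c ->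
  dom b s -> dom c (iota s) -> differentiable (fwd c \o (iota \o bwd b)) (fwd b s).
Proof.
move=> [f [A [rf ->]]] ac db dc.
have := slice_smooth s0 rf (fdim_rV m) (chart_open_dom (atlas_chart ac)) (sm_id ac).
by move/smooth_diff; apply; exists s.
Qed.

Lemma incl_bwd_continuous (b : chart Sigma 'rV[R]_n) s : atlas b -> dom b s ->
  {for fwd b s, continuous (iota \o bwd b)}.
Proof.
move=> ab db; apply: continuous_comp; last exact: incl_continuous.
by have [_ _ _ H _] := atlas_chart ab; apply: H; exists s.
Qed.

Lemma tangent_std_jacobian (b : chart Sigma 'rV[R]_n) c s f A : atlas b -> atlas c ->
  dom b s -> dom c (iota s) -> std act f A -> dom f (iota s) ->
  tangent_mx b c iota s *m J f c (iota s) =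
  jacobian ((fun y => rvec (fwd f y)) \o (iota \o bwd b)) (fwd b s).
Proof.
move=> ab ac db dc sf df; have [cf _ _ _ _] := sf.
have sE : bwd b (fwd b s) = s by exact: (chart_bwdK (atlas_chart ab)).
have dc' : dom c ((iota \o bwd b) (fwd b s)) by rewrite /= sE.
have df' : dom f ((iota \o bwd b) (fwd b s)) by rewrite /= sE.
have := jacobian_sm ac dc' (chart_open_dom cf.1) df' (sm_rvec cf)
  (incl_bwd_continuous ab db) (incl_differentiable ab ac db dc).
by rewrite /= sE => ->.
Qed.

(** The linear injection [u |-> (u, 0)], which is the inclusion in a slice and its real chart, has a
    differential that factors through the tangent map; so the latter is injective. *)
Lemma incl_immersion : injective_immersion iota.
Proof.
split; first split; first exact: incl_continuous.
- move=> b c [f [A [rf ->]]] ac.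
  exact: (slice_smooth s0 rf (fdim_rV m) (chart_open_dom (atlas_chart ac)) (sm_id ac)).
- exact: incl_inj.
move=> s b c ab ac db dc; apply: inj_row_free => v v0.
have [f [A [rf bE]]] := ab.
have df : dom f (iota s) by move: db; rewrite bE.
have := tangent_std_jacobian ab ac db dc rf.1 df.
pose L (u : 'rV[R]_n) : 'rV[R]_(n + n) := rvec (u, 0).
have sL : smooth_on L setT.
  apply: smooth_rvec; first exact: openT.
  by apply: smooth_pair; [exact: openT|exact: smooth_id|exact: smooth_cst].
have lL : linear L by move=> t u w; rewrite /L -rvec_linear; congr rvec; rewrite -[RHS]/(t *: u + w, t *: 0 + 0) scaler0 addr0.
have near : \forall u \near fwd b s, L u = ((fun y => rvec (fwd f y)) \o (iota \o bwd b)) u.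
  have : nbhs (fwd b s) (fwd b @` dom b).
    apply: open_nbhs_nbhs; split; last by exists s.
    by case: (atlas_chart ab).
  rewrite bE; apply: filterS => _ [s' ds' <-].
  by rewrite /L /= -(slice_fwd rf ds') (chart_bwdK (std_chart rf.1)) // to_realK //; exact: incl_in.
rewrite -(jacobian_near near (smooth_diff sL I)) => E.
have : L v = 0.
  have cL : continuous L by move=> u; exact: (smooth_cont sL I).
  by rewrite -(jacobian_linear (fwd b s) v lL cL) -E mulmxA v0 mul0mx.
by move/(congr1 (@cvec R n)); rewrite rvecK => /(congr1 fst) /= ->; apply/rowP => k; rewrite !mxE.
Qed.

(** The imaginary coordinates of [f] vanish along [S], hence so do their derivatives along [Sigma].
    Here [f] is any real chart at the point, not only the one underlying [b], since every summand of
    the metric is concerned. *)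
Lemma tangent_real (b : chart Sigma 'rV[R]_n) c s f A : atlas b -> atlas c ->
  dom b s -> dom c (iota s) -> real_chart act f A S -> dom f (iota s) ->
  rsubmx (tangent_mx b c iota s *m J f c (iota s)) = 0.
Proof.
move=> ab ac db dc rf df; rewrite (tangent_std_jacobian ab ac db dc rf.1 df).
have [cf _ _ _ _] := rf.1; have cb := atlas_chart ab.
set H := (X in jacobian X _).
have dH : differentiable H (fwd b s).
  have [g [B [rg bE]]] := ab; rewrite /H bE.
  have := slice_smooth s0 rg (fdim_rV (n + n)) (chart_open_dom cf.1) (sm_rvec cf).
  by move/smooth_diff; apply; exists s => //; split => //; move: db; rewrite bE.
apply/matrixP => r k; rewrite mxE [RHS]mxE.
have -> : jacobian H (fwd b s) r (rshift n k) = ('D_(delta_mx 0 r) H (fwd b s)) 0 (rshift n k).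
  by rewrite (deriveEjacobian _ dH) -rowE [RHS]mxE.
have E : \forall u \near fwd b s, H u 0 (rshift n k) = 0.
  have oD : open (dom b `&` iota @^-1` dom f).
    apply: openI; first exact: chart_open_dom.
    by apply: open_comp; [move=> u _; exact: incl_continuous|exact: (chart_open_dom cf.1)].
  have : nbhs (fwd b s) (fwd b @` (dom b `&` (dom b `&` iota @^-1` dom f))).
    apply: open_nbhs_nbhs; split; last by exists s.
    exact: chart_open_image cb _ oD.
  apply: filterS => _ [s' [ds' [_ dfs']] <-]; rewrite /H /= (chart_bwdK cb) //.
  by rewrite (slice_fwd rf dfs') /rvec row_mxEr mxE.
rewrite -(@derive_comp_linear _ _ _ _ (fun w : 'rV[R]_(n + n) => w 0 (rshift n k)) H) //.
- by rewrite (near_eq_derive _ E) derive_cst.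
- by move=> t u w; rewrite !mxE.
- exact: coord_continuous.
Qed.

(** Multiplication by [i a] sends a real point to an imaginary vector. *)
Lemma orbit_real c x f A : atlas c -> dom c x -> real_chart act f A S -> dom f x -> S x ->
  lsubmx (orbit_mx act c x *m J f c x) = 0.
Proof.
move=> ac dc rf df Sx; have z2 : (fwd f x).2 = 0 by apply/(rf.2 _ df).
apply/matrixP => r k; rewrite mxE [RHS]mxE.
have -> : (orbit_mx act c x *m J f c x) r (lshift n k) =
    ((delta_mx 0 r : 'rV[R]_n) *m orbit_mx act c x *m J f c x) 0 (lshift n k).
  by rewrite -mulmxA -rowE [RHS]mxE.
by rewrite (orbit_mx_std hact _ rf.1 df ac dc) /rvec row_mxEl rot_field1 z2 [(0 : 'rV[R]_n) 0 k]mxE mulr0 oppr0.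
Qed.

(** A point without zero coordinates in a standard chart has trivial stabilizer, which lies in every
    other one. A rotation field that vanishes there has [v *m A = 0], so its orbit has dimension
    [n]. *)
Lemma torus_cohomogeneity : (n + n)%N = m -> cohomogeneity act n.
Proof.
move=> nm; have [x0 _] := manifold_nonempty M.
have [x [f [A [_ sf dx zx]]]] := generic_dense ls openT (I : setT x0).
have [_ _ _ Au _] := sf.
exists x, n; split => //.
- move=> y t [tt tx]; have /torusP[a tE] := tt; split => //.
  have -> : t = cone n by rewrite tE; apply: (free_moduli sf dx zx); rewrite /tact -tE.
  by case: hact.
- move=> c ac dc; apply/eqP/inj_row_free => v v0.
  have := orbit_mx_std hact v sf dx ac dc; rewrite v0 mul0mx.
  move=> /(congr1 (@cvec R n)); rewrite rvecK => E.
  rewrite -(mulmxK Au v); suff -> : v *m A = 0 by rewrite mul0mx.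
  apply/rowP => k; rewrite [RHS]mxE; have := zx k; rewrite /mod2.
  have := congr1 (fun z : C => z.1 0 k) E; have := congr1 (fun z : C => z.2 0 k) E.
  rewrite /= !mxE; move: (\sum_j _) (fwd f x) => w z /esym/eqP h2 /esym/eqP h1.
  rewrite oppr_eq0 in h1; move: h1 h2; rewrite !mulf_eq0.
  have [-> //|_] := eqVneq w 0 => /eqP -> /eqP ->.
  by rewrite expr0n addr0 eqxx.
Qed.

Variables (N : nat) (f : 'I_N -> chart M C) (A : 'I_N -> 'M[R]_n) (phi : 'I_N -> M -> R)
  (O : 'I_N -> set M).
Hypotheses (rf : forall i, real_chart act (f i) (A i) S)
  (bf : forall i, bump act (f i) (phi i) (O i)).

Lemma real_section_polar : (n + n)%N = m -> polar act (pullback_metric f phi).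
Proof.
move=> nm; exists n; split; first exact: torus_cohomogeneity.
exists Sigma, iota; split; first exact: incl_immersion.
- move=> x; have [a Sa] := real_str_meet rS (I : setT x).
  by exists (to_real s0 (tact act a x)); apply/(same_orbitP act); exists a; rewrite to_realK.
move=> s b c ab ac db dc.
rewrite mulmx_sumr mulmx_suml big1 // => i _.
have [_ _ cov z0] := bf i; have [df|/z0 ->] := cov (iota s); last first.
  by rewrite scale0r mulmx0 mul0mx.
rewrite -scalemxAr -scalemxAl; set T1 := tangent_mx _ _ _ _; set J1 := J _ _ _.
have -> : T1 *m (J1 *m J1^T) *m (orbit_mx act c (iota s))^T =
    (T1 *m J1) *m (orbit_mx act c (iota s) *m J1)^T by rewrite trmx_mul !mulmxA.
have r0 := tangent_real ab ac db dc (rf i) df.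
have l0 := orbit_real ac dc (rf i) df (incl_in s).
by rewrite (mulmx_orthogonal r0 l0) scaler0.
Qed.

End RealSection.

Theorem theorem1 (R : realType) (n : nat) (M : manifold R (2 * n))
    (act : Cn n -> M -> M) (hM : quasitoric act) :
  exists g : chart M 'rV[R]_(2 * n) -> M -> 'M[R]_(2 * n),
    [/\ riemannian_metric g,
        forall t, torus t -> isometric g (act t)
      & polar act g].
Proof.
have [hact cM ls [P [proj [[pP _ _] [cproj PE] oproj fproj faces]]]] := hM.
rewrite -{}PE in pP oproj faces.
have [S rS] := real_str_global hact cM ls cproj oproj fproj (polytope_cvx pP).
have [x0 _] := manifold_nonempty M.
have [a0 Sa0] := real_str_meet rS (I : setT x0).
pose s0 : real_points S := SigSub (mem_set Sa0).
have fixed : exists x, forall a, tact act a x = x.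
  have [|_ [x _ <-] fv] := polytope_vertex pP; first by exists (proj x0); exists x0.
  have [k ok] := orbit_dim_exists hact x; have [F [fF dF [Fx H]]] := faces x k ok.
  (* The vertex is a face inside [F] that contains a point of the interior of [F], so it is all of
     [F]; hence the orbit over it has dimension 0. *)
  have FE : [set proj x] = F by apply: H => // _ ->.
  rewrite -FE in dF; rewrite (affine_dim_point dF) in ok.
  by exists x; exact: fixed_point.
have connT := real_points_connected cM rS cproj oproj fproj fixed.
(* The predicate selects charts in which [S] is the real part, so that each summand of the metric
   makes [S] orthogonal to the orbits. *)
have [|N [f [A [phi [Z [H pos]]]]]] := @finite_bumps R _ n M act hact
    (fun f _ => forall y, dom f y -> S y <-> (fwd f y).2 = 0) setT cM.
  by move=> x _; have [f [A [[sf Sf] dx]]] := rS x I; exists f, A.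
have sf i : std act (f i) (A i) by case: (H i).
have bf i : bump act (f i) (phi i) (Z i) by case: (H i).
have rf i : real_chart act (f i) (A i) S by case: (H i).
exists (pullback_metric f phi); split.
- by apply: (pullback_riemannian sf bf) => x; exact: pos.
- exact: (pullback_isometric hact sf bf).
- by apply: (real_section_polar hact ls rS s0 connT rf bf); rewrite addnn mul2n.
Qed.
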